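(* Let $R>0$ and $\mathbb{B}_R=\{(x,y)\in\mathbb{R}^2: x^2+y^2<R^2\}$. For a real-valued Dirichlet eigenfunction $u$ of the Laplacian on $\mathbb{B}_R$ with eigenvalue $\lambda$, let $\mathcal{N}(u)=\{x\in\mathbb{B}_R: u(x)=0\}$ be its nodal set in the interior and $\mathcal{H}^1$ the $1$-dimensional Hausdorff measure. Then, with the liminf and limsup taken over all such eigenfunctions as $\lambda\to\infty$, $$H_1(\mathbb{B}_R)=\liminf_{\lambda\to\infty}\frac{\mathcal{H}^1(\mathcal{N}(u))}{\sqrt\lambda}=R^2=\frac1\pi\,\mathrm{Area}(\mathbb{B}_R)$$ and $$H_2(\mathbb{B}_R)=\limsup_{\lambda\to\infty}\frac{\mathcal{H}^1(\mathcal{N}(u))}{\sqrt\lambda}=2R^2=\frac2\pi\,\mathrm{Area}(\mathbb{B}_R).$$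
   Context: A Dirichlet eigenfunction with eigenvalue $\lambda$ is a function $u\not\equiv 0$ with $-\Delta u=\lambda u$ in the disc and $u=0$ on the boundary circle. The liminf over all eigenfunctions means $\lim_{\Lambda\to\infty}\inf\{\mathcal{H}^1(\mathcal{N}(u))/\sqrt\lambda\}$, the infimum being over all real-valued Dirichlet eigenfunctions $u$ with eigenvalue $\lambda\ge\Lambda$; the limsup is defined analogously with the supremum. *)

(* Defs.v *)
From HB Require Import structures.
From mathcomp Require Import all_boot all_order all_algebra.
From mathcomp Require Import all_classical all_reals all_analysis.

Set Implicit Arguments.
Unset Strict Implicit.
Unset Printing Implicit Defensive.

Import Order.TTheory GRing.Theory Num.Theory.
Import numFieldNormedType.Exports.

Local Open Scope classical_set_scope.
Local Open Scope ring_scope.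

(* The plane is R * R.  Its library norm is the sup norm: this gives the usual
   topology and the usual derivatives, but lengths must be computed with the
   Euclidean distance below. *)
Definition edist (R : realType) (p q : R * R) : R :=
  Num.sqrt ((p.1 - q.1) ^+ 2 + (p.2 - q.2) ^+ 2).

(* The outer maximum makes the diameter of the empty set 0 rather than -oo. *)
Definition ediam (R : realType) (A : set (R * R)) : \bar R :=
  maxe 0%E
    (ereal_sup [set e | exists p q, [/\ A p, A q & e = (edist p q)%:E]]).

(* Coverings are sequences; finite ones are padded with the empty set. *)
Definition hausdorff1_pre (R : realType) (delta : R) (A : set (R * R)) :
    \bar R :=
  ereal_inf [set e | exists U : nat -> set (R * R),
    [/\ A `<=` \bigcup_k U k,
        forall k, (ediam (U k) <= delta%:E)%E
      & e = (\sum_(0 <= k <oo) ediam (U k))%E]].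

Definition hausdorff1 (R : realType) (A : set (R * R)) : \bar R :=
  ereal_sup [set e | exists2 delta : R,
    0 < delta & e = hausdorff1_pre delta A].

Definition disc (R : realType) (r : R) : set (R * R) :=
  [set p | p.1 ^+ 2 + p.2 ^+ 2 < r ^+ 2].

Definition closed_disc (R : realType) (r : R) : set (R * R) :=
  [set p | p.1 ^+ 2 + p.2 ^+ 2 <= r ^+ 2].

Definition circle (R : realType) (r : R) : set (R * R) :=
  [set p | p.1 ^+ 2 + p.2 ^+ 2 = r ^+ 2].

Definition area (R : realType) (A : set (R * R)) : \bar R :=
  (lebesgue_measure \x lebesgue_measure)%E A.

Definition basis_vec (R : realType) (i : bool) : R * R :=
  if i then (0, 1) else (1, 0).

Definition pderiv (R : realType) (i : bool) (u : R * R -> R) : R * R -> R :=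
  fun p => 'D_(basis_vec R i) u p.

Definition C1_on (R : realType) (D : set (R * R)) (u : R * R -> R) : Prop :=
  forall p, D p ->
    {for p, continuous u} /\
    forall i, derivable u p (basis_vec R i) /\ {for p, continuous (pderiv i u)}.

Definition C2_on (R : realType) (D : set (R * R)) (u : R * R -> R) : Prop :=
  C1_on D u /\ forall i, C1_on D (pderiv i u).

Definition laplacian (R : realType) (u : R * R -> R) : R * R -> R :=
  fun p => pderiv false (pderiv false u) p + pderiv true (pderiv true u) p.

(* Classical solutions, C^2 inside and continuous up to the boundary; the values
   of u outside the closed disc are irrelevant. *)
Definition dirichlet_eigenfunction (R : realType) (r lambda : R)
    (u : R * R -> R) : Prop :=
  [/\ C2_on (disc r) u,
      {within closed_disc r, continuous u},
      forall p, disc r p -> - laplacian u p = lambda * u p,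
      forall p, circle r p -> u p = 0
    & exists2 p, disc r p & u p != 0].

Definition nodal_set (R : realType) (r : R) (u : R * R -> R) : set (R * R) :=
  [set p | disc r p /\ u p = 0].

Definition nodal_ratios (R : realType) (r Lambda : R) : set (\bar R) :=
  [set e | exists lambda u,
    [/\ Lambda <= lambda, dirichlet_eigenfunction r lambda u
      & e = (hausdorff1 (nodal_set r u) * (Num.sqrt lambda)^-1%:E)%E]].

Definition H1_disc (R : realType) (r : R) : \bar R :=
  lim (ereal_inf (nodal_ratios r Lambda) @[Lambda --> +oo]).

Definition H2_disc (R : realType) (r : R) : \bar R :=
  lim (ereal_sup (nodal_ratios r Lambda) @[Lambda --> +oo]).

(* Main.v *)
Require Import Defs.
From HB Require Import structures.
From mathcomp Require Import all_boot all_order all_algebra.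
From mathcomp Require Import all_classical all_reals all_analysis.
From mathcomp Require Import perm ring lra zify.

Set Implicit Arguments.
Unset Strict Implicit.
Unset Printing Implicit Defensive.

Import Order.TTheory GRing.Theory Num.Theory.
Import numFieldNormedType.Exports.

Local Open Scope classical_set_scope.
Local Open Scope ring_scope.

(* Expanding an eigenfunction [u] in Fourier modes on the circles centred at the
   origin, the coefficients solve Bessel's equation and are regular at the
   origin, so they are multiples of [J_m (k rho)], [k = sqrt lambda]; the boundary
   condition leaves only the modes with [J_m (k r) = 0].  There is only one of
   them (Bourget's hypothesis): writing [J_m x = (x / 2) ^ m * phi m (- x ^ 2 / 4)],
   Siegel's method shows that the nonzero zeros of [phi m] are transcendental,
   whereas the Lommel polynomials would make a nonzero common zero of [phi m] and
   [phi n] algebraic.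

   Hence [u = C J_m (k rho) cos (m theta + ph)].  Its nodal set consists of the
   circles of radius [z / k], [z] running over the zeros of [J_m] in [0, k r[, and
   of [2 m] radii, so that with [x = k r] the ratio of the theorem is
   [r ^ 2 (2 pi (\sum z) + 2 m x) / x ^ 2].  Sturm comparison controls the gaps
   between the zeros of [J_m]; comparing the sum with an integral, the numerator
   lies between [(1 - e) x ^ 2], for [x] large, and [2 x ^ 2].  The value [r ^ 2] is
   approached for [m = 1], and [2 r ^ 2] when [x] is the first zero of [J_m] and [m]
   tends to infinity, because that zero is asymptotic to [m]. *)

(** * Pointwise forms of the rules of differentiation *)

(** In the variable [- x ^ 2 / 4] the Taylor coefficients are rational with explicit denominators,
    and [phi n], [phi n.+1] satisfy a differential system with integer coefficients. Let [al] be a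
    nonzero algebraic zero of [phi n]. A form with integer polynomial coefficients, homogeneous in
    [phi n] and [phi n.+1], reduces at [al] to one polynomial value times a power of [phi n.+1 al],
    which is not zero; so do its iterates under [z d/dz]. The pigeonhole principle supplies such a
    form vanishing to a high order [K] at the origin. Its iterates up to order [J] are small at
    [al], and a Liouville inequality forces them to vanish there. The obstacle is to show that they
    cannot all vanish: a combination of them removes the Taylor coefficients of index [K + 1] to
    [K + J], and then the coefficient of index [K], a nonzero integer over known factorials, would
    be too small.

    For lengths, the obstacle is that circles and radii cross. Neighbourhoods of the crossings are
    cut out, which puts the remaining pieces at positive distance, and their size then tends to
    0. *)

Lemma derD (R : realType) (V : normedModType R) (f g : V -> R) (x v : V) (a b : R) :
  is_derive x v f a -> is_derive x v g b ->
  is_derive x v (fun y => f y + g y) (a + b).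
Proof. exact: is_deriveD. Qed.

Lemma derB (R : realType) (V : normedModType R) (f g : V -> R) (x v : V) (a b : R) :
  is_derive x v f a -> is_derive x v g b ->
  is_derive x v (fun y => f y - g y) (a - b).
Proof. exact: is_deriveB. Qed.

Lemma derN (R : realType) (V : normedModType R) (f : V -> R) (x v : V) (a : R) :
  is_derive x v f a -> is_derive x v (fun y => - f y) (- a).
Proof. exact: is_deriveN. Qed.

Lemma derM (R : realType) (V : normedModType R) (f g : V -> R) (x v : V) (a b : R) :
  is_derive x v f a -> is_derive x v g b ->
  is_derive x v (fun y => f y * g y) (a * g x + f x * b).
Proof.
move=> fa gb; apply: is_derive_eq (is_deriveM fa gb) _.
by rewrite /GRing.scale /= addrC mulrC.
Qed.

Lemma derC (R : realType) (V : normedModType R) (x v : V) (c : R) :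
  is_derive x v (fun=> c) 0.
Proof. exact: is_derive_cst. Qed.

Lemma derZ (R : realType) (V : normedModType R) (f : V -> R) (x v : V) (a c : R) :
  is_derive x v f a -> is_derive x v (fun y => c * f y) (c * a).
Proof.
move=> fa; apply: is_derive_eq (derM (derC x v c) fa) _.
by rewrite mul0r add0r.
Qed.

Lemma derX (R : realType) (V : normedModType R) (f : V -> R) (x v : V) (a : R)
    (n : nat) : is_derive x v f a ->
  is_derive x v (fun y => f y ^+ n) (n%:R * f x ^+ n.-1 * a).
Proof.
move=> fa; elim: n => [|n IH].
  rewrite !mul0r (_ : (fun y => f y ^+ 0) = cst 1); first exact: derC.
  by apply/funext => y; rewrite expr0.
rewrite (_ : (fun y => f y ^+ n.+1) = fun y => f y * f y ^+ n); last first.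
  by apply/funext => y; rewrite exprS.
apply: is_derive_eq (derM fa IH) _; rewrite -natr1.
by case: n {IH} => [|n] /=; rewrite ?expr0 ?exprS; ring.
Qed.

Lemma derI (R : realType) (x : R) : is_derive x 1 (fun y : R => y) 1.
Proof. exact: is_derive_id. Qed.

Lemma der_comp (R : realType) (f g : R -> R) (x a b : R) :
  is_derive (g x) 1 f a -> is_derive x 1 g b ->
  is_derive x 1 (fun y => f (g y)) (a * b).
Proof. exact: is_derive1_comp. Qed.

Lemma der_sum (R : realType) (V : normedModType R) (n : nat) (f : 'I_n -> V -> R)
    (x v : V) (a : 'I_n -> R) : (forall i, is_derive x v (f i) (a i)) ->
  is_derive x v (fun y => \sum_(i < n) f i y) (\sum_(i < n) a i).
Proof.
move=> fa; rewrite (_ : (fun y => _) = \sum_(i < n) f i); first exact: is_derive_sum.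
by apply/funext => y; rewrite fct_sumE.
Qed.

Lemma der_cvg (R : realType) (f : R -> R) (x a : R) :
  is_derive x 1 f a -> {for x, continuous f}.
Proof. by case=> fx _; exact/differentiable_continuous/derivable1_diffP. Qed.

(** * Entire power series with factorially small coefficients *)

Definition psum (R : realType) (c : nat -> R) (z : R) : R := limn (pseries c z).

(** One constant [A] serves as prefactor and as geometric rate, whence the exponent [k.+1]. The
    class is stable under formal differentiation, shift, Euler operator and linear combinations, and
    its series converge everywhere, so that [psum] is always a true sum. *)
Definition rapid (R : realType) (c : nat -> R) : Prop :=
  exists2 A : R, 1 <= A & forall k, `|c k| <= A ^+ k.+1 / k`!%:R.

Lemma factr_neq0 (R : realType) (k : nat) : k`!%:R != 0 :> R.
Proof. by rewrite pnatr_eq0 -lt0n fact_gt0. Qed.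

Lemma rapid_le_exp (R : realType) (c : nat -> R) (A z : R) : 0 <= A ->
  (forall k, `|c k| <= A ^+ k.+1 / k`!%:R) ->
  forall k, `|c k * z ^+ k| <= A * exp_coeff (A * `|z|) k.
Proof.
move=> A0 cA k; rewrite normrM normrX /exp_coeff /= exprMn.
rewrite (le_trans (ler_wpM2r (exprn_ge0 _ (normr_ge0 _)) (cA k)))//.
by rewrite exprS; lra.
Qed.

Lemma rapid_norm_cvg (R : realType) (c : nat -> R) (z : R) : rapid c ->
  cvgn [normed series (fun k => c k * z ^+ k)].
Proof.
case=> A A1 cA; have A0 : 0 <= A by lra.
apply: (@series_le_cvg _ _ (fun k => A * exp_coeff (A * `|z|) k)) => //=.
- by move=> k; rewrite mulr_ge0// exp_coeff_ge0// mulr_ge0.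
- by move=> k; exact: rapid_le_exp.
- exact/is_cvg_seriesZ/is_cvg_series_exp_coeff.
Qed.

Lemma rapid_cvg (R : realType) (c : nat -> R) (z : R) : rapid c ->
  cvgn (pseries c z).
Proof. by move=> cc; apply: normed_cvg; exact: rapid_norm_cvg. Qed.

Lemma rapid_diffs (R : realType) (c : nat -> R) :
  rapid c -> rapid (pseries_diffs c).
Proof.
case=> A A1 cA; exists (A ^+ 2); first by rewrite exprn_ege1.
move=> k; rewrite /pseries_diffs normrM ger0_norm//.
rewrite (le_trans (ler_wpM2l _ (cA _)))//.
have -> : k.+1%:R * (A ^+ k.+2 / k.+1`!%:R) = A ^+ k.+2 / k`!%:R.
  by rewrite factS natrM; field; rewrite factr_neq0 ?nat1r ?natr1 pnatr_eq0.
by rewrite ler_wpM2r// -exprM ler_weXn2l//; lia.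
Qed.

Lemma is_derive_psum (R : realType) (c : nat -> R) (z : R) : rapid c ->
  is_derive z 1 (psum c) (psum (pseries_diffs c) z).
Proof.
move=> cc; apply: (@pseries_snd_diffs _ _ (`|z| + 1)).
- exact: rapid_cvg.
- by apply: rapid_cvg; apply: rapid_diffs.
- by apply: rapid_cvg; do 2 apply: rapid_diffs.
- by rewrite [ltRHS]ger0_norm//; lra.
Qed.

Lemma rapidD (R : realType) (c d : nat -> R) :
  rapid c -> rapid d -> rapid (fun k => c k + d k).
Proof.
case=> A A1 cA [B B1 dB]; exists (A + B); first lra.
move=> k; rewrite (le_trans (ler_normD _ _))// (le_trans (lerD (cA k) (dB k)))//.
rewrite -mulrDl ler_wpM2r//.
have H : forall n, A ^+ n.+1 + B ^+ n.+1 <= (A + B) ^+ n.+1.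
  elim=> [|n IH]; first by rewrite !expr1.
  rewrite ![_ ^+ n.+2]exprS mulrDl lerD// ler_wpM2l//; try lra;
    (apply: le_trans IH; rewrite ?lerDl ?lerDr exprn_ge0//; lra).
exact: H.
Qed.

Lemma rapidZ (R : realType) (c : nat -> R) (a : R) :
  rapid c -> rapid (fun k => a * c k).
Proof.
case=> A A1 cA; exists ((`|a| + 1) * A).
  by rewrite -[1]mulr1 ler_pM//; have := normr_ge0 a; lra.
move=> k; rewrite normrM (le_trans (ler_wpM2l _ (cA k)))//.
rewrite mulrA ler_wpM2r// exprMn ler_wpM2r// ?exprn_ge0//; first lra.
rewrite exprS; have := normr_ge0 a; have : 1 <= (`|a| + 1) ^+ k.
  by rewrite exprn_ege1//; have := normr_ge0 a; lra.
by nra.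
Qed.

Lemma psumD (R : realType) (c d : nat -> R) (z : R) : rapid c -> rapid d ->
  psum (fun k => c k + d k) z = psum c z + psum d z.
Proof.
move=> cc dd; rewrite /psum /pseries -lim_seriesD//; try exact: rapid_cvg.
by congr (limn (series _)); apply/funext => k; rewrite /= mulrDl.
Qed.

Lemma psumZ (R : realType) (c : nat -> R) (a z : R) : rapid c ->
  psum (fun k => a * c k) z = a * psum c z.
Proof.
move=> cc; rewrite /psum /pseries.
transitivity (limn (series (a *: (fun k => c k * z ^+ k)))).
  by congr (limn (series _)); apply/funext => k; exact: (esym (mulrA _ _ _)).
by rewrite lim_seriesZ//; exact: rapid_cvg.
Qed.

(** The Euler operator [z d/dz] on coefficients. It keeps the index of each coefficient, unlike
    differentiation, hence also the order of vanishing at the origin. *)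
Definition theta (R : realType) (c : nat -> R) : nat -> R :=
  fun k => k%:R * c k.

Lemma rapid_theta (R : realType) (c : nat -> R) : rapid c -> rapid (theta c).
Proof.
case=> A A1 cA; exists (2 * A); first lra.
move=> k; rewrite /theta normrM ger0_norm//.
rewrite (le_trans (ler_wpM2l _ (cA _)))// mulrA ler_wpM2r//.
rewrite exprMn ler_wpM2r ?exprn_ge0//; first lra.
rewrite -natrX ler_nat; apply: leq_trans (ltnW (ltn_expl k.+1 (isT : (1 < 2)%N))).
exact: leqnSn.
Qed.

Definition seq_shift (R : realType) (c : nat -> R) : nat -> R :=
  fun k => if k is k'.+1 then c k' else 0.

Lemma rapid_shift (R : realType) (c : nat -> R) : rapid c -> rapid (seq_shift c).
Proof.
case=> A A1 cA; exists (2 * A); first lra.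
case=> [|k] /=; first by rewrite normr0 divr_ge0// expr1; lra.
rewrite (le_trans (cA _))// factS natrM invfM mulrA ler_wpM2r//.
rewrite ler_pdivlMr ?ltr0n// exprMn mulrC ler_pM ?exprn_ge0//; try lra.
  rewrite -natrX ler_nat; apply: leq_trans (ltnW (ltn_expl k.+2 (isT : (1 < 2)%N))).
  exact: leqnSn.
by rewrite ler_weXn2l.
Qed.

Lemma psum_shift (R : realType) (c : nat -> R) (z : R) : rapid c ->
  psum (seq_shift c) z = z * psum c z.
Proof.
move=> cc; rewrite -psumZ//; rewrite /psum.
have /cvg_ex[l cl] := rapid_cvg (z := z) (rapidZ z cc).
rewrite (cvg_lim _ cl)//; apply/cvg_lim => //; rewrite -cvg_shiftS.
apply: cvg_trans cl; apply: near_eq_cvg; apply: nearW => n.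
rewrite /pseries /series /= big_nat_recl//= mul0r add0r.
by apply: eq_bigr => k _; rewrite exprS; ring.
Qed.

Lemma psum_theta (R : realType) (c : nat -> R) (z : R) : rapid c ->
  psum (theta c) z = z * psum (pseries_diffs c) z.
Proof.
move=> cc; rewrite -psum_shift; last exact: rapid_diffs.
by congr psum; apply/funext => -[|k]; rewrite /theta /= ?mul0r.
Qed.

(** * Products of power series *)

Definition cauchy_prod (R : realType) (a b : nat -> R) : nat -> R :=
  fun k => \sum_(i < k.+1) a i * b (k - i)%N.

Lemma sum_cauchy_prod (R : realType) (a b : nat -> R) (n : nat) :
  \sum_(0 <= k < n) cauchy_prod a b k =
  \sum_(0 <= i < n) a i * \sum_(0 <= j < n - i) b j.
Proof.
elim: n => [|n IH]; first by rewrite !big_geq.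
rewrite big_nat_recr//= IH /cauchy_prod -(big_mkord xpredT (fun i => a i * b (n - i)%N)).
rewrite [RHS]big_nat_recr//= subSnn big_nat1 [in LHS]big_nat_recr//= subnn addrA.
congr (_ + _); rewrite -big_split /=; apply: eq_big_nat => i /andP[_ ni].
by rewrite subSn 1?ltnW// [in RHS]big_nat_recr//= mulrDr.
Qed.

(** The product of partial sums runs over a square of indices and the Cauchy product over the
    triangle [i + j < n] inside it. Both sides of the inequality are sums over what remains of the
    square, and the right one has the absolute values. *)
Lemma norm_sum_cauchy_prod_sub (R : realType) (a b : nat -> R) (n : nat) :
  `|(\sum_(0 <= k < n) a k) * (\sum_(0 <= k < n) b k) -
    \sum_(0 <= k < n) cauchy_prod a b k|
  <= (\sum_(0 <= k < n) `|a k|) * (\sum_(0 <= k < n) `|b k|) -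
     \sum_(0 <= k < n) cauchy_prod (fun k => `|a k|) (fun k => `|b k|) k.
Proof.
rewrite !sum_cauchy_prod !mulr_suml -!sumrB (le_trans (ler_norm_sum _ _ _))//.
apply: ler_sum_nat => i /andP[_ ni].
rewrite -!mulrBr normrM ler_wpM2l//.
have E (c : nat -> R) : \sum_(0 <= k < n) c k - \sum_(0 <= j < n - i) c j =
    \sum_(n - i <= k < n) c k.
  by rewrite (@big_cat_nat _ _ _ (n - i))//= ?leq_subr// addrAC subrr add0r.
by rewrite !E ler_norm_sum.
Qed.

(** For absolute values, the square of side [n] lies between the triangles of sides [n] and [2 n].
    The sums [T] over triangles and [P] over squares thus have the same limit, and [P - T] dominates
    the error for the signed series. *)
Lemma cvg_cauchy_prod (R : realType) (a b : nat -> R) :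
  cvgn [normed series a] -> cvgn [normed series b] ->
  series (cauchy_prod a b) @ \oo --> limn (series a) * limn (series b).
Proof.
move=> ca cb; set a' := (fun k => `|a k|); set b' := (fun k => `|b k|).
have a'0 k : 0 <= a' k by rewrite /a'.
have b'0 k : 0 <= b' k by rewrite /b'.
have c0 k : 0 <= cauchy_prod a' b' k by apply: sumr_ge0 => i _; rewrite mulr_ge0.
pose P n := series a' n * series b' n.
pose T n := series (cauchy_prod a' b') n.
have cP : P @ \oo --> limn (series a') * limn (series b') by apply: cvgM.
have TP n : T n <= P n.
  rewrite /T /P /series /= sum_cauchy_prod mulr_suml; apply: ler_sum_nat => i /andP[_ ni].
  by rewrite ler_wpM2l// [leRHS](@big_cat_nat _ _ _ (n - i))//= ?leq_subr// lerDl sumr_ge0.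
have PT n : P n <= T (n * 2)%N.
  rewrite /T /P /series /= sum_cauchy_prod mulr_suml.
  rewrite [leRHS](@big_cat_nat _ _ _ n)//=; last lia.
  rewrite ler_wpDr//; first by apply: sumr_ge0 => i _; rewrite mulr_ge0// sumr_ge0.
  apply: ler_sum_nat => i /andP[_ ni]; rewrite ler_wpM2l//.
  rewrite [leRHS](@big_cat_nat _ _ _ n)//=; last lia.
  by rewrite lerDl sumr_ge0.
have ndT : nondecreasing_seq T.
  by apply: (@nondecreasing_series _ (cauchy_prod a' b') xpredT 0%N) => n _ _; exact: c0.
have ndP : nondecreasing_seq P.
  move=> m n mn; rewrite /P ler_pM//; try by rewrite sumr_ge0.
    by apply: (@nondecreasing_series _ a' xpredT 0%N).
  by apply: (@nondecreasing_series _ b' xpredT 0%N).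
have cT : cvgn T.
  apply: nondecreasing_is_cvgn => //.
  exists (limn (series a') * limn (series b')) => _ [n _ <-].
  apply: le_trans (TP n) _; rewrite -(cvg_lim _ cP)//.
  by apply: nondecreasing_cvgn_le => //; apply/cvg_ex; eexists; exact: cP.
have cT2 : (T (n * 2)%N) @[n --> \oo] --> limn T.
  apply: (@cvg_comp _ _ _ (fun n => (n * 2)%N) T) cT.
  apply/cvgnyPge => N; near=> n.
  have : (N <= n)%N by near: n; exact: nbhs_infty_ge.
  by lia.
have cPT : P @ \oo --> limn T.
  by apply: (@squeeze_cvgr _ _ _ _ T (fun n => T (n * 2)%N)) => //; apply: nearW => n; rewrite TP PT.
have d0 : (P n - T n) @[n --> \oo] --> (0 : R).
  by rewrite -(subrr (limn T)); apply: cvgB.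
have cA : cvgn (series a) by exact: normed_cvg.
have cB : cvgn (series b) by exact: normed_cvg.
have cF : (series a n * series b n) @[n --> \oo] -->
    limn (series a) * limn (series b) by apply: cvgM.
have e0 : (series a n * series b n - series (cauchy_prod a b) n) @[n --> \oo] --> (0 : R).
  apply/norm_cvg0P; apply: (@squeeze_cvgr _ _ _ _ (cst 0) (fun n => P n - T n)) => //.
    apply: nearW => n; rewrite normr_ge0/=; exact: norm_sum_cauchy_prod_sub.
  exact: cvg_cst.
rewrite -[X in _ --> X]subr0.
have -> : series (cauchy_prod a b) = (fun n => series a n * series b n -
   (series a n * series b n - series (cauchy_prod a b) n)).
  by apply/funext => n; rewrite subKr.
exact: cvgB.
Unshelve. all: by end_near.
Qed.

Lemma psum_cauchy_prod (R : realType) (a b : nat -> R) (z : R) : rapid a -> rapid b ->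
  psum (cauchy_prod a b) z = psum a z * psum b z.
Proof.
move=> ra rb; apply/cvg_lim => //.
have -> : pseries (cauchy_prod a b) z =
    series (cauchy_prod (fun k => a k * z ^+ k) (fun k => b k * z ^+ k)).
  congr series; apply/funext => k; rewrite /= /cauchy_prod mulr_suml.
  apply: eq_bigr => i _; rewrite mulrACA -exprD subnKC//.
  by rewrite -ltnS.
by apply: cvg_cauchy_prod; exact: rapid_norm_cvg.
Qed.

Lemma psum0 (R : realType) (c : nat -> R) : psum c 0 = c 0%N.
Proof.
apply/cvg_lim => //; rewrite -cvg_shiftS.
apply: cvg_near_cst; apply: nearW => n.
rewrite /pseries /series /= big_nat_recl//= expr0 mulr1 big1_seq ?addr0// => i _.
by rewrite exprS mul0r mulr0.
Qed.

(* [J_n x = (x / 2) ^+ n * phi n (- x ^+ 2 / 4)]. *)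
Definition phi_coef (R : realType) (n k : nat) : R := (k`!%:R * (k + n)`!%:R)^-1.

Definition phi (R : realType) (n : nat) : R -> R := psum (phi_coef R n).

Lemma rapid_phi_coef (R : realType) (n : nat) : rapid (phi_coef R n).
Proof.
exists 1 => // k; rewrite /phi_coef expr1n mul1r ger0_norm ?invr_ge0 ?mulr_ge0//.
rewrite invfM ler_piMr ?invr_ge0// invf_le1 ?ltr0n ?fact_gt0//.
by rewrite ler1n fact_gt0.
Qed.

Lemma diffs_phi_coef (R : realType) (n : nat) :
  pseries_diffs (phi_coef R n) = phi_coef R n.+1.
Proof.
apply/funext => k; rewrite /pseries_diffs /phi_coef addSnnS factS natrM.
by field; rewrite !factr_neq0 ?nat1r ?natr1 pnatr_eq0.
Qed.

Lemma is_derive_phi (R : realType) (n : nat) (z : R) :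
  is_derive z 1 (@phi R n) (phi n.+1 z).
Proof. by rewrite /phi -diffs_phi_coef; apply: is_derive_psum; exact: rapid_phi_coef. Qed.

(** The three-term recurrence of the Bessel functions, checked on coefficients; the factor [z] acts
    as a shift. *)
Lemma phi_rec (R : realType) (n : nat) (z : R) :
  z * phi n.+2 z + n.+1%:R * phi n.+1 z = phi n z.
Proof.
rewrite /phi -psum_shift; last exact: rapid_phi_coef.
rewrite -psumZ; last exact: rapid_phi_coef.
rewrite -psumD; last 2 first.
- by apply: rapid_shift; exact: rapid_phi_coef.
- by apply: rapidZ; exact: rapid_phi_coef.
congr psum; apply/funext => -[|k]; rewrite /= /phi_coef.
  by rewrite add0r !add0n fact0 !mul1r factS natrM; field; rewrite factr_neq0 ?nat1r ?natr1 pnatr_eq0.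
have -> : (k.+1 + n.+1 = (k + n.+1).+1)%N by [].
have -> : (k + n.+2 = (k + n.+1).+1)%N by lia.
have -> : (k.+1 + n = k + n.+1)%N by lia.
rewrite !factS !natrM; have := factr_neq0 R k; have := factr_neq0 R (k + n.+1).
have : (k + n.+1).+1%:R != 0 :> R by rewrite pnatr_eq0.
have : k.+1%:R != 0 :> R by rewrite pnatr_eq0.
have -> : (k + n.+1).+1%:R = k.+1%:R + n.+1%:R :> R by rewrite -natrD; congr _%:R; lia.
move: (k.+1%:R : R) (n.+1%:R : R) (k`!%:R : R) ((k + n.+1)`!%:R : R) => a b x y.
by move=> a0 ab0 y0 x0; field; rewrite a0 ab0 y0 x0.
Qed.

Lemma phi0 (R : realType) (n : nat) : phi n 0 = n`!%:R^-1 :> R.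
Proof. by rewrite /phi psum0 /phi_coef fact0 mul1r add0n. Qed.

Lemma continuous_phi (R : realType) (n : nat) : continuous (@phi R n).
Proof.
by move=> z; exact: der_cvg (is_derive_phi n z).
Qed.

Lemma psum_tail (R : realType) (c : nat -> R) (z A B : R) (K : nat) :
  rapid c -> (forall i, `|c (K + i)%N * z ^+ (K + i)| <= A * (B ^+ i / i`!%:R)) ->
  `|psum c z - \sum_(0 <= m < K) c m * z ^+ m| <= A * expR B.
Proof.
move=> rc cAB.
have cz : (fun n => \sum_(0 <= m < n + K) c m * z ^+ m) @ \oo --> psum c z.
  by have := rapid_cvg (z := z) rc; rewrite -(cvg_shiftn K).
have cz' : (fun n => `|\sum_(0 <= m < n + K) c m * z ^+ m -
    \sum_(0 <= m < K) c m * z ^+ m|) @ \oo -->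
    `|psum c z - \sum_(0 <= m < K) c m * z ^+ m|.
  by apply: cvg_norm; apply: cvgB => //; exact: cvg_cst.
rewrite -(cvg_lim _ cz')//.
have ce : (fun n => A * series (exp_coeff B) n) @ \oo --> A * expR B.
  by apply: cvgMr; exact: is_cvg_series_exp_coeff.
rewrite -(cvg_lim _ ce)//; apply: ler_lim.
- by apply/cvg_ex; eexists; exact: cz'.
- by apply/cvg_ex; eexists; exact: ce.
- apply: nearW => n; rewrite /series /= (@big_cat_nat _ _ _ K)//= ?leq_addl//.
  rewrite [X in X - _]addrC addrK mulr_sumr.
  rewrite -{1}[K]add0n big_addn addnK (le_trans (ler_norm_sum _ _ _))//.
  by apply: ler_sum => i _; rewrite addnC; exact: cAB.
Qed.

(** By the recurrence, two consecutive functions vanishing at [z] would make all later ones vanish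
    there, whereas [m! phi m z] tends to 1. As [phi n.+1] is the derivative of [phi n], all zeros
    are simple. *)
Lemma phi_simple_zero (R : realType) (n : nat) (z : R) :
  phi n z = 0 -> phi n.+1 z != 0.
Proof.
move=> pn; apply/negP => /eqP pn1.
have z0 : z != 0.
  by apply/eqP => z0; move/eqP: pn; rewrite z0 phi0 invr_eq0 (negbTE (factr_neq0 _ _)).
have pk k : phi (n + k) z = 0 /\ phi (n + k).+1 z = 0.
  elim: k => [|k [IH1 IH2]]; first by rewrite addn0.
  rewrite addnS; split=> //; have := phi_rec (n + k) z.
  by rewrite IH1 IH2 mulr0 addr0 => /eqP; rewrite mulf_eq0 (negbTE z0) => /eqP.
(* [a / m.+1] bounds the terms of [m! phi m z] beyond the constant one, so any [m] with [a < m.+1]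
   gives the contradiction. *)
pose a := `|z| * expR `|z|; have a0 : 0 <= a by rewrite mulr_ge0// expR_ge0.
pose m := (n + Num.bound a)%N; have am : a < m.+1%:R.
  by rewrite (lt_le_trans (archi_boundP a0))// ler_nat /m; lia.
have := @psum_tail _ (phi_coef R m) z (`|z| / m.+1`!%:R) `|z| 1 (rapid_phi_coef R m).
rewrite -/(phi m z) (proj1 (pk _)) big_nat1 expr0 mulr1 sub0r normrN.
rewrite /phi_coef fact0 mul1r add0n => H.
have : `|(m`!%:R : R)^-1| <= `|z| / m.+1`!%:R * expR `|z|.
  apply: H => i; rewrite normrM normrX add1n exprS.
  rewrite ger0_norm ?invr_ge0 ?mulr_ge0// invfM.
  rewrite [leRHS](_ : _ = (i`!%:R^-1 * m.+1`!%:R^-1) * (`|z| * `|z| ^+ i)); last by ring.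
  rewrite ler_wpM2r ?mulr_ge0 ?exprn_ge0//.
  apply: ler_pM; rewrite ?invr_ge0// lef_pV2 ?posrE ?ltr0n ?fact_gt0// ler_nat.
    by rewrite factS leq_pmull.
  elim: i => [|i IH]; first by rewrite add1n.
  by rewrite [(i.+2 + m)%N]addSn factS (leq_trans IH)// leq_pmull.
rewrite ger0_norm ?invr_ge0// mulrAC -/a ler_pdivlMr ?ltr0n ?fact_gt0//.
rewrite factS natrM mulrCA mulVf ?factr_neq0// mulr1; lra.
Qed.

(** * Bourget's hypothesis: no common zeros of Bessel functions *)

(** The [(B + 1) ^ (2 M)] vectors with entries in [[0, B]] have images with entries in
    [[- off, off]], where [2 off = B ^ 2] by the choice [B = 4 M a]. That leaves [(B ^ 2 + 1) ^ M]
    images, which is fewer; the difference of two vectors with the same image is the solution. *)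
Lemma pigeonhole_int (M a : nat) (A : 'M[int]_(M, M * 2)) :
  (0 < M)%N -> (0 < a)%N -> (forall i j, `|A i j| <= a%:R) ->
  exists x : 'cV[int]_(M * 2),
    [/\ x != 0, A *m x = 0 & forall j, `|x j 0| <= (4 * M * a)%:R].
Proof.
move=> M0 a0 Aa; pose B := (4 * M * a)%N.
pose col (x : {ffun 'I_(M * 2) -> 'I_B.+1}) : 'cV[int]_(M * 2) :=
  \col_j (x j : nat)%:R.
pose off : int := (M * 2 * (a * B))%:R.
have rng x i : 0 <= (A *m col x) i 0 + off <= (B ^ 2)%:R.
  have : `|(A *m col x) i 0| <= off.
    rewrite mxE (le_trans (ler_norm_sum _ _ _))//.
    apply: (@le_trans _ _ (\sum_(j < M * 2) (a * B)%:R)).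
      apply: ler_sum => j _; rewrite mxE normrM natrM ler_pM// ger0_norm//.
      by rewrite ler_nat -ltnS.
    by rewrite sumr_const card_ord /off -[leLHS]mulr_natl -natrM.
  rewrite ler_norml => /andP[h1 h2]; apply/andP; split; first by lia.
  have -> : (B ^ 2)%:R = off + off :> int.
    by rewrite /off -natrD; congr _%:R; rewrite /B; lia.
  by rewrite lerD2r.
pose F (x : {ffun 'I_(M * 2) -> 'I_B.+1}) : {ffun 'I_M -> 'I_(B ^ 2).+1} :=
  [ffun i => inord `|((A *m col x) i 0 + off)%R|%N].
have [inj|] := boolP (injectiveb F).
  exfalso; have := leq_card F (injectiveP _ inj).
  rewrite !card_ffun !card_ord; apply/negP; rewrite -ltnNge.
  rewrite mulnC expnM ltn_exp2r//.
  have B0 : (0 < B)%N by rewrite /B; lia.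
  by rewrite !expnS !expn0; nia.
case/injectivePn => x [y xy Fxy]; exists (col x - col y); split.
- apply/eqP => /(congr1 (fun z => z + col y)); rewrite subrK add0r => E.
  case/eqP: xy; apply/ffunP => j; apply/val_inj => /=.
  by move/matrixP: E => /(_ j 0); rewrite !mxE => /eqP; rewrite eqr_nat => /eqP.
- apply/matrixP => i j; rewrite ord1 mulmxBr [LHS]mxE [X in _ + X]mxE [RHS]mxE.
  move/ffunP: Fxy => /(_ i); rewrite !ffunE => /(congr1 (@nat_of_ord _)).
  have P z : (`|((A *m col z) i 0 + off)%R| < (B ^ 2).+1)%N.
    by have := rng z i; lia.
  rewrite !inordK ?P// => E.
  have key (s t o : int) : 0 <= s + o -> 0 <= t + o ->
      `|(s + o)%R|%N = `|(t + o)%R|%N -> s - t = 0 by lia.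
  have /andP[h1 _] := rng x i; have /andP[h2 _] := rng y i.
  exact: (key _ _ off).
- move=> j; rewrite !mxE.
  have key (s t b : nat) : (s < b.+1)%N -> (t < b.+1)%N ->
    `|s%:R - t%:R| <= b%:R :> int by rewrite !natz; lia.
  exact: key.
Qed.

Lemma intr_norm_le (R : realType) (x : int) (b : nat) :
  `|x| <= b%:R -> `|x%:~R : R| <= b%:R.
Proof. by move=> xb; rewrite -intr_norm -(rmorph_nat intr) ler_int. Qed.

Definition mx_le (m n : nat) (X : 'M[int]_(m, n)) (b : nat) :=
  forall i j, `|X i j| <= b%:R.

Lemma mx_leM (m n p : nat) (X : 'M[int]_(m, n)) (Y : 'M[int]_(n, p)) (b c : nat) :
  mx_le X b -> mx_le Y c -> mx_le (X *m Y) (n * (b * c)).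
Proof.
move=> Xb Yc i j; rewrite mxE (le_trans (ler_norm_sum _ _ _))//.
apply: (@le_trans _ _ (\sum_(k < n) (b * c)%:R)).
  by apply: ler_sum => k _; rewrite normrM natrM ler_pM.
by rewrite sumr_const card_ord -[leLHS]mulr_natl -natrM.
Qed.

Lemma mx_leX (n : nat) (X : 'M[int]_n.+1) (b k : nat) :
  mx_le X b -> mx_le (X ^+ k) ((n.+1 * b) ^ k).
Proof.
move=> Xb; elim: k => [|k IH].
  by move=> i j; rewrite expr0 mxE expn0; case: eqP.
rewrite exprS expnS -mulnA; exact: mx_leM.
Qed.

Lemma det_le (n : nat) (X : 'M[int]_n) (b : nat) :
  mx_le X b -> `|\det X| <= (n`! * b ^ n)%:R.
Proof.
move=> Xb; rewrite /determinant (le_trans (ler_norm_sum _ _ _))//.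
apply: (@le_trans _ _ (\sum_(s : 'S_n) (b ^ n)%:R)).
  apply: ler_sum => s _; rewrite normrMsign normr_prod.
  apply: (@le_trans _ _ (\prod_(i < n) b%:R)).
    by apply: ler_prod => i _; rewrite normr_ge0 Xb.
  by rewrite prodr_const card_ord natrX.
by rewrite sumr_const card_Sn -[leLHS]mulr_natl -natrM.
Qed.

Lemma adj_le (n : nat) (X : 'M[int]_n.+1) (b : nat) :
  mx_le X b -> mx_le (\adj X) (n`! * b ^ n).
Proof.
move=> Xb i j; rewrite mxE /cofactor normrMsign; apply: det_le => k l.
by rewrite !mxE.
Qed.

Definition zhorner (R : realType) (p : {poly int}) (x : R) : R :=
  (map_poly intr p).[x].

Lemma zhornerE (R : realType) (p : {poly int}) (x : R) (n : nat) :
  (size p <= n)%N -> zhorner p x = \sum_(i < n) (p`_i)%:~R * x ^+ i.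
Proof.
move=> pn; rewrite /zhorner (@horner_coef_wide _ n).
  by apply: eq_bigr => i _; rewrite coef_map.
by rewrite (leq_trans (size_poly _ _)).
Qed.

(** A polynomial of least degree among the nonzero integer ones that vanish at [al] plays the part
    of the minimal polynomial. Degree [d.+1] is at least 1 because a nonzero constant does not
    vanish. *)
Lemma minimal_annihilator (R : realType) (al : R) (f : {poly int}) :
  f != 0 -> zhorner f al = 0 -> exists (d : nat) (g : {poly int}),
  [/\ size g = d.+2, zhorner g al = 0 &
      forall w : {poly int}, (size w <= d.+1)%N -> zhorner w al = 0 -> w = 0].
Proof.
move=> f0 fa.
pose P n := `[< exists2 g : {poly int}, g != 0 /\ zhorner g al = 0 & size g = n >].
have exP : exists n, P n by exists (size f); apply/asboolP; exists f.
case: (ex_minnP exP) => n /asboolP[g [g0 ga] sg] nmin.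
have n2 : (2 <= n)%N.
  case: n sg {nmin} => [/eqP|[|//] sg]; first by rewrite size_poly_eq0 (negbTE g0).
  move: ga; rewrite (@zhornerE _ _ _ 1) ?sg// big_ord1 expr0 mulr1 => /eqP.
  rewrite intr_eq0 => g00; move: g0; rewrite -lead_coef_eq0 lead_coefE sg.
  by rewrite g00.
exists n.-2, g; split => //; first by lia.
move=> w sw wa; apply/eqP; apply/negPn/negP => w0.
have : P (size w) by apply/asboolP; exists w.
by move=> /nmin; lia.
Qed.

(** The matrix [A] is multiplication by [a al] on the powers of [al] up to [d], a companion matrix
    cleared of denominators, and [Bh] is multiplication by [a ^ T B(al)]. The determinant of [Bh] is
    a nonzero integer; the adjugate writes it as [a ^ T B(al)] times a sum that involves the [d]-th
    power of the height of [B], whence [h = d]. *)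
Lemma liouville (R : realType) (al : R) (f : {poly int}) :
  f != 0 -> zhorner f al = 0 -> exists h C : nat, (0 < C)%N /\
  forall (B : {poly int}) (T H : nat), (size B <= T.+1)%N ->
    (forall k, `|B`_k| <= H%:R) -> zhorner B al != 0 ->
    1 <= `|zhorner B al| * (H ^ h * C ^ T.+1)%:R.
Proof.
move=> f0 fa; have [d [g [sg ga gmin]]] := minimal_annihilator f0 fa.
pose a := lead_coef g.
pose A : 'M[int]_d.+1 := \matrix_(i, j)
  (if (i < d)%N then a * ((j == i.+1 :> nat)%:R) else - g`_j).
pose v : 'cV[R]_d.+1 := \col_i al ^+ i.
have Av : map_mx intr A *m v = (a%:~R * al) *: v.
  apply/matrixP => i j; rewrite ord1 !mxE.
  case: (ltnP i d) => id.
    rewrite (bigD1 (inord i.+1)) //= !mxE inordK ?ltnS// id eqxx mulr1.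
    rewrite big1 ?addr0; first by rewrite exprS mulrA.
    move=> k; rewrite !mxE id => /eqP ki.
    case: eqP => [E|_]; last by rewrite mulr0 mul0r.
    by exfalso; apply: ki; apply/val_inj; rewrite /= inordK ?ltnS.
  have -> : i = d :> nat by have := ltn_ord i; lia.
  move: ga; rewrite (@zhornerE _ _ _ d.+2) ?sg// big_ord_recr /=.
  have -> : g`_(d.+1) = a by rewrite /a lead_coefE sg.
  rewrite -mulrA -exprS => /eqP; rewrite addrC addr_eq0 => /eqP ->.
  rewrite -sumrN; apply: eq_bigr => k _; rewrite !mxE ltnNge id /=.
  by rewrite rmorphN mulNr.
have [m m1 Am] : exists2 m : nat, (0 < m)%N & mx_le A m /\ `|a| <= m%:R.
  exists ((\sum_i \sum_j `|A i j|) + `|a| + 1)%N; first by rewrite addn1.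
  split; last by rewrite natz; lia.
  move=> i j; rewrite (bigD1 i)//= (bigD1 j)//= natz; lia.
have Apow l : map_mx intr (A ^+ l) *m v = (a%:~R * al) ^+ l *: v.
  elim: l => [|l IH]; first by rewrite !expr0 map_mx1 mul1mx scale1r.
  by rewrite exprSr map_mxM -mulmxA Av -scalemxAr IH scalerA exprS.
pose V := \sum_(i < d.+1) `|v i 0|.
have [W VW] : exists W : nat, V <= W%:R.
  exists (Num.bound V); have V0 : 0 <= V by apply: sumr_ge0.
  by rewrite ltW// archi_boundP.
pose C0 := (2 * (m + d.+1 * m))%N.
pose C := (m * (W.+1 * (d`! * C0 ^ d).+1))%N.
have C00 : (0 < C0)%N by rewrite /C0; lia.
exists d, C; split; first by rewrite /C !muln_gt0 m1.
move=> B T H sB BH Bal.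
(* Each term [B_l al ^ l] receives [a ^ T], of which [a ^ l] goes with [al ^ l]: entries stay
   integral even if [al] is not an algebraic integer. *)
pose Bh : 'M[int]_d.+1 := \sum_(l < T.+1) (B`_l * a ^+ (T - l)) *: A ^+ l.
have Bhv : map_mx intr Bh *m v = (a%:~R ^+ T * zhorner B al) *: v.
  rewrite /Bh raddf_sum /= mulmx_suml (zhornerE _ sB) mulr_sumr scaler_suml.
  apply: eq_bigr => l _; rewrite map_mxZ -scalemxAl Apow scalerA; congr (_ *: _).
  have aT : a%:~R ^+ T = a%:~R ^+ (T - l) * a%:~R ^+ l :> R.
    by rewrite -exprD subnK// -ltnS.
  by rewrite rmorphM rmorphXn /= exprMn aT; ring.
have H1 : (0 < H)%N.
  case: H BH => // BH; exfalso; move: Bal; rewrite (zhornerE _ sB) big1 ?eqxx//.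
  by move=> i _; have := BH i; rewrite normr_le0 => /eqP ->; rewrite mul0r.
have a0 : a != 0 by rewrite lead_coef_eq0 -size_poly_eq0 sg.
have Bhb : mx_le Bh (H * C0 ^ T.+1).
  move=> i j; rewrite summxE (le_trans (ler_norm_sum _ _ _))//.
  apply: (@le_trans _ _ (\sum_(l < T.+1) (H * (m + d.+1 * m) ^ T)%:R)).
    apply: ler_sum => l _; rewrite mxE !normrM normrX.
    have -> : ((m + d.+1 * m) ^ T)%N =
        ((m + d.+1 * m) ^ (T - l) * (m + d.+1 * m) ^ l)%N.
      by rewrite -expnD subnK// -ltnS.
    rewrite mulnA !natrM; apply: ler_pM; rewrite ?mulr_ge0 ?exprn_ge0//.
      apply: ler_pM; rewrite ?exprn_ge0//.
      rewrite natrX; apply: lerXn2r; rewrite ?nnegrE//.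
      by rewrite (le_trans (proj2 Am))// ler_nat leq_addr.
    apply: le_trans (mx_leX _ (proj1 Am) _ _) _.
    by rewrite ler_nat; case: (nat_of_ord l) => [//|l']; rewrite leq_exp2r// leq_addl.
  rewrite sumr_const card_ord -[leLHS]mulr_natl -natrM ler_nat mulnCA leq_mul2l.
  apply/orP; right; rewrite /C0 expnMn; apply: leq_mul.
    exact: ltnW (ltn_expl _ _).
  by rewrite leq_pexp2l//; lia.
(* A row vector killed by [Bh] is a polynomial of degree at most [d] vanishing at [al], hence zero
   by minimality. *)
have detB : \det Bh != 0.
  apply/negP => /det0P[w w0 wB]; case/eqP: w0.
  have : zhorner (rVpoly w) al = 0.
    have : (map_mx intr w *m (map_mx intr Bh *m v)) 0 0 = 0.
      by rewrite mulmxA -map_mxM wB map_mx0 mul0mx mxE.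
    rewrite Bhv -scalemxAr mxE => /eqP; rewrite mulf_eq0 mulf_eq0 (negbTE Bal).
    rewrite expf_eq0 intr_eq0 (negbTE a0) andbF/= => /eqP E.
    rewrite -E (@zhornerE _ _ _ d.+1) ?size_poly// mxE.
    apply: eq_bigr => i _; rewrite !mxE coef_rVpoly_ord//.
  move=> wal; have wp0 : rVpoly w = 0 by apply: gmin wal; exact: size_poly.
  by apply/rowP => i; have := coef_rVpoly_ord w i; rewrite wp0 coef0 mxE => <-.
have det1 : 1 <= `|\det Bh| by rewrite -gtz0_ge1 normr_gt0.
have E : (\det Bh)%:~R = a%:~R ^+ T * zhorner B al *
    \sum_k ((\adj Bh) 0 k)%:~R * v k 0.
  have : (map_mx intr (\adj Bh *m Bh) *m v) 0 0 =
    a%:~R ^+ T * zhorner B al * \sum_k ((\adj Bh) 0 k)%:~R * v k 0.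
    rewrite map_mxM -mulmxA Bhv -scalemxAr [LHS]mxE; congr (_ * _).
    by rewrite mxE; apply: eq_bigr => k _; rewrite mxE.
  move=> <-; rewrite mul_adj_mx map_scalar_mx mul_scalar_mx !mxE.
  by rewrite expr0 mulr1.
have : (1 : R) <= `|(\det Bh)%:~R|.
  by rewrite -intr_norm (_ : 1 = 1%:~R)// ler_int.
rewrite E !normrM => /le_trans; apply.
rewrite [leLHS]mulrAC mulrC ler_wpM2l//.
apply: (@le_trans _ _ (m%:R ^+ T * ((d`! * (H * C0 ^ T.+1) ^ d)%:R * W%:R))).
  apply: ler_pM => //.
    rewrite normrX; apply: lerXn2r; rewrite ?nnegrE//.
    by apply: intr_norm_le; exact: (proj2 Am).
  rewrite (le_trans (ler_norm_sum _ _ _))//.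
  apply: le_trans (_ : _ <= (d`! * (H * C0 ^ T.+1) ^ d)%:R * V) _; last first.
    by rewrite ler_wpM2l.
  rewrite /V mulr_sumr; apply: ler_sum => k _; rewrite normrM ler_wpM2r//.
  by apply: intr_norm_le; exact: adj_le.
rewrite -natrX -!natrM ler_nat.
rewrite [leqRHS](_ : _ = H ^ d * (m ^ T.+1 * ((W.+1 ^ T.+1) * (d`! * C0 ^ d).+1 ^ T.+1)))%N; last first.
  by rewrite /C !expnMn.
rewrite (expnMn H); have -> : (m ^ T * (d`! * (H ^ d * (C0 ^ T.+1) ^ d) * W) =
  H ^ d * (m ^ T * (W * (d`! * (C0 ^ d) ^ T.+1))))%N.
  by rewrite -!expnM [(T.+1 * d)%N]mulnC; lia.
rewrite leq_mul2l; apply/orP; right; apply: leq_mul; first by rewrite leq_pexp2l.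
apply: leq_mul; first by rewrite (leq_trans (leqnSn _))// -{1}(expn1 W.+1) leq_pexp2l.
apply: leq_trans (_ : (d`! * C0 ^ d) ^ T.+1 <= _)%N; last by rewrite leq_exp2r.
by rewrite expnMn leq_mul2r -{1}(expn1 (d`!)) leq_pexp2l ?fact_gt0 ?orbT.
Qed.

(* Integrality and growth of the Taylor coefficients of products of the [phi n],
   the analogue of Siegel's E-functions in the variable [- x ^+ 2 / 4]. *)
Definition Eseries (R : realType) (p : nat) (c : nat -> R) : Prop :=
  exists (g : nat -> int) (C : nat), (0 < C)%N /\
  forall k, c k = (g k)%:~R / (k`!%:R * (k + p)`!%:R) /\
            `|g k| <= (C ^ k.+1)%:R.

Lemma bin_le_exp2 (n k : nat) : ('C(n, k) <= 2 ^ n)%N.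
Proof.
elim: n k => [|n IH] [|k]; rewrite ?bin0 ?expn_gt0//.
by rewrite binS expnS mul2n -addnn leq_add.
Qed.

Lemma Eseries_rapid (R : realType) (p : nat) (c : nat -> R) :
  Eseries p c -> rapid c.
Proof.
case=> g [C [C0 H]]; exists C%:R; first by rewrite ler1n.
move=> k; have [-> gk] := H k; rewrite normrM normfV (ger0_norm (mulr_ge0 _ _))//.
rewrite invfM mulrA -[leRHS]mulr1 ler_pM ?mulr_ge0//.
  by rewrite ler_wpM2r// -natrX; exact: intr_norm_le.
by rewrite invf_le1 ?ltr0n ?fact_gt0// ler1n fact_gt0.
Qed.

Lemma Eseries_phi (R : realType) (n : nat) : Eseries n (phi_coef R n).
Proof.
by exists (fun=> 1), 1%N; split=> // k; rewrite exp1n /phi_coef mul1r.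
Qed.

(** The additional factor [k + p + 1] of the denominator is put back into the integer [g k], where a
    power of 2 dominates it. *)
Lemma EseriesS (R : realType) (p : nat) (c : nat -> R) :
  Eseries p c -> Eseries p.+1 c.
Proof.
case=> g [C [C0 H]]; exists (fun k => g k * (k + p).+1%:R), (C * 2 ^ p.+1)%N.
split=> [|k]; first by rewrite muln_gt0 C0 expn_gt0.
have [-> gk] := H k; split.
  rewrite addnS factS natrM rmorphM /= rmorph_nat.
  have := factr_neq0 R k; have := factr_neq0 R (k + p).
  have : (k + p).+1%:R != 0 :> R by rewrite pnatr_eq0.
  move: ((k + p).+1%:R : R) ((k + p)`!%:R : R) (k`!%:R : R) => a b d a0 b0 d0.
  by field; rewrite a0 b0 d0.
rewrite normrM expnMn natrM ler_pM// ger0_norm// ler_nat -expnM.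
apply: leq_trans (_ : 2 ^ (k + p).+1 <= _)%N.
  exact: ltnW (ltn_expl _ _).
by rewrite leq_pexp2l//; lia.
Qed.

Lemma Eseries_le (R : realType) (p q : nat) (c : nat -> R) :
  (p <= q)%N -> Eseries p c -> Eseries q c.
Proof.
move=> /subnKC <-; elim: (q - p)%N => [|d IH] cp; first by rewrite addn0.
by rewrite addnS; apply: EseriesS; exact: IH.
Qed.

(** The factorials of indices [i] and [k - i] combine into those of index [k] at the price of two
    binomial coefficients. Denominators therefore keep their shape, and only a geometric factor is
    lost. *)
Lemma Eseries_cauchy_prod (R : realType) (p q : nat) (c d : nat -> R) :
  Eseries p c -> Eseries q d -> Eseries (p + q) (cauchy_prod c d).
Proof.
case=> g [C [C0 cg]] [f [D [D0 df]]].
exists (fun k => \sum_(i < k.+1) g i * f (k - i)%N *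
   ('C(k, i) * 'C(k + (p + q), i + p))%:R), (C * D * (2 * 4 * 2 ^ (p + q)))%N.
split=> [|k]; first by rewrite !muln_gt0 C0 D0 expn_gt0.
split.
  rewrite rmorph_sum mulr_suml; apply: eq_bigr => i _.
  have [-> _] := cg i; have [-> _] := df (k - i)%N.
  have ik : (i <= k)%N by rewrite -ltnS.
  rewrite -(bin_fact ik) -(@bin_fact (k + (p + q)) (i + p)); last lia.
  have -> : (k + (p + q) - (i + p) = k - i + q)%N by lia.
  rewrite !natrM !rmorphM /= !rmorph_nat.
  have B0 a b : (b <= a)%N -> 'C(a, b)%:R != 0 :> R.
    by move=> ba; rewrite pnatr_eq0 -lt0n bin_gt0.
  have := B0 _ _ ik; have /B0 : (i + p <= k + (p + q))%N by lia.
  have := factr_neq0 R i; have := factr_neq0 R (k - i).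
  have := factr_neq0 R (i + p); have := factr_neq0 R (k - i + q).
  move: ('C(k, i)%:R : R) ('C(k + (p + q), i + p)%:R : R) (i`!%:R : R)
    ((k - i)`!%:R : R) ((i + p)`!%:R : R) ((k - i + q)`!%:R : R) => *.
  by field; do ! (apply/andP; split).
rewrite (le_trans (ler_norm_sum _ _ _))//.
apply: (@le_trans _ _ (\sum_(i < k.+1)
   ((C * D) ^ k.+1 * (2 ^ k * 2 ^ (k + (p + q))))%:R)).
  apply: ler_sum => i _; have [_ gi] := cg i; have [_ fi] := df (k - i)%N.
  rewrite normrM [leRHS]natrM; apply: ler_pM => //; last first.
    by rewrite ger0_norm// ler_nat leq_mul// bin_le_exp2.
  rewrite normrM expnMn natrM; apply: ler_pM => //.
    by rewrite (le_trans gi)// ler_nat leq_pexp2l//.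
  by rewrite (le_trans fi)// ler_nat leq_pexp2l// ltnS leq_subr.
rewrite sumr_const card_ord -[leLHS]mulr_natl -natrM ler_nat.
rewrite mulnCA [leqRHS]expnMn leq_mul2l; apply/orP; right.
rewrite [leqRHS]expnMn [X in (_ <= X * _)%N]expnMn -mulnA; apply: leq_mul.
  exact: ltnW (ltn_expl _ _).
rewrite (_ : 4 = 2 ^ 2)%N// -!expnM -!expnD leq_pexp2l//; lia.
Qed.

Definition seq1 (R : realType) : nat -> R := fun k => (k == 0%N)%:R.

Definition cauchy_exp (R : realType) (c : nat -> R) (i : nat) : nat -> R :=
  iter i (cauchy_prod c) (seq1 R).

Lemma Eseries1 (R : realType) : Eseries 0 (seq1 R).
Proof.
exists (fun k => (k == 0%N)%:R), 1%N; split=> // k; rewrite exp1n /seq1.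
by case: k => [|k]; rewrite ?eqxx ?mul0r// addn0 fact0 !mulr1 divr1.
Qed.

Lemma psum1 (R : realType) (z : R) : psum (seq1 R) z = 1.
Proof.
apply/cvg_lim => //; rewrite -cvg_shiftS; apply: cvg_near_cst; apply: nearW => n.
rewrite /pseries /series /= big_nat_recl//= expr0 mulr1 big1_seq ?addr0// => i _.
by rewrite /seq1 /= mul0r.
Qed.

Lemma Eseries_cauchy_exp (R : realType) (p i : nat) (c : nat -> R) :
  Eseries p c -> Eseries (p * i) (cauchy_exp c i).
Proof.
move=> cp; elim: i => [|i IH]; first by rewrite muln0; exact: Eseries1.
by rewrite mulnS; exact: Eseries_cauchy_prod.
Qed.

Lemma psum_cauchy_exp (R : realType) (c : nat -> R) (i : nat) (z : R) (p : nat) :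
  Eseries p c -> psum (cauchy_exp c i) z = psum c z ^+ i.
Proof.
move=> cp; elim: i => [|i IH]; first by rewrite expr0 psum1.
rewrite exprS -IH /= psum_cauchy_prod//; first exact: Eseries_rapid cp.
exact: Eseries_rapid (Eseries_cauchy_exp i cp).
Qed.

Definition monomial_seq (R : realType) (n nu i : nat) : nat -> R :=
  cauchy_prod (cauchy_exp (phi_coef R n) i) (cauchy_exp (phi_coef R n.+1) (nu - i)).

(** The index [n.+1 * nu] is independent of [i]: all monomials of degree [nu] share one denominator,
    and so do their combinations. *)
Lemma Eseries_monomial (R : realType) (n nu i : nat) : (i <= nu)%N ->
  Eseries (n.+1 * nu) (monomial_seq R n nu i).
Proof.
move=> inu.
apply: (@Eseries_le _ (n * i + n.+1 * (nu - i))); first nia.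
by apply: Eseries_cauchy_prod; apply: Eseries_cauchy_exp; exact: Eseries_phi.
Qed.

Lemma psum_monomial (R : realType) (n nu i : nat) (z : R) :
  psum (monomial_seq R n nu i) z = phi n z ^+ i * phi n.+1 z ^+ (nu - i).
Proof.
have E m k := Eseries_cauchy_exp k (Eseries_phi R m).
rewrite psum_cauchy_prod; try exact: Eseries_rapid (E _ _).
by rewrite !(psum_cauchy_exp _ _ (Eseries_phi _ _)).
Qed.

Lemma psum_iter_shift (R : realType) (c : nat -> R) (l : nat) (z : R) :
  rapid c -> rapid (iter l (@seq_shift R) c) /\
  psum (iter l (@seq_shift R) c) z = z ^+ l * psum c z.
Proof.
move=> cc; elim: l => [|l [IH1 IH2]]; first by rewrite expr0 mul1r.
by split; [exact: rapid_shift|rewrite /= psum_shift// IH2 mulrA exprS].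
Qed.

Lemma iter_shiftE (R : realType) (c : nat -> R) (l k : nat) :
  iter l (@seq_shift R) c k = if (l <= k)%N then c (k - l)%N else 0.
Proof.
elim: l k => [|l IH] k /=; first by rewrite subn0.
by case: k => [|k] //=; rewrite IH ltnS subSS.
Qed.

(* [P : nat -> {poly int}] stands for the form [\sum_(i <= nu) P i X^i Y^(nu-i)],
   evaluated at [X = phi n], [Y = phi n.+1]; [thetaP] is the operator [z d/dz]
   computed with [z phi(n+2) = phi n - (n+1) phi(n+1)]. *)
Definition evalP (R : realType) (n nu : nat) (P : nat -> {poly int}) (z : R) : R :=
  \sum_(i < nu.+1) zhorner (P i) z * (phi n z ^+ i * phi n.+1 z ^+ (nu - i)).

Definition thetaP (n nu : nat) (P : nat -> {poly int}) (i : nat) : {poly int} :=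
  'X * (P i)^`() + ('X * P i.+1) *+ i.+1 +
  (if i is i'.+1 then P i' *+ (nu.+1 - i) else 0) - P i *+ (n.+1 * (nu - i)).

Lemma zhornerD (R : realType) (p q : {poly int}) (x : R) :
  zhorner (p + q) x = zhorner p x + zhorner q x.
Proof. by rewrite /zhorner rmorphD hornerD. Qed.

Lemma zhornerN (R : realType) (p : {poly int}) (x : R) :
  zhorner (- p) x = - zhorner p x.
Proof. by rewrite /zhorner rmorphN hornerN. Qed.

Lemma zhornerMn (R : realType) (p : {poly int}) (x : R) (k : nat) :
  zhorner (p *+ k) x = zhorner p x *+ k.
Proof. by rewrite /zhorner rmorphMn hornerMn. Qed.

Lemma zhornerXM (R : realType) (p : {poly int}) (x : R) :
  zhorner ('X * p) x = x * zhorner p x.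
Proof. by rewrite /zhorner rmorphM /= map_polyX hornerM hornerX. Qed.

Lemma zhorner0 (R : realType) (x : R) : zhorner 0 x = 0.
Proof. by rewrite /zhorner rmorph0 horner0. Qed.

Lemma is_derive_zhorner (R : realType) (p : {poly int}) (x : R) :
  is_derive x 1 (zhorner p) (zhorner p^`() x).
Proof.
rewrite /zhorner -deriv_map derivE derive1E.
by apply/derivableP; exact: derivable_horner.
Qed.

Lemma is_derive_evalP (R : realType) (n nu : nat) (P : nat -> {poly int}) (z : R) :
  (forall i, (nu < i)%N -> P i = 0) ->
  exists2 d, is_derive z 1 (evalP n nu P : R -> R) d &
             z * d = evalP n nu (thetaP n nu P) z.
Proof.
move=> Pnu.
pose f := @phi R n; pose g := @phi R n.+1.
pose t (i : nat) : R :=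
  zhorner (P i)^`() z * (f z ^+ i * g z ^+ (nu - i)) +
  zhorner (P i) z * ((i%:R * f z ^+ i.-1 * g z) * g z ^+ (nu - i) +
     f z ^+ i * ((nu - i)%:R * g z ^+ (nu - i).-1 * phi n.+2 z)).
have Df : is_derive z 1 f (g z) by exact: is_derive_phi.
have Dg : is_derive z 1 g (phi n.+2 z) by exact: is_derive_phi.
exists (\sum_(i < nu.+1) t i).
  apply: (der_sum (f := fun i : 'I_nu.+1 => fun y =>
    zhorner (P i) y * (f y ^+ i * g y ^+ (nu - i)))) => i.
  exact: derM (is_derive_zhorner (P i) z) (derM (derX i Df) (derX (nu - i) Dg)).
pose u (i : nat) : R := zhorner (P i) z.
have zrec : z * phi n.+2 z = f z - n.+1%:R * g z.
  by rewrite /f /g -(phi_rec n z); ring.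
rewrite /evalP /thetaP mulr_sumr.
pose A := \sum_(i < nu.+1) z * zhorner (P i)^`() z * (f z ^+ i * g z ^+ (nu - i)).
pose B := \sum_(i < nu.+1) i%:R * z * u i * (f z ^+ i.-1 * g z ^+ (nu - i).+1).
pose C := \sum_(i < nu.+1) (nu - i)%:R * u i * (f z ^+ i.+1 * g z ^+ (nu - i).-1).
pose D := \sum_(i < nu.+1) (n.+1 * (nu - i))%:R * u i * (f z ^+ i * g z ^+ (nu - i)).
transitivity (A + B + C - D).
  rewrite /A /B /C /D -!big_split -sumrB /=; apply: eq_bigr => i _.
  rewrite /t mulrDr mulrDr !mulrDr.
  rewrite (_ : z * (u i * (f z ^+ i * _)) = (nu - i)%:R * u i * (f z ^+ i * g z ^+ (nu - i).-1) *
     (z * phi n.+2 z)); last by rewrite /u; ring.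
  rewrite zrec natrM !exprS /u.
  case: (nu - i)%N => [|k] /=; first by rewrite !mul0r; ring.
  by rewrite exprS; ring.
(* In [B] and [C] the index is shifted by one. The sum from [B] gains a term with [P nu.+1 = 0], and
   [C] loses the term [i = nu], whose factor [nu - i] is 0. *)
transitivity (A + \sum_(i < nu.+1) (z * u i.+1 *+ i.+1 * (f z ^+ i * g z ^+ (nu - i)))
  + \sum_(i < nu.+1) ((if (i : nat) is i'.+1 then u i' *+ (nu.+1 - i) else 0)
       * (f z ^+ i * g z ^+ (nu - i))) - D).
  congr (_ + _ + _ - _).
    rewrite /B big_ord_recl !mul0r add0r big_ord_recr /= [u nu.+1]/u Pnu// zhorner0.
    rewrite mulr0 mul0rn mul0r addr0; apply: eq_bigr => i _ /=.
    rewrite /bump /= add1n subnSK//.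
    by rewrite -[X in _ = X * _]mulr_natl; ring.
  rewrite /C big_ord_recr /= subnn !mul0r addr0 [RHS]big_ord_recl mul0r add0r.
  apply: eq_bigr => i _ /=; rewrite /bump /= add1n subSS -subnS.
  by rewrite add0n -[X in _ = X * _]mulr_natl.
rewrite /A /D -!big_split -sumrB /=; apply: eq_bigr => i _.
rewrite !zhornerD zhornerN !zhornerMn !zhornerXM.
have -> : zhorner (match (i : nat) with 0%N => 0 | i'.+1 => P i' *+ (nu.+1 - i) end) z =
   match (i : nat) with 0%N => 0 | i'.+1 => u i' *+ (nu.+1 - i) end.
  by case: (i : nat) => [|k]; rewrite ?zhorner0// zhornerMn.
rewrite -(mulr_natl (zhorner (P i) z)) -/(u i).
by rewrite /u /f /g !mulrDl mulNr.
Qed.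

(** The iterates have two descriptions: by Taylor coefficients, which gives upper bounds, and by
    integer polynomials, to which the Liouville inequality applies. *)
Lemma psum_iter_theta (R : realType) (n nu : nat) (P : nat -> {poly int})
    (r : nat -> R) : (forall i, (nu < i)%N -> P i = 0) -> rapid r ->
  (forall z, psum r z = evalP n nu P z) ->
  forall j z, psum (iter j (@theta R) r) z = evalP n nu (iter j (thetaP n nu) P) z.
Proof.
move=> Pnu rr E j.
suff [_ _] : [/\ forall i, (nu < i)%N -> iter j (thetaP n nu) P i = 0,
    rapid (iter j (@theta R) r) &
    forall z, psum (iter j (@theta R) r) z = evalP n nu (iter j (thetaP n nu) P) z] by [].
elim: j => [//|j [IH1 IH2 IH3]]; split.
- move=> i nui /=; rewrite /thetaP !IH1 ?ltnS ?(ltnW nui)//.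
  rewrite deriv0 !mulr0 !mul0rn addr0 add0r.
  case: i nui => // i nui.
  by rewrite (_ : nu.+1 - i.+1 = 0)%N ?mulr0n ?subr0//; lia.
- exact: rapid_theta.
- move=> z; rewrite /= psum_theta//.
  have [d dE <-] := is_derive_evalP n z IH1; congr (_ * _).
  have dE' := is_derive_psum z IH2.
  rewrite -(@derive_val _ _ _ _ _ _ _ dE') -(@derive_val _ _ _ _ _ _ _ dE).
  by congr ('D_1 _ z); apply/funext.
Qed.

(** One application multiplies the height by at most [S + j] for the derivative of a polynomial,
    [nu.+1] for each of the two neighbouring indices and [n.+1 * nu] for the last term. *)
Lemma iter_thetaP_height (n nu : nat) (P : nat -> {poly int}) (S H : nat) :
  (forall i, (nu < i)%N -> P i = 0) -> (forall i, (size (P i) <= S)%N) ->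
  (forall i k, `|(P i)`_k| <= H%:R) ->
  forall j, let Q := iter j (thetaP n nu) P in
    let W := (2 * nu.+1 + n.+1 * nu)%N in
  [/\ forall i, (nu < i)%N -> Q i = 0, forall i, (size (Q i) <= S + j)%N &
      forall i k, `|(Q i)`_k| <= (H * (S + j + W) ^ j)%:R].
Proof.
move=> Pnu PS PH j; elim: j => [|j [IH1 IH2 IH3]].
  by rewrite /= expn0 muln1 addn0.
set W := (2 * nu.+1 + n.+1 * nu)%N in IH3 *.
set Q := iter j (thetaP n nu) P in IH1 IH2 IH3 *; rewrite /= -/Q.
have Z i : (nu < i)%N -> thetaP n nu Q i = 0.
  move=> nui; rewrite /thetaP !IH1 ?ltnS ?(ltnW nui)//.
  rewrite deriv0 !mulr0 !mul0rn addr0 add0r.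
  case: i nui => // i nui.
  by rewrite (_ : nu.+1 - i.+1 = 0)%N ?mulr0n ?subr0//; lia.
split => // [i|i k].
  have sX (p : {poly int}) (s : nat) : (size p <= s)%N -> (size ('X * p)%R <= s.+1)%N.
    by move=> ps; rewrite (leq_trans (size_polyMleq _ _))// size_polyX.
  have sMn (p : {poly int}) (s m : nat) : (size p <= s)%N -> (size (p *+ m)%R <= s)%N.
    move=> ps; rewrite -scaler_nat; exact: leq_trans (size_scale_leq _ _) ps.
  have sD (p q : {poly int}) (s : nat) : (size p <= s)%N -> (size q <= s)%N ->
      (size (p + q)%R <= s)%N.
    by move=> ps qs; rewrite (leq_trans (size_polyD _ _))// geq_max ps.
  have IH2' i' : (size (Q i') <= (S + j).+1)%N by rewrite (leq_trans (IH2 _)).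
  rewrite addnS /thetaP; apply: (sD); last by rewrite size_polyN; exact: (sMn).
  apply: (sD); last by case: (i) => [|i']; [rewrite size_poly0|exact: (sMn)].
  apply: (sD); last by apply: (sMn); apply: (sX); exact: IH2.
  apply: (sX); apply: leq_trans (IH2 i).
  have [->|Qi0] := eqVneq (Q i) 0; first by rewrite deriv0.
  exact: ltnW (lt_size_deriv Qi0).
have [nui|inu] := ltnP nu i; first by rewrite Z// coef0 normr0.
set b := (H * (S + j + W) ^ j)%N in IH3.
have cM (x : int) (m : nat) : `|x| <= b%:R -> `|x *+ m| <= (b * m)%:R.
  by move=> xb; rewrite -[x *+ m]mulr_natr normrM natrM [`|_%:R|]ger0_norm// ler_wpM2r.
rewrite /thetaP; set p3 := (X in _ + X - _).
have T1 : `|('X * (Q i)^`())`_k| <= (b * (S + j))%:R.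
  rewrite mulrC coefMX; case: eqP => [_|/eqP k0]; first by rewrite normr0.
  rewrite coef_deriv prednK ?lt0n//.
  have [kS|Sk] := leqP k (S + j).
    by rewrite (le_trans (cM _ _ (IH3 _ _)))// ler_nat leq_mul2l kS orbT.
  rewrite nth_default ?mul0rn ?normr0//.
  by rewrite (leq_trans (IH2 _))// ltnW.
have T2 : `|(('X * Q i.+1) *+ i.+1)`_k| <= (b * nu.+1)%:R.
  rewrite coefMn mulrC coefMX.
  apply: le_trans (_ : _ <= (b * i.+1)%:R) _; last by rewrite ler_nat leq_mul2l ltnS inu orbT.
  by apply: cM; case: eqP => // _; rewrite normr0.
have T3 : `|p3`_k| <= (b * nu.+1)%:R.
  rewrite /p3; case: (i) => [|i']; first by rewrite coef0 normr0.
  rewrite coefMn (le_trans (cM _ _ (IH3 _ _)))// ler_nat leq_mul2l.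
  by rewrite subSS (leq_trans (leq_subr _ _)) ?orbT.
have T4 : `|(Q i *+ (n.+1 * (nu - i)))`_k| <= (b * (n.+1 * nu))%:R.
  rewrite coefMn (le_trans (cM _ _ (IH3 _ _)))// ler_nat leq_mul2l.
  by rewrite leq_mul2l leq_subr !orbT.
apply: (@le_trans _ _ (b * (S + j + W))%:R).
  have key (x y z t A B C D : int) : `|x| <= A -> `|y| <= B -> `|z| <= C ->
      `|t| <= D -> `|x + y + z - t| <= A + B + C + D.
    move=> xA yB zC tD; apply: le_trans (ler_normB _ _) (lerD _ tD).
    apply: le_trans (ler_normD _ _) (lerD _ zC).
    exact: le_trans (ler_normD _ _) (lerD xA yB).
  rewrite !coefD coefN.
  have := key _ _ _ _ _ _ _ _ T1 T2 T3 T4; move/le_trans; apply.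
  by rewrite -!natrD ler_nat /W; lia.
rewrite ler_nat /b -mulnA -expnSr leq_mul2l; apply/orP; right.
by rewrite leq_exp2r//; lia.
Qed.

Lemma fact_mul_le (a b : nat) : (a`! * b`! <= (a + b)`!)%N.
Proof.
rewrite -(@bin_fact (a + b) a) ?leq_addr// addKn leq_pmull//.
by rewrite bin_gt0 leq_addr.
Qed.

(** From [1 + x <= exp x]. The [j]-th iterate of [z d/dz] multiplies the coefficient of index [m] by
    [m ^ j]; beyond index [K] this costs only [K ^ j] and a geometric factor. *)
Lemma pow_ratio (R : realType) (j K m : nat) : (j <= K)%N -> (K <= m)%N -> (0 < K)%N ->
  m%:R ^+ j <= K%:R ^+ j * expR 1 ^+ (m - K) :> R.
Proof.
move=> jK Km K0; have K0' : 0 < K%:R :> R by rewrite ltr0n.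
have -> : m%:R = K%:R * (1 + (m - K)%:R / K%:R) :> R.
  by rewrite natrB//; field; rewrite lt0r_neq0.
rewrite exprMn ler_wpM2l ?exprn_ge0//.
apply: (@le_trans _ _ ((1 + (m - K)%:R / K%:R) ^+ K)).
  by rewrite ler_weXn2l// lerDl divr_ge0.
apply: (@le_trans _ _ (expR ((m - K)%:R / K%:R) ^+ K)).
  by apply: lerXn2r; rewrite ?nnegrE ?expR_ge0 ?addr_ge0 ?divr_ge0// expR_ge1Dx.
by rewrite -expRM_natl -expRM_natl mulr1 mulrCA mulfV ?mulr1 ?lt0r_neq0.
Qed.

Lemma expn_le_fact (R : realType) (K : nat) :
  K%:R ^+ K <= expR 1 ^+ K * K`!%:R :> R.
Proof.
elim: K => [|K IH]; first by rewrite !expr0 fact0 mulr1.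
have [->|K0] := posnP K.
  by rewrite !expr1 (_ : 1`! = 1)%N// mulr1; have := expR_ge1Dx (1 : R); lra.
rewrite factS natrM exprS [leRHS](_ : _ = K.+1%:R * (expR 1 ^+ K.+1 * K`!%:R)); last by ring.
rewrite ler_wpM2l// (le_trans (pow_ratio R (leqnn K) (leqnSn K) K0))//.
rewrite subSnn expr1 exprSr mulrAC.
by rewrite [leLHS]mulrC [leRHS]mulrC ler_wpM2l// expR_ge0.
Qed.

Lemma zhorner_roots_unbounded (R : realType) (p : {poly int}) :
  (forall B : R, exists2 z, B < `|z| & zhorner p z = 0) -> p = 0.
Proof.
move=> H; apply/eqP/negPn/negP => p0.
pose q : {poly R} := map_poly intr p.
have q0 : q != 0 by rewrite map_poly_eq0_id0 ?intr_eq0 ?lead_coef_eq0.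
suff L k : exists s : seq R, [/\ size s = k, uniq s & all (root q) s].
  have [s [ss us rs]] := L (size q).
  by have := max_poly_roots q0 rs us; rewrite ss ltnn.
elim: k => [|k [s [ss us rs]]]; first by exists [::].
have [z zB pz] := H (\sum_(x <- s) `|x|); exists (z :: s) => /=; split.
- by rewrite ss.
- rewrite us andbT; apply/negP => zs; move: zB.
  by rewrite (big_rem z)//= ltNge lerDl sumr_ge0.
- by rewrite rs andbT; apply/rootP.
Qed.

Lemma continuous_evalP (R : realType) (n nu : nat) (P : nat -> {poly int}) :
  (forall i, (nu < i)%N -> P i = 0) -> continuous (evalP n nu P : R -> R).
Proof.
by move=> Pnu z; have [d D _] := is_derive_evalP n z Pnu; exact: der_cvg D.
Qed.

(* At a zero of [phi n] only the coefficient of [Y^nu] survives. *)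
Lemma evalP_zero (R : realType) (n nu : nat) (P : nat -> {poly int}) (z : R) :
  phi n z = 0 -> evalP n nu P z = zhorner (P 0%N) z * phi n.+1 z ^+ nu.
Proof.
move=> pz; rewrite /evalP big_ord_recl /= pz expr0 mul1r subn0 big1 ?addr0// => i _.
by rewrite exprS !mul0r mulr0.
Qed.

(** At the zeros of [phi n] the form is [P 0] times a nonzero power of [phi n.+1], so [P 0] has
    infinitely many roots and is zero; a factor [phi n] can then be divided out. The division is
    legitimate because [phi n] cannot vanish near a point: its derivative would vanish there too. *)
Lemma evalP_inj (R : realType) (n nu : nat) (P : nat -> {poly int}) :
  (forall B : R, exists2 z, B < `|z| & phi n z = 0) ->
  (forall i, (nu < i)%N -> P i = 0) ->
  (forall z : R, evalP n nu P z = 0) -> forall i, P i = 0.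
Proof.
move=> zeros; elim: nu P => [|nu IH] P Pnu E.
all: have P00 : P 0%N = 0.
1,3: apply: (@zhorner_roots_unbounded R) => B; have [z Bz pz] := zeros B; exists z => //;
  have := E z; rewrite evalP_zero// => /eqP; rewrite mulf_eq0 expf_eq0;
  by rewrite (negbTE (phi_simple_zero pz)) andbF orbF => /eqP.
  by case=> [//|i]; exact: Pnu.
case=> [//|i]; move: i; apply: IH => [i nui|]; first exact: Pnu.
pose Q i := P i.+1.
have Qnu i : (nu < i)%N -> Q i = 0 by move=> nui; exact: Pnu.
have EQ (z : R) : phi n z * evalP n nu Q z = 0.
  rewrite -(E z) [in RHS]/evalP big_ord_recl /= P00 zhorner0 mul0r add0r.
  rewrite /evalP mulr_sumr; apply: eq_bigr => i _.
  by rewrite /= /bump /= add1n exprS subSS; ring.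
move=> z; apply/eqP/negPn/negP => Qz.
have Qnear : \forall y \near z, evalP n nu Q y != 0.
  have cQ : evalP n nu Q y @[y --> z] --> evalP n nu Q z by exact: continuous_evalP.
  exact: cvgr_neq0 cQ Qz.
have pnear : \forall y \near z, phi n y = 0.
  near=> y; have /eqP := EQ y; rewrite mulf_eq0 => /orP[/eqP//|/eqP Qy].
  exfalso; have : evalP n nu Q y != 0 by near: y.
  by rewrite Qy eqxx.
have pz : phi n z = 0 by exact: nbhs_singleton pnear.
have /eqP := phi_simple_zero pz; apply.
have D := is_derive_phi n z.
have D0 : is_derive z 1 (@phi R n) 0.
  apply: (near_eq_is_derive _ (derC z (1 : R) 0)).
  by apply: filterS pnear => y ->.
by rewrite -(@derive_val _ _ _ _ _ _ _ D) (@derive_val _ _ _ _ _ _ _ D0).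
Unshelve. all: by end_near.
Qed.

(** There are [2 M] unknown coefficients for [M] conditions [rho k = 0]. The unknown in front of
    [z ^ l] carries the weight [(N! / l!) ^ 2], which turns the factorials of the linear system into
    binomial coefficients. The system then has coefficients of geometric size, and factorial growth
    is confined to the explicit [N! ^ 2]. *)
Lemma siegel_form (R : realType) (n nu : nat) : exists D : nat, (0 < D)%N /\
  forall N M : nat, (M * 2 = nu.+1 * N.+1)%N -> (0 < M)%N ->
  exists (P : nat -> {poly int}) (rho : nat -> int),
  [/\ [/\ forall i, (nu < i)%N -> P i = 0, exists i, P i != 0,
          forall i, (size (P i) <= N.+1)%N &
          forall i k, `|(P i)`_k| <= (D ^ M.+1 * N`! ^ 2)%:R],
      forall k, (k < M)%N -> rho k = 0,
      forall k, `|rho k| <= (D ^ k.+1)%:R &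
      let r (k : nat) : R :=
        N`!%:R ^+ 2 * ((rho k)%:~R / (k`!%:R * (k + n.+1 * nu)`!%:R)) in
      rapid r /\ forall z, psum r z = evalP n nu P z].
Proof.
pose E := (n.+1 * nu)%N.
have /choice[g /choice[G gG]] : forall i : nat, exists (g : nat -> int) (G : nat),
    (i <= nu)%N -> (0 < G)%N /\ forall k, monomial_seq R n nu i k =
      (g k)%:~R / (k`!%:R * (k + E)`!%:R) /\ `|g k| <= (G ^ k.+1)%:R.
  move=> i; have [inu|nui] := leqP i nu; last by exists (fun=> 0), 0%N.
  by have [g [G H]] := @Eseries_monomial R n nu i inu; exists g, G.
pose Gm := (\max_(i < nu.+1) G i)%N.
have Gm_ge i : (i <= nu)%N -> (G i <= Gm)%N.
  by rewrite -ltnS => inu; exact: (leq_bigmax (Ordinal inu)).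
have Gm0 : (0 < Gm)%N by have [G0 _] := gG 0%N isT; exact: leq_trans G0 (Gm_ge 0%N isT).
pose Q := (Gm * (4 * 2 ^ E))%N.
have Q0 : (0 < Q)%N by rewrite /Q !muln_gt0 Gm0 expn_gt0.
(* [32] absorbs [8 M ^ 2 <= 2 ^ (3 + 2 M)], and [Q ^ 2] the two powers of [Q] coming from the system
   and from its solution. *)
exists (32 * Q ^ 2)%N; split; first by rewrite muln_gt0 expn_gt0 Q0.
move=> N M MN M0.
(* The unknown of number [j = i (N + 1) + l] belongs to [z ^ l] and to the monomial of index [i]. *)
pose ii (j : nat) := (j %/ N.+1)%N; pose ll (j : nat) := (j %% N.+1)%N.
have ii_le (j : 'I_(M * 2)) : (ii j <= nu)%N.
  by rewrite -ltnS /ii ltn_divLR// -MN.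
have ll_le j : (ll j <= N)%N by rewrite -ltnS ltn_pmod.
pose a k (j : nat) : int := g (ii j) (k - ll j)%N * ('C(k, ll j) * 'C(k + E, ll j))%:R.
have aQ k (j : 'I_(M * 2)) : `|a k j| <= (Q ^ k.+1)%:R.
  have [_ /(_ (k - ll j)%N)[_ gk]] := gG _ (ii_le j).
  rewrite /a normrM /Q expnMn [leRHS]natrM; apply: ler_pM => //.
    apply: (le_trans gk); rewrite ler_nat.
    apply: (@leq_trans (Gm ^ (k - ll j).+1)); first by rewrite leq_exp2r// Gm_ge// ii_le.
    by rewrite leq_pexp2l// ltnS leq_subr.
  rewrite ger0_norm// ler_nat (leq_trans (leq_mul (bin_le_exp2 _ _) (bin_le_exp2 _ _)))//.
  by rewrite (_ : 4 = 2 ^ 2)%N// -!expnD -expnM leq_pexp2l//; lia.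
have [x [x0 Ax xb]] := @pigeonhole_int M (Q ^ M) (\matrix_(i, j) a i j) M0
  (ltac:(by rewrite expn_gt0 Q0)) (ltac:(by move=> i j; rewrite mxE (le_trans (aQ _ _))// ler_nat leq_pexp2l)).
pose w (j : nat) : int := (N`! %/ (ll j)`!)%:R ^+ 2.
have wE j : (w j)%:~R = N`!%:R ^+ 2 / (ll j)`!%:R ^+ 2 :> R.
  have dv : ((ll j)`! %| N`!)%N.
    by rewrite -(bin_fact (ll_le j)) mulnCA dvdn_mulr.
  rewrite /w rmorphXn /= rmorph_nat -expr_div_n; congr (_ ^+ 2).
  by rewrite -[in RHS](divnK dv) natrM mulfK// factr_neq0.
have wle j : `|w j| <= (N`! ^ 2)%:R.
  by rewrite /w ger0_norm ?exprn_ge0// -natrX ler_nat leq_exp2r// leq_div.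
pose P (i : nat) : {poly int} := \sum_(j < M * 2 | ii j == i) (x j 0 * w j) *: 'X^(ll j).
pose rho (k : nat) : int := \sum_(j < M * 2) x j 0 * a k j.
exists P, rho; split.
- split.
  + move=> i nui; rewrite /P big_pred0// => j; apply/negbTE; apply/eqP => ji.
    by have := ii_le j; rewrite ji; lia.
  + have /cV0Pn[j xj] := x0; exists (ii j); apply/eqP => /(congr1 (fun p : {poly int} => p`_(ll j))).
    rewrite coef0 coef_sum (bigD1 j)//= big1 ?addr0; last first.
      move=> k /andP[/eqP ik /eqP kj]; rewrite coefZ coefXn.
      case: eqP => [lk|_]; last by rewrite mulr0.
      exfalso; apply: kj; apply/val_inj => /=.
      by rewrite (divn_eq k N.+1) (divn_eq j N.+1) -/(ii k) -/(ll k) ik -lk.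
    rewrite coefZ coefXn eqxx mulr1 => /eqP; rewrite mulf_eq0 (negbTE xj) /=.
    move=> /eqP wj; have := wE j; rewrite wj mulr0z => /eqP.
    by rewrite eq_sym mulf_eq0 invr_eq0 !expf_eq0 /= !(negbTE (factr_neq0 _ _)).
  + move=> i; rewrite /P; apply: (leq_trans (size_sum _ _ _)).
    apply/bigmax_leqP => j _; rewrite (leq_trans (size_scale_leq _ _))// size_polyXn.
    by rewrite ltnS.
  + move=> i k; rewrite /P coef_sum (le_trans (ler_norm_sum _ _ _))//.
    apply: (@le_trans _ _ (\sum_(j < M * 2) (4 * M * Q ^ M * N`! ^ 2)%:R)).
      rewrite big_mkcond /=; apply: ler_sum => j _; case: ifP => _ //.
      rewrite coefZ coefXn normrM [`|x j 0 * w j|]normrM [leRHS]natrM -[leRHS]mulr1; apply: ler_pM => //.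
        by apply: ler_pM => //; exact: wle.
      by case: (k == ll j); rewrite ?normr0 ?normr1.
    rewrite sumr_const card_ord -[leLHS]mulr_natl -natrM ler_nat mulnA leq_mul2r.
    apply/orP; right.
    have -> : (M * 2 * (4 * M * Q ^ M) = (8 * (M * M)) * Q ^ M)%N by lia.
    rewrite expnMn -expnM; apply: leq_mul; last by rewrite leq_pexp2l//; lia.
    have M2 : (M <= 2 ^ M)%N by exact: ltnW (ltn_expl _ _).
    apply: leq_trans (leq_mul (leqnn 8) (leq_mul M2 M2)) _.
    rewrite (_ : 8 = 2 ^ 3)%N// (_ : 32 = 2 ^ 5)%N// -!expnD -expnM leq_pexp2l//; lia.
- move=> k kM; have := congr1 (fun y : 'cV_M => y (Ordinal kM) 0) Ax.
  rewrite !mxE => Ak; rewrite -[RHS]Ak; apply: eq_bigr => j _.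
  by rewrite mxE mulrC.
- have rhoM k : (k < M)%N -> rho k = 0.
    move=> kM; have := congr1 (fun y : 'cV_M => y (Ordinal kM) 0) Ax.
    rewrite !mxE => Ak; rewrite -[RHS]Ak; apply: eq_bigr => j _.
    by rewrite mxE mulrC.
  move=> k; have [kM|Mk] := ltnP k M; first by rewrite rhoM// normr0.
  rewrite (le_trans (ler_norm_sum _ _ _))//.
  apply: (@le_trans _ _ (\sum_(j < M * 2) (4 * M * Q ^ M * Q ^ k.+1)%:R)).
    by apply: ler_sum => j _; rewrite normrM natrM; apply: ler_pM.
  rewrite sumr_const card_ord -[leLHS]mulr_natl -natrM ler_nat.
  have -> : (M * 2 * (4 * M * Q ^ M * Q ^ k.+1) = (8 * (M * M)) * (Q ^ M * Q ^ k.+1))%N by lia.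
  rewrite expnMn -expnM -expnD; apply: leq_mul; last by rewrite leq_pexp2l//; lia.
  have M2 : (M <= 2 ^ M)%N by exact: ltnW (ltn_expl _ _).
  apply: leq_trans (leq_mul (leqnn 8) (leq_mul M2 M2)) _.
  rewrite (_ : 8 = 2 ^ 3)%N// (_ : 32 = 2 ^ 5)%N// -!expnD -expnM leq_pexp2l//; lia.
- pose t (j : nat) : nat -> R := iter (ll j) (@seq_shift R) (monomial_seq R n nu (ii j)).
  have tE j : (ii j <= nu)%N -> rapid (t j) /\ forall z,
      psum (t j) z = z ^+ ll j * (phi n z ^+ ii j * phi n.+1 z ^+ (nu - ii j)).
    move=> inu; have rm := Eseries_rapid (@Eseries_monomial R n nu (ii j) inu).
    split=> [|z]; first by have [] := psum_iter_shift (ll j) 0 rm.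
    by have [_ ->] := psum_iter_shift (ll j) z rm; rewrite psum_monomial.
  move=> r.
  have rE : r = fun k => \sum_(j < M * 2) (x j 0 * w j)%:~R * t j k.
    apply/funext => k; rewrite /r /rho rmorph_sum mulr_suml mulr_sumr.
    apply: eq_bigr => j _; rewrite /t iter_shiftE rmorphM.
    rewrite [in RHS]rmorphM /= wE /a.
    case: leqP => lk; last first.
      by rewrite (bin_small lk) mul0n mulr0 rmorph0; ring.
    have [_ /(_ (k - ll j)%N)[-> _]] := gG _ (ii_le j).
    have lkE : (ll j <= k + E)%N by lia.
    rewrite -/E -(bin_fact lk) -(bin_fact lkE).
    have -> : (k + E - ll j = k - ll j + E)%N by lia.
    rewrite !natrM !rmorphM /= !rmorph_nat.
    have B0 b c : (c <= b)%N -> 'C(b, c)%:R != 0 :> R.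
      by move=> cb; rewrite pnatr_eq0 -lt0n bin_gt0.
    have := B0 _ _ lk; have := B0 _ _ lkE.
    have := factr_neq0 R (ll j); have := factr_neq0 R (k - ll j).
    have := factr_neq0 R (k - ll j + E).
    move: ('C(k, ll j)%:R : R) ('C(k + E, ll j)%:R : R) ((ll j)`!%:R : R)
      ((k - ll j)`!%:R : R) ((k - ll j + E)`!%:R : R) => *.
    by field; do ! (apply/andP; split).
  have S (m : nat) (mM : (m <= M * 2)%N) : let s := fun k => \sum_(j < m)
       (x (widen_ord mM j) 0 * w j)%:~R * t j k in
     rapid s /\ forall z, psum s z = \sum_(j < m) (x (widen_ord mM j) 0 * w j)%:~R * psum (t j) z.
    elim: m mM => [|m IH] mM /=.
      split=> [|z]; first by exists 1 => // k; rewrite big_ord0 normr0 divr_ge0 ?exprn_ge0.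
      rewrite big_ord0 (_ : (fun _ => _) = fun k => 0 * seq1 R k); last first.
        by apply/funext => k; rewrite big_ord0 mul0r.
      by rewrite psumZ ?mul0r//; exact: Eseries_rapid (Eseries1 R).
    have [IH1 IH2] := IH (ltnW mM).
    have [t1 t2] := tE m (ii_le (Ordinal mM)).
    have sE : (fun k => \sum_(j < m.+1) (x (widen_ord mM j) 0 * w j)%:~R * t j k) =
       (fun k => \sum_(j < m) (x (widen_ord (ltnW mM) j) 0 * w j)%:~R * t j k +
         (x (Ordinal mM) 0 * w m)%:~R * t m k).
      apply/funext => k; rewrite big_ord_recr /=; congr (_ + _).
        by apply: eq_bigr => j _; congr ((x _ _ * _)%:~R * _); apply/val_inj.
      by congr ((x _ _ * _)%:~R * _); apply/val_inj.
    rewrite sE; split; first by apply: rapidD => //; exact: rapidZ.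
    move=> z; rewrite psumD//; last exact: rapidZ.
    rewrite IH2 psumZ// big_ord_recr /=; congr (_ + _).
      by apply: eq_bigr => j _; congr ((x _ _ * _)%:~R * _); apply/val_inj.
    by congr ((x _ _ * _)%:~R * _); apply/val_inj.
  have [S1 S2] := S (M * 2)%N (leqnn _).
  have E1 : r = fun k => \sum_(j < M * 2) (x (widen_ord (leqnn _) j) 0 * w j)%:~R * t j k.
    rewrite rE; apply/funext => k; apply: eq_bigr => j _.
    by congr ((x _ _ * _)%:~R * _); apply/val_inj.
  split; first by rewrite E1.
  move=> z; rewrite E1 S2 /evalP.
  transitivity (\sum_(i < nu.+1) \sum_(j < M * 2 | ii j == i)
     (x j 0 * w j)%:~R * z ^+ ll j * (phi n z ^+ i * phi n.+1 z ^+ (nu - i))).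
    rewrite (exchange_big_dep xpredT)//=; apply: eq_bigr => j _.
    rewrite (big_pred1 (Ordinal (ii_le j : (ii j < nu.+1)%N))); last first.
      by move=> i; rewrite /= eq_sym -val_eqE.
    have [_ ->] := tE j (ii_le j).
    by rewrite -mulrA; congr ((x _ _ * _)%:~R * _); apply/val_inj.
  apply: eq_bigr => i _; rewrite -mulr_suml; congr (_ * _).
  rewrite /zhorner /P rmorph_sum horner_sum; apply: eq_bigr => j _.
  by rewrite /= map_polyZ map_polyXn hornerZ hornerXn.
Qed.

(** * Estimates between factorials and powers *)

Lemma fact_le_expn (n : nat) : (n`! <= n ^ n)%N.
Proof.
have H m : (m <= n -> m`! <= n ^ m)%N.
  elim: m => [//|m IH] mn; rewrite factS expnS leq_mul//.
  by apply: IH; exact: ltnW.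
exact: H.
Qed.

Lemma fact_add_ge (K J : nat) : (K`! * K ^ J <= (K + J)`!)%N.
Proof.
elim: J => [|J IH]; first by rewrite muln1 addn0.
rewrite addnS factS expnS mulnCA leq_mul//.
by rewrite (leq_trans (leq_addr J K)).
Qed.

Lemma fact_add_le (K E : nat) : ((K + E)`! <= K`! * (K + E) ^ E)%N.
Proof.
elim: E => [|E IH]; first by rewrite muln1 addn0.
rewrite addnS factS expnS mulnCA leq_mul//.
apply: leq_trans IH _; rewrite leq_mul2l; apply/orP; right.
by case: E => // E; rewrite leq_exp2r.
Qed.

(** The inequality that a nonzero value at [al] would satisfy, with all constants replaced by [G].
    The total exponent of [K] on the right is [(2 N + j) (h + 1)], which the parameters keep below
    [K]. *)
Lemma liouville_numerics (K N M j h G D be C W : nat) :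
  (2 < G)%N -> (D <= G)%N -> (be <= G)%N -> (C <= G)%N ->
  (M <= K)%N -> (N < K)%N -> (W <= K)%N -> ((2 * N + j) * h.+1 <= K)%N ->
  (K`! ^ 2 <= G * N`! ^ 2 * K ^ j * D * (D * be) ^ K * G *
     ((D ^ M.+1 * N`! ^ 2 * (N.+1 + j + W) ^ j) ^ h * C ^ (N + j).+1))%N ->
  (K`! ^ 2 <= (G ^ (2 * h + 6)) ^ K.+1 * K ^ K)%N.
Proof.
move=> G3 DG beG CG MK NK WK jK /leq_trans; apply.
have K0 : (0 < K)%N by lia.
have G0 : (0 < G)%N by lia.
have jK' : (j <= K)%N by nia.
have NN : (N`! ^ 2 <= K ^ (2 * N))%N.
  rewrite mulnC expnM leq_exp2r// (leq_trans (fact_le_expn _))//.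
  by case: (N) NK => // N' NK; rewrite leq_exp2r// ltnW.
have Dx x : (D ^ x <= G ^ x)%N by case: x => // x; rewrite leq_exp2r.
have Cx x : (C ^ x <= G ^ x)%N by case: x => // x; rewrite leq_exp2r.
have DbK : ((D * be) ^ K <= G ^ (2 * K))%N.
  by rewrite expnM leq_exp2r//; exact: leq_mul.
have WW : ((N.+1 + j + W) ^ j <= G ^ K * K ^ j)%N.
  have -> : (G ^ K * K ^ j = G ^ (K - j) * (G * K) ^ j)%N.
    by rewrite expnMn mulnA -expnD subnK.
  apply: leq_trans (_ : (G * K) ^ j <= _)%N; last by rewrite leq_pmull// expn_gt0 G0.
  by case: (j) jK' => // j' jK'; rewrite leq_exp2r//; nia.
have HH : (D ^ M.+1 * N`! ^ 2 * (N.+1 + j + W) ^ j <=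
     G ^ (2 * K).+1 * K ^ (2 * N + j))%N.
  have -> : (G ^ (2 * K).+1 * K ^ (2 * N + j) =
     G ^ K.+1 * K ^ (2 * N) * (G ^ K * K ^ j))%N.
    by rewrite expnD (_ : (2 * K).+1 = K.+1 + K)%N ?expnD; lia.
  apply: leq_mul => //; apply: leq_mul => //.
  by apply: leq_trans (Dx _) _; rewrite leq_pexp2l.
have HHh : ((D ^ M.+1 * N`! ^ 2 * (N.+1 + j + W) ^ j) ^ h <=
    G ^ ((2 * K).+1 * h) * K ^ ((2 * N + j) * h))%N.
  rewrite !(expnM _ _ h) -expnMn.
  by case: (h) => // h'; rewrite leq_exp2r.
apply: (@leq_trans (G * K ^ (2 * N) * K ^ j * G * G ^ (2 * K) * G *
  ((G ^ ((2 * K).+1 * h) * K ^ ((2 * N + j) * h)) * G ^ (N + j).+1))%N).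
  by do ! apply: leq_mul => //.
have -> : (G * K ^ (2 * N) * K ^ j * G * G ^ (2 * K) * G *
  ((G ^ ((2 * K).+1 * h) * K ^ ((2 * N + j) * h)) * G ^ (N + j).+1) =
  G ^ (3 + 2 * K + (2 * K).+1 * h + (N + j).+1) * K ^ ((2 * N + j) * h.+1))%N.
  have -> : ((2 * N + j) * h.+1 = 2 * N + j + (2 * N + j) * h)%N by lia.
  rewrite !expnD (_ : G ^ 3 = G * G * G)%N; last by rewrite !expnS expn0; lia.
  by move: (K ^ (2 * N))%N (K ^ j)%N (G ^ (2 * K))%N => *; lia.
by rewrite leq_mul//; [rewrite -expnM leq_pexp2l//; lia|rewrite leq_pexp2l].
Qed.

(** After cancelling [K! ^ 2], it remains to compare [K ^ (2 J)] with [K ^ E] and a geometric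
    factor. As [E <= J] and [J] is about a fixed fraction of [K], this bounds [K]. *)
Lemma isolation_numerics (K J E h G D be : nat) :
  (1 < G)%N -> (D <= G)%N -> (be <= G)%N -> (E <= J)%N -> (0 < J)%N ->
  (J <= K)%N -> (K <= 2 * h.+1 * J.+1)%N -> (3 < K)%N ->
  ((K + J)`! ^ 2 <= K`! * (K + E)`! *
     (be ^ K * (2 ^ J * D * (D * be) ^ (K + J).+1 * G)))%N ->
  (K <= G ^ (32 * h.+1))%N.
Proof.
move=> G2 DG beG EJ J0 JK KJ K4 H.
have K0 : (0 < K)%N by lia.
have G0 : (0 < G)%N by lia.
have b1 : (be ^ K <= G ^ K)%N by rewrite leq_exp2r.
have b2 : (2 ^ J <= G ^ J)%N by rewrite leq_exp2r.
have b3 : ((D * be) ^ (K + J).+1 <= G ^ (2 * (K + J).+1))%N.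
  by rewrite expnM leq_exp2r//; exact: leq_mul.
have b4 : ((K + E) ^ E <= G ^ E * K ^ E)%N.
  rewrite -expnMn; case: (E) EJ => // E' EJ; rewrite leq_exp2r//; nia.
have H1 : (K`! ^ 2 * (K ^ J * K ^ J) <= K`! ^ 2 * (G ^ E * K ^ E *
     (G ^ K * (G ^ J * G * G ^ (2 * (K + J).+1) * G))))%N.
  apply: leq_trans (_ : (K + J)`! ^ 2 <= _)%N.
    have := leq_mul (fact_add_ge K J) (fact_add_ge K J).
    by rewrite !expnS !expn0 !muln1; lia.
  apply: leq_trans H _.
  set Z := (_ * (_ * G * _ * G))%N.
  have -> : (K`! ^ 2 * (G ^ E * K ^ E * Z) = K`! * (K`! * (G ^ E * K ^ E)) * Z)%N.
    by rewrite expnS expn1 -!mulnA.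
  rewrite /Z; do ! apply: leq_mul => //.
  by apply: leq_trans (fact_add_le K E) _; rewrite leq_mul2l b4 orbT.
move: H1; rewrite leq_pmul2l ?expn_gt0 ?fact_gt0// => H1.
have H2 : (K ^ J * K ^ J <= K ^ J * G ^ (8 * K))%N.
  apply: leq_trans H1 _.
  apply: leq_trans (_ : K ^ E * G ^ (E + K + J + 1 + 2 * (K + J).+1 + 1) <= _)%N.
    by rewrite !expnD !expn1; lia.
  by apply: leq_mul; rewrite leq_pexp2l//; lia.
move: H2; rewrite leq_pmul2l ?expn_gt0 ?K0// => H2.
have H3 : (K ^ J <= (G ^ (32 * h.+1)) ^ J)%N.
  by apply: leq_trans H2 _; rewrite -expnM leq_pexp2l//; nia.
by rewrite leq_exp2r in H3.
Qed.

(** Since [K!] is at least [(K / e) ^ K], its square exceeds [K ^ K] by a factor [(K / e ^ 2) ^ K],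
    more than any geometric sequence when [K] is large. *)
Lemma growth_numerics (K e Y : nat) :
  (K ^ K <= e ^ K * K`!)%N -> (K`! ^ 2 <= Y ^ K.+1 * K ^ K)%N ->
  (0 < e)%N -> (0 < Y)%N -> (0 < K)%N -> (K <= (e ^ 2 * Y) ^ 2)%N.
Proof.
move=> H1 H2 e0 Y0 K0.
have H3 : (K ^ K * K ^ K <= K ^ K * (e ^ 2 * Y) ^ K.+1)%N.
  apply: leq_trans (leq_mul H1 H1) _.
  apply: leq_trans (_ : (e ^ K) ^ 2 * (K`! ^ 2) <= _)%N.
    by rewrite !expnS !expn0; lia.
  apply: leq_trans (leq_mul (leqnn _) H2) _.
  rewrite expnMn -!expnM.
  rewrite [leqRHS]mulnC -mulnA; apply: leq_mul => //.
  by rewrite leq_pexp2l//; lia.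
move: H3; rewrite leq_pmul2l ?expn_gt0 ?K0// => H3.
have : (K ^ K <= ((e ^ 2 * Y) ^ 2) ^ K)%N.
  apply: leq_trans H3 _; rewrite -(expnM (e ^ 2 * Y)) leq_pexp2l//; last lia.
  by rewrite muln_gt0 expn_gt0 e0.
by rewrite leq_exp2r.
Qed.

(** * Transcendence of the zeros *)

Lemma iter_thetaE (R : realType) (c : nat -> R) (j k : nat) :
  iter j (@theta R) c k = k%:R ^+ j * c k.
Proof.
elim: j => [|j IH] /=; first by rewrite mul1r.
by rewrite /theta IH exprS mulrA.
Qed.

Lemma rapid_iter_theta (R : realType) (c : nat -> R) (j : nat) :
  rapid c -> rapid (iter j (@theta R) c).
Proof. by move=> rc; elim: j => [//|j IH] /=; exact: rapid_theta. Qed.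

(** The weight is a polynomial in [k] of degree [J], so the weighted series is a combination of the
    iterates of [z d/dz] up to order [J]. It is chosen to vanish for [k = K + 1, ..., K + J]. *)
Lemma psum_moments (R : realType) (c : nat -> R) (z : R) (K J : nat) : rapid c ->
  (forall j, (j <= J)%N -> psum (iter j (@theta R) c) z = 0) ->
  let d k := (\prod_(t < J) (k%:R - (K + t).+1%:R)) * c k in
  rapid d /\ psum d z = 0.
Proof.
move=> rc H.
pose d s (k : nat) : R := (\prod_(t < s) (k%:R - (K + t).+1%:R)) * c k.
suff S s : (s <= J)%N -> rapid (d s) /\
    forall i, (i + s <= J)%N -> psum (iter i (@theta R) (d s)) z = 0.
  by have [h1 h2] := S J (leqnn _); split=> //; exact: (h2 0%N (leqnn _)).
elim: s => [_|s IH sJ].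
  have -> : d 0%N = c by apply/funext => k; rewrite /d big_ord0 mul1r.
  by split=> // i; rewrite addn0; exact: H.
have [IH1 IH2] := IH (ltnW sJ).
have E i : iter i (@theta R) (d s.+1) = fun k => iter i.+1 (@theta R) (d s) k +
    (- (K + s).+1%:R) * iter i (@theta R) (d s) k.
  apply/funext => k; rewrite !iter_thetaE /d big_ord_recr /=.
  by rewrite exprS; ring.
have rE i := rapid_iter_theta i IH1.
split.
  by rewrite -[d s.+1]/(iter 0 (@theta R) (d s.+1)) E; apply: rapidD; [exact: rE|apply: rapidZ; exact: rE].
move=> i iJ; rewrite E psumD; [|exact: rE|by apply: rapidZ; exact: rE].
rewrite psumZ; last exact: rE.
by rewrite !IH2 ?mulr0 ?addr0//; lia.
Qed.

(* The Taylor coefficients of an auxiliary form, bounded beyond index [K]. *)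
Lemma coef_tail_bound (R : realType) (rho : nat -> int) (E D be K i : nat) (al F : R) :
  `|al| <= be%:R -> 0 <= F -> (forall k, `|rho k| <= (D ^ k.+1)%:R) ->
  let r (k : nat) : R := F * ((rho k)%:~R / (k`!%:R * (k + E)`!%:R)) in
  `|r (K + i)%N * al ^+ (K + i)| <=
  F * (D%:R * (D * be)%:R ^+ K / K`!%:R ^+ 2) * ((D * be)%:R ^+ i / i`!%:R).
Proof.
move=> albe F0 rhoD; cbv zeta; rewrite normrM normrX normrM (ger0_norm F0).
rewrite -!mulrA ler_wpM2l// normrM (ger0_norm (_ : 0 <= (_ * _)^-1)) ?invr_ge0 ?mulr_ge0//.
have h1 : `|(rho (K + i)%N)%:~R| <= D%:R ^+ (K + i).+1 :> R.
  by rewrite -natrX; exact: intr_norm_le.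
have h2 : `|al| ^+ (K + i) <= be%:R ^+ (K + i) by apply: lerXn2r; rewrite ?nnegrE.
have h3 : ((K + i)`!%:R * (K + i + E)`!%:R)^-1 <= (K`!%:R * (K`! * i`!)%:R)^-1 :> R.
  rewrite lef_pV2 ?posrE ?mulr_gt0 ?ltr0n ?muln_gt0 ?fact_gt0//.
  rewrite -!natrM ler_nat mulnC leq_mul ?fact_mul_le//.
  by rewrite -addnA (leq_trans _ (fact_mul_le _ _))// leq_pmulr// fact_gt0.
rewrite -mulrA; apply: le_trans (ler_pM _ _ h1 (ler_pM _ _ h3 h2)) _;
  rewrite ?mulr_ge0 ?invr_ge0 ?exprn_ge0 ?mulr_ge0//.
rewrite le_eqVlt; apply/orP; left; apply/eqP.
rewrite !natrM -addSn !exprD exprS !exprMn.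
have := factr_neq0 R K; have := factr_neq0 R i.
move: (K`!%:R : R) (i`!%:R : R) => x y x0 y0.
by field; rewrite x0 y0.
Qed.

(** The order [K] of the form at the origin exceeds [N], which is free, yet it is bounded in both
    cases: by [liouville] if some iterate of order at most [J] is nonzero at [al], and by the
    integrality of [rho K] if they all vanish. *)
Lemma siegel_transcendence (R : realType) (n : nat) (al : R) (f : {poly int}) :
  (forall B : R, exists2 z, B < `|z| & phi n z = 0) ->
  f != 0 -> zhorner f al = 0 -> al != 0 -> phi n al != 0.
Proof.
move=> zeros f0 fal al0; apply/negP => /eqP pal.
have [h [C [C0 liou]]] := liouville f0 fal.
(* This makes [M = 4 (h + 1) (N + 1)]. Together with [j <= K / (2 (h + 1))] it gives
   [(2 N + j) (h + 1) <= K], half of [K] for each summand. *)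
pose nu := (8 * h.+1).-1.
have nuE : nu.+1 = (8 * h.+1)%N by rewrite /nu; lia.
have [D [D0 form]] := siegel_form R n nu.
pose E := (n.+1 * nu)%N; pose W := (2 * nu.+1 + n.+1 * nu)%N.
pose c : R := phi n.+1 al; have c0 : c != 0 by exact: phi_simple_zero.
pose be := (Num.bound (`|al| + `|al|^-1)).+1.
have al_pos : 0 < `|al| by rewrite normr_gt0.
have be_al : `|al| <= be%:R /\ `|al|^-1 <= be%:R.
  have : `|al| + `|al|^-1 < (Num.bound (`|al| + `|al|^-1))%:R.
    by apply: archi_boundP; rewrite addr_ge0 ?invr_ge0.
  have : 0 < `|al|^-1 by rewrite invr_gt0.
  by rewrite /be -natr1; lra.
pose e0 := (Num.bound (expR (1 : R))).+1.
have e0E : expR 1 <= e0%:R :> R.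
  have := archi_boundP (expR_ge0 (1 : R)).
  by rewrite /e0 -natr1; lra.
pose X : R := expR (expR 1 * (D * be)%:R) + expR ((2 * D * be)%:R) + `|c| ^- nu.
have X0 : 0 <= X by rewrite !addr_ge0 ?expR_ge0 ?invr_ge0 ?exprn_ge0.
have [G [G3 DG beG CG GB]] : exists G, [/\ 2 < G, D <= G, be <= G, C <= G &
    Num.bound X <= G]%N.
  have H a b x y : exists G, [/\ 2 < G, a <= G, b <= G, x <= G & y <= G]%N.
    by exists (a + b + x + y + 3)%N; clear; split; lia.
  exact: H.
have GX : [/\ expR (expR 1 * (D * be)%:R) <= G%:R :> R, expR ((2 * D * be)%:R) <= G%:R :> R
     & `|c| ^- nu <= G%:R].
  have XG : X <= G%:R.
    by apply: le_trans (ltW (archi_boundP X0)) _; rewrite ler_nat.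
  have c0' : 0 <= `|c| ^- nu by rewrite invr_ge0 exprn_ge0.
  split; apply: (le_trans _ XG); rewrite /X.
  - by rewrite -addrA lerDl addr_ge0// expR_ge0.
  - by rewrite addrAC lerDr addr_ge0// expR_ge0.
  - by rewrite lerDr addr_ge0// expR_ge0.
have [GX1 GX2 GX3] := GX.
pose Y := (G ^ (2 * h + 6))%N.
(* The first two conditions contradict the final bounds on [K] of the two cases; the third is a
   hypothesis of [liouville_numerics], and the last forces [E < J]. *)
have [N [N1 N2 N3 N4]] : exists N, [/\ (e0 ^ 2 * Y) ^ 2 <= N, G ^ (32 * h.+1) <= N,
    W <= N & 2 * h.+1 * E.+1 <= N]%N.
  have H a b x y : exists N, [/\ a <= N, b <= N, x <= N & y <= N]%N.
    by exists (a + b + x + y)%N; clear; split; lia.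
  exact: H.
have [M ME] : exists M, M = (4 * (h.+1 * N.+1))%N by eexists.
have NM : (N < M)%N by rewrite ME mulnA leq_pmull.
have MN : (M * 2 = nu.+1 * N.+1)%N by rewrite ME nuE; clear; lia.
have M0 : (0 < M)%N by apply: leq_ltn_trans NM.
have [P [rho [[Pnu [i0 Pi0] Psz Pht] rho0 rhoD rrP]]] := form N M MN M0.
pose r (k : nat) : R :=
  N`!%:R ^+ 2 * ((rho k)%:~R / (k`!%:R * (k + E)`!%:R)).
have [rr rP] : rapid r /\ forall z, psum r z = evalP n nu P z := rrP.
have exK : exists k, rho k != 0.
  apply/not_existsP => allr; move/eqP: Pi0; apply.
  apply: (evalP_inj zeros Pnu) => z; rewrite -rP /psum.
  have -> : r = fun k => 0 * seq1 R k.
    apply/funext => k; have /negP/negPn/eqP := allr k; rewrite /r => ->.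
    by rewrite mul0r mulr0 mul0r.
  by rewrite -/(psum _ z) psumZ ?mul0r//; exact: Eseries_rapid (Eseries1 R).
(* [K] is the exact order of vanishing, finite because the form is not identically zero; it is at
   least [M] by construction. *)
case: (ex_minnP exK) => K rhoK Kmin.
have MK : (M <= K)%N.
  by rewrite leqNgt; apply/negP => /rho0 E0; rewrite E0 eqxx in rhoK.
have rltK k : (k < K)%N -> rho k = 0.
  move=> kK; apply/eqP/negPn/negP => /Kmin; rewrite leqNgt kK//.
have NK : (N < K)%N := leq_trans NM MK.
have K0 : (0 < K)%N := leq_ltn_trans (leq0n N) NK.
pose J := (K %/ (2 * h.+1))%N.
have JK : (2 * h.+1 * J <= K)%N by rewrite mulnC leq_trunc_div.
have KJ : (K < 2 * h.+1 * J.+1)%N by rewrite mulnC ltn_ceil.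
have F0 : 0 <= N`!%:R ^+ 2 :> R by rewrite exprn_ge0.
have tail k i := @coef_tail_bound R rho E D be k i al _ (proj1 be_al) F0 rhoD.
have moments j : (j <= J)%N -> psum (iter j (@theta R) r) al = 0.
  move=> jJ.
  pose Q := iter j (thetaP n nu) P.
  have := psum_iter_theta Pnu rr rP j al; rewrite evalP_zero// -/Q -/c => psE.
  have [_ Qsz Qht] := iter_thetaP_height n Pnu Psz Pht j.
  rewrite -/Q -/W in Qsz Qht.
  have [Q0|Q0] := eqVneq (zhorner (Q 0%N) al) 0; first by rewrite psE Q0 mul0r.
  exfalso.
  have L := liou (Q 0%N) (N + j)%N _ (Qsz 0%N) (Qht 0%N) Q0.
  have jK : (j <= K)%N by apply: leq_trans jJ (leq_trans _ JK); rewrite leq_pmull.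
  pose A : R := N`!%:R ^+ 2 * (K%:R ^+ j * (D%:R * (D * be)%:R ^+ K / K`!%:R ^+ 2)).
  have up : `|psum (iter j (@theta R) r) al| <= A * expR (expR 1 * (D * be)%:R).
    have := @psum_tail _ (iter j (@theta R) r) al A (expR 1 * (D * be)%:R) K
      (rapid_iter_theta j rr).
    rewrite [X in _ - X]big1_seq ?subr0; last first.
      move=> k; rewrite mem_index_iota => /andP[_ kK].
      by rewrite iter_thetaE /r rltK// mul0r !mulr0 mul0r.
    apply=> i; rewrite iter_thetaE -mulrA normrM ger0_norm ?exprn_ge0//.
    apply: le_trans (ler_pM _ _ (pow_ratio R jK (leq_addr i K) K0) (tail K i)) _;
      rewrite ?exprn_ge0//.
    by rewrite addKn exprMn /A le_eqVlt; apply/orP; left; apply/eqP; ring.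
  have cnu : 0 < `|c| ^+ nu by rewrite exprn_gt0// normr_gt0.
  have lowb : 1 <= A * G%:R * G%:R * (((D ^ M.+1 * N`! ^ 2 * (N.+1 + j + W) ^ j) ^ h
      * C ^ (N + j).+1)%:R).
    apply: le_trans L _; rewrite ler_wpM2r//.
    have -> : `|zhorner (Q 0%N) al| = `|psum (iter j (@theta R) r) al| * `|c| ^- nu.
      by rewrite psE normrM normrX mulfK// lt0r_neq0.
    have A0 : 0 <= A by rewrite /A !mulr_ge0 ?invr_ge0 ?exprn_ge0.
    apply: ler_pM => //; rewrite ?invr_ge0 ?exprn_ge0//.
    by apply: le_trans up _; rewrite ler_wpM2l.
  have num : (K`! ^ 2 <= G * N`! ^ 2 * K ^ j * D * (D * be) ^ K * G *
     ((D ^ M.+1 * N`! ^ 2 * (N.+1 + j + W) ^ j) ^ h * C ^ (N + j).+1))%N.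
    rewrite -(ler_nat R) natrX -[leLHS]mulr1.
    have F2 : 0 < K`!%:R ^+ 2 :> R by rewrite exprn_gt0// ltr0n fact_gt0.
    apply: le_trans (ler_wpM2l (ltW F2) lowb) _.
    rewrite le_eqVlt; apply/orP; left; apply/eqP.
    rewrite [in RHS]natrM !mulrA; congr (_ * _); rewrite /A !(natrM, natrX).
    have := factr_neq0 R K; move: (K`!%:R : R) => x x0.
    by field; rewrite x0.
  have := liouville_numerics _ _ _ _ MK NK _ _ num.
  rewrite G3 DG beG CG (leq_trans N3 (ltnW NK)).
  have -> : ((2 * N + j) * h.+1 <= K)%N.
    have : (4 * (h.+1 * N) <= K)%N.
      by apply: leq_trans MK; rewrite ME leq_mul2l leq_mul2l leqnSn !orbT.
    have : (2 * (h.+1 * j) <= K)%N.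
      by apply: leq_trans JK; rewrite mulnA leq_mul2l jJ orbT.
    by clear; lia.
  move=> /(_ isT isT isT isT isT isT) num2.
  have := @growth_numerics K e0 Y _ num2 isT _ K0.
  have -> : (0 < Y)%N by rewrite /Y expn_gt0 (leq_ltn_trans _ G3).
  have -> : (K ^ K <= e0 ^ K * K`!)%N.
    rewrite -(ler_nat R) natrM !natrX (le_trans (expn_le_fact R K))//.
    by rewrite ler_wpM2r// lerXn2r// ?nnegrE ?expR_ge0.
  by move=> /(_ isT isT); rewrite leqNgt (leq_ltn_trans N1 NK).
have JE : (E < J)%N.
  have : (2 * h.+1 * E.+1 < 2 * h.+1 * J.+1)%N.
    exact: leq_ltn_trans N4 (ltn_trans NK KJ).
  by rewrite ltn_pmul2l.
(* The weighted series vanishes at [al], and below index [K + J + 1] its only nonzero coefficient is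
   the one of index [K]; this term must be balanced by the tail. *)
pose d (k : nat) : R := (\prod_(t < J) (k%:R - (K + t).+1%:R)) * r k.
have [rd dal] : rapid d /\ psum d al = 0 := @psum_moments R r al K J rr moments.
pose A : R := N`!%:R ^+ 2 * J`!%:R * 2 ^+ J *
  (D%:R * (D * be)%:R ^+ (K + J).+1 / (K + J)`!%:R ^+ 2).
have up : `|psum d al - \sum_(0 <= m < (K + J).+1) d m * al ^+ m| <=
    A * expR ((2 * D * be)%:R).
  apply: psum_tail => // i.
  have prodE : \prod_(t < J) (((K + J).+1 + i)%N%:R - (K + t).+1%:R) =
      (((J + i) ^_ J)%N)%:R :> R.
    rewrite ffact_prod natr_prod; apply: eq_bigr => t _.
    have tJ := ltn_ord t; rewrite -natrB; last by move: tJ; clear; lia.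
    by congr _%:R; clear; lia.
  rewrite /d prodE -bin_ffact -mulrA normrM ger0_norm//.
  have b2 : ('C(J + i, J) * J`!)%:R <= 2 ^+ J * 2 ^+ i * J`!%:R :> R.
    by rewrite natrM ler_wpM2r// -exprD -natrX ler_nat bin_le_exp2.
  apply: le_trans (ler_pM _ _ b2 (tail _ i)) _ => //.
  have -> : ((2 * D * be)%:R : R) = 2 * (D * be)%:R by rewrite -mulnA natrM.
  rewrite exprMn /A.
  have F1 : 0 <= (D%:R * (D * be)%:R ^+ (K + J).+1 : R) by rewrite mulr_ge0 ?exprn_ge0.
  have F2 : ((K + J).+1`!%:R : R) ^- 2 <= (K + J)`!%:R ^- 2.
    rewrite lef_pV2 ?posrE ?exprn_gt0 ?ltr0n ?fact_gt0//.
    by apply: lerXn2r; rewrite ?nnegrE// ler_nat factS leq_pmull.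
  have F3 : 0 <= 2 ^+ J * 2 ^+ i * J`!%:R * (N`!%:R ^+ 2) *
      ((D * be)%:R ^+ i / i`!%:R) * (D%:R * (D * be)%:R ^+ (K + J).+1) :> R.
    by rewrite !mulr_ge0 ?exprn_ge0 ?invr_ge0 ?exprn_ge0.
  apply: (le_trans _ (le_trans (ler_wpM2l F3 F2) _)).
    by rewrite le_eqVlt; apply/orP; left; apply/eqP; rewrite -exprVn; ring.
  by rewrite le_eqVlt; apply/orP; left; apply/eqP; rewrite -!exprVn; ring.
have sumE : \sum_(0 <= m < (K + J).+1) d m * al ^+ m = d K * al ^+ K.
  rewrite (bigD1_seq K) ?mem_index_iota ?iota_uniq//=; last by clear; lia.
  rewrite big1_seq ?addr0// => k /andP[/eqP kK]; rewrite mem_index_iota => /andP[_ kJ].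
  have [kltK|] := ltnP k K; first by rewrite /d /r rltK// mul0r !mulr0 mul0r.
  move=> Kk; have kJ' : (k - K.+1 < J)%N by move: kK Kk kJ; clear; lia.
  rewrite /d (bigD1 (Ordinal kJ'))//=.
  by rewrite (_ : (K + (k - K.+1)).+1 = k) ?subrr ?mul0r//; move: kK Kk; clear; lia.
have prodK : `|\prod_(t < J) (K%:R - (K + t).+1%:R)| = J`!%:R :> R.
  rewrite normr_prod fact_prod big_add1 big_mkord natr_prod.
  by apply: eq_bigr => t _; rewrite -addnS natrD opprD addrA subrr sub0r normrN ger0_norm.
(* Arithmetic enters here: a nonzero integer [rho K] has absolute value at least 1. *)
have rK : N`!%:R ^+ 2 / (K`! * (K + E)`!)%:R <= `|r K|.
  rewrite /r normrM (ger0_norm F0) ler_wpM2l// normrM natrM.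
  rewrite (ger0_norm (_ : 0 <= (_ * _)^-1)) ?invr_ge0 ?mulr_ge0//.
  rewrite -[leLHS]mul1r ler_wpM2r ?invr_ge0 ?mulr_ge0//.
  by rewrite -intr_norm (_ : 1 = 1%:~R)// ler_int -gtz0_ge1 normr_gt0.
move: up; rewrite dal sub0r normrN sumE normrM normrX /d normrM prodK => up.
have num : ((K + J)`! ^ 2 <= K`! * (K + E)`! *
     (be ^ K * (2 ^ J * D * (D * be) ^ (K + J).+1 * G)))%N.
  rewrite -(ler_nat R).
  have alK : 1 <= `|al| ^+ K * be%:R ^+ K.
    rewrite -exprMn exprn_ege1//.
    have := ler_wpM2l (ltW al_pos) (proj2 be_al).
    by rewrite mulfV ?gt_eqF.
  have H1 : J`!%:R * (N`!%:R ^+ 2 / (K`! * (K + E)`!)%:R) * `|al| ^+ K <= A * G%:R.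
    apply: le_trans (_ : J`!%:R * `|r K| * `|al| ^+ K <= _).
      by rewrite ler_wpM2r ?exprn_ge0// ler_wpM2l.
    apply: le_trans up _; rewrite ler_wpM2l// /A.
    by rewrite !mulr_ge0 ?invr_ge0 ?exprn_ge0.
  have KJ0 : 0 < (K + J)`!%:R ^+ 2 :> R by rewrite exprn_gt0// ltr0n fact_gt0.
  have NJ0 : 0 < J`!%:R * N`!%:R ^+ 2 :> R by rewrite mulr_gt0 ?exprn_gt0 ?ltr0n ?fact_gt0.
  have KE0 : 0 < (K`! * (K + E)`!)%:R :> R by rewrite ltr0n muln_gt0 !fact_gt0.
  have be0 : 0 <= be%:R ^+ K :> R by rewrite exprn_ge0.
  rewrite -(ler_pM2l NJ0) natrX.
  have T1 : J`!%:R * N`!%:R ^+ 2 * (K + J)`!%:R ^+ 2 <=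
      J`!%:R * N`!%:R ^+ 2 * (K + J)`!%:R ^+ 2 * (`|al| ^+ K * be%:R ^+ K).
    by rewrite ler_peMr// mulr_ge0 ?ltW.
  apply: le_trans T1 _.
  have T2 := ler_wpM2l (mulr_ge0 (mulr_ge0 (ltW KJ0) (ltW KE0)) be0) H1.
  apply: le_trans (_ : _ <= (K + J)`!%:R ^+ 2 * (K`! * (K + E)`!)%:R * be%:R ^+ K *
     (J`!%:R * (N`!%:R ^+ 2 / (K`! * (K + E)`!)%:R) * `|al| ^+ K)) _.
    rewrite le_eqVlt; apply/orP; left; apply/eqP.
    by field; rewrite !factr_neq0.
  apply: le_trans T2 _; rewrite le_eqVlt; apply/orP; left; apply/eqP.
  rewrite /A !(natrM, natrX); have := factr_neq0 R (K + J).
  move: ((K + J)`!%:R : R) => x x0.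
  by field; rewrite x0.
have JK' : (J <= K)%N by apply: leq_trans JK; rewrite leq_pmull.
have := isolation_numerics _ _ _ (ltnW JE) _ JK' (ltnW KJ) _ num.
rewrite (ltnW G3) DG beG (leq_ltn_trans (leq0n E) JE).
have -> : (3 < K)%N by apply: leq_trans MK; rewrite ME leq_pmulr.
by move=> /(_ isT isT isT isT isT); rewrite leqNgt (leq_ltn_trans N2 NK).
Qed.

(* Lommel polynomials: [al ^+ k * phi (n + k.+1) al] is a multiple of
   [phi n.+1 al] when [phi n al = 0]. *)
Fixpoint lommel (n k : nat) : {poly int} * {poly int} :=
  if k is k'.+1 then
    let: (p, q) := lommel n k' in (q, 'X * p - q *+ (n + k).+1)
  else (1, - (1 *+ n.+1)).

(** At a common zero the Lommel polynomial vanishes, because its cofactor [phi n.+1 al] does not. It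
    is a nonzero integer polynomial, so [al] would be algebraic, against [siegel_transcendence]. *)
Lemma bourget (R : realType) (n d : nat) (al : R) :
  (forall B : R, exists2 z, B < `|z| & phi n z = 0) -> al != 0 ->
  phi n al = 0 -> phi (n + d.+1) al != 0.
Proof.
move=> zeros al0 pn; apply/negP => /eqP pnd.
pose L (k : nat) := lommel n k.
have LE k : al ^+ k * phi (n + k.+1) al = zhorner (L k).1 al * phi n.+1 al /\
            al ^+ k.+1 * phi (n + k.+2) al = zhorner (L k).2 al * phi n.+1 al.
  elim: k => [|k [IH1 IH2]].
    rewrite /L /= zhornerN zhornerMn.
    rewrite (_ : zhorner 1 al = 1); last by rewrite /zhorner rmorph1 hornerE.
    rewrite expr0 !mul1r expr1 addn1; split=> //.
    have := phi_rec n al; rewrite pn (_ : n + 2 = n.+2)%N; last by lia.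
    by move=> /eqP; rewrite addr_eq0 => /eqP ->; rewrite mulNr.
  rewrite /L /=; rewrite /L in IH1 IH2; case E : (lommel n k) IH1 IH2 => [p q] /= IH1 IH2.
  split=> //; rewrite zhornerD zhornerN zhornerMn zhornerXM.
  have := phi_rec (n + k.+1) al.
  rewrite (_ : (n + k.+1).+2 = n + k.+3)%N; last by lia.
  rewrite (_ : (n + k.+1).+1 = n + k.+2)%N; last by lia.
  move=> H.
  have -> : (al * zhorner p al - zhorner q al *+ (n + k.+2)) * phi n.+1 al =
      al * (zhorner p al * phi n.+1 al) -
      (zhorner q al * phi n.+1 al) * (n + k.+2)%:R.
    by rewrite -mulr_natr; ring.
  by rewrite -IH1 -IH2 -H !exprS; ring.
(* Constant terms follow a one-term recursion, each being minus a positive integer times the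
   previous one; hence the polynomials are nonzero. *)
have L0 k : ((L k).1)`_0 != 0 /\ ((L k).2)`_0 != 0.
  elim: k => [|k [IH1 IH2]].
    rewrite /L /= coefN coefMn coef1 /=; split=> //.
  rewrite /L /=; rewrite /L in IH1 IH2; case E : (lommel n k) IH1 IH2 => [p q] /= IH1 IH2.
  split=> //; rewrite coefB coefXM /= sub0r oppr_eq0 coefMn -mulr_natl mulf_eq0 negb_or.
  by rewrite pnatr_eq0.
have := siegel_transcendence zeros _ _ al0.
move=> /(_ (L d).1) H; have /eqP := pn; apply/negP; apply: H.
  by apply/eqP => L1; have [] := L0 d; rewrite L1 coef0 eqxx.
have [LE1 _] := LE d; move/esym/eqP: LE1; rewrite pnd mulr0 mulf_eq0.
by rewrite (negbTE (phi_simple_zero pn)) orbF => /eqP.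
Qed.

(** * Positive zeros of Bessel functions *)

Lemma derV (R : realType) (f : R -> R) (x a : R) : f x != 0 ->
  is_derive x 1 f a -> is_derive x 1 (fun y => (f y)^-1) (- a / f x ^+ 2).
Proof.
move=> fx0 [df <-]; apply: DeriveDef; first exact: derivableV.
by rewrite deriveV// /GRing.scale /= !mulNr mulrC.
Qed.

Lemma is_derive_continuous_itv (R : realType) (f f' : R -> R) (a b : R) :
  (forall t, a <= t <= b -> is_derive t 1 f (f' t)) ->
  {within `[a, b], continuous f}.
Proof.
move=> D; apply: derivable_within_continuous => t.
by rewrite in_itv /= => /D[].
Qed.

Lemma der_ge0_le (R : realType) (f f' : R -> R) (a b : R) : a <= b ->
  (forall t, a <= t <= b -> is_derive t 1 f (f' t)) ->
  (forall t, a <= t <= b -> 0 <= f' t) -> f a <= f b.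
Proof.
move=> ab D f'0; have cf := is_derive_continuous_itv D.
have [|c cab E] := @MVT_segment _ f f' a b ab _ cf.
  by move=> x; rewrite in_itv /= => /andP[/ltW ax /ltW xb]; apply: D; rewrite ax.
by rewrite -subr_ge0 E mulr_ge0 ?f'0 ?subr_ge0//; move: cab; rewrite in_itv.
Qed.

Lemma der_ge0_lt (R : realType) (f f' : R -> R) (a b : R) : a < b ->
  (forall t, a <= t <= b -> is_derive t 1 f (f' t)) ->
  (forall t, a <= t <= b -> 0 <= f' t) ->
  {for a, continuous f'} -> 0 < f' a -> f a < f b.
Proof.
move=> ab D f'0 cf' fa.
have [d d0 Hd] : exists2 d, 0 < d & forall t, `|a - t| < d -> 0 < f' t.
  have cf'' : f' t @[t --> a] --> f' a by exact: cf'.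
  have : \forall t \near a, 0 < f' t by apply: (cvgr_gt _ cf'').
  by move=> /nbhs_ballP[d d0 H]; exists d => // t; apply: H.
pose c := Num.min b (a + d / 2).
have ac : a < c by rewrite /c lt_min ab/= ltrDl divr_gt0.
have cb : c <= b by rewrite /c ge_min lexx.
have cd : c <= a + d / 2 by rewrite /c ge_min lexx orbT.
have h1 : f c <= f b.
  apply: (der_ge0_le (f' := f')) => // t /andP[ct tb]; first by apply: D; rewrite tb andbT; lra.
  by apply: f'0; rewrite tb andbT; lra.
have D1 t : a <= t <= c -> is_derive t 1 f (f' t).
  by move=> /andP[at_ tc]; apply: D; rewrite at_ /=; lra.
have cf := is_derive_continuous_itv D1.
have [|e eac E] := @MVT _ f f' a c ac _ cf.
  by move=> x; rewrite in_itv /= => /andP[/ltW ax /ltW xb]; apply: D1; rewrite ax.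
move: eac; rewrite in_itv /= => /andP[ae ec].
apply: lt_le_trans h1; rewrite -subr_gt0 E mulr_gt0 ?subr_gt0//.
by apply: Hd; rewrite ltr_norml; apply/andP; split; lra.
Qed.

(* Picone's identity: [(y / z) (y' z - y z')] has derivative
   [((y' z - y z') / z) ^+ 2 + (q - p) y ^+ 2]. *)
Lemma picone (R : realType) (y y1 z z1 p q : R -> R) (a b : R) : a < b ->
  (forall t, a <= t <= b -> is_derive t 1 y (y1 t)) ->
  (forall t, a <= t <= b -> is_derive t 1 y1 (- (p t * y t))) ->
  (forall t, a <= t <= b -> is_derive t 1 z (z1 t)) ->
  (forall t, a <= t <= b -> is_derive t 1 z1 (- (q t * z t))) ->
  (forall t, a <= t <= b -> p t <= q t) ->
  (forall t, a <= t <= b -> z t != 0) ->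
  {for a, continuous p} -> {for a, continuous q} ->
  y a = 0 -> y b = 0 -> y1 a != 0 -> False.
Proof.
move=> ab Dy Dy1 Dz Dz1 pq z0 cp cq ya yb y1a.
pose F t := y t * (z t)^-1 * (y1 t * z t - y t * z1 t).
pose W t := (y1 t * z t - y t * z1 t) * (z t)^-1.
pose F' t := W t * W t + (q t - p t) * (y t * y t).
have aab : a <= a <= b by rewrite lexx ltW.
have : F a < F b.
  apply: (der_ge0_lt (f' := F')) => //.
  - move=> t tab; have Z := z0 t tab.
    have DV := derV Z (Dz t tab).
    have := derM (derM (Dy t tab) DV)
      (derB (derM (Dy1 t tab) (Dz t tab)) (derM (Dy t tab) (Dz1 t tab))).
    by move=> D; apply: is_derive_eq D _; rewrite /F' /W; field.
  - by move=> t tab; rewrite addr_ge0 -?expr2 ?sqr_ge0// mulr_ge0 -?expr2 ?sqr_ge0// subr_ge0 pq.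
  - have c1 := der_cvg (Dy a aab); have c2 := der_cvg (Dy1 a aab).
    have c3 := der_cvg (Dz a aab); have c4 := der_cvg (Dz1 a aab).
    have cW : W t @[t --> a] --> W a.
      apply: cvgM; last by apply: cvgV => //; exact: z0.
      by apply: cvgB; apply: cvgM.
    by apply: cvgD; apply: cvgM => //; [apply: cvgB|apply: cvgM].
  - rewrite /F' /W ya mul0r subr0 !mulr0 addr0 mulfK ?z0//.
    by rewrite -expr2 lt_neqAle sqr_ge0 andbT eq_sym expf_eq0.
by rewrite /F ya yb !mul0r ltxx.
Qed.

(** This is [2 ^ m J_m]; the constant changes neither the zeros nor the equation. *)
Definition bess (R : realType) (m : nat) (t : R) : R :=
  t ^+ m * phi m (- (t ^+ 2 / 4)).

Definition bess1 (R : realType) (m : nat) (t : R) : R :=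
  m%:R * t ^+ m.-1 * phi m (- (t ^+ 2 / 4)) -
  t ^+ m.+1 / 2 * phi m.+1 (- (t ^+ 2 / 4)).

Lemma is_derive_phi_sq (R : realType) (m : nat) (t : R) :
  is_derive t 1 (fun s => phi m (- (s ^+ 2 / 4))) (- (t / 2) * phi m.+1 (- (t ^+ 2 / 4))).
Proof.
have D : is_derive t 1 (fun s : R => - (s ^+ 2 / 4)) (- (t / 2)).
  apply: is_derive_eq (derN (derM (derX 2 (derI t)) (derC t 1 4^-1))) _.
  by rewrite /= expr1; field.
by apply: is_derive_eq (der_comp (is_derive_phi m _) D) _; rewrite mulrC.
Qed.

Lemma is_derive_bess (R : realType) (m : nat) (t : R) :
  is_derive t 1 (@bess R m) (bess1 m t).
Proof.
apply: is_derive_eq (derM (derX m (derI t)) (is_derive_phi_sq m t)) _.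
by rewrite /bess1 (exprS t m); field.
Qed.

Lemma is_derive_bess1 (R : realType) (m : nat) (t : R) : t != 0 ->
  is_derive t 1 (@bess1 R m)
    (- (bess1 m t / t) - (1 - m%:R ^+ 2 / t ^+ 2) * bess m t).
Proof.
move=> t0.
have D1 := derM (derM (derC t 1 m%:R) (derX m.-1 (derI t))) (is_derive_phi_sq m t).
have D2 := derM (derM (derX m.+1 (derI t)) (derC t 1 2^-1)) (is_derive_phi_sq m.+1 t).
apply: is_derive_eq (derB D1 D2) _; rewrite /bess1 /bess.
have /esym := phi_rec m (- (t ^+ 2 / 4)).
move: (phi m _) (phi m.+1 _) (phi m.+2 _) => f0 f1 f2 ->.
case: m {D1 D2} => [|[|m]] /=; rewrite ?expr0 ?expr1.
- by field.
- by field.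
rewrite -!natr1 !exprS; set u := t ^+ m; set c := m%:R.
by field.
Qed.

(** The factor [sqrt t] removes the first-order term of Bessel's equation, which becomes
    [w'' = - q w] with [q = qbess m], as Picone's identity requires. *)
Definition wbess (R : realType) (m : nat) (t : R) : R := Num.sqrt t * bess m t.

Definition wbess1 (R : realType) (m : nat) (t : R) : R :=
  (2 * Num.sqrt t)^-1 * bess m t + Num.sqrt t * bess1 m t.

Definition qbess (R : realType) (m : nat) (t : R) : R :=
  1 - (m%:R ^+ 2 - 4^-1) / t ^+ 2.

Lemma is_derive_wbess (R : realType) (m : nat) (t : R) : 0 < t ->
  is_derive t 1 (@wbess R m) (wbess1 m t).
Proof. by move=> t0; exact: derM (is_derive1_sqrt t0) (is_derive_bess m t). Qed.

Lemma is_derive_wbess1 (R : realType) (m : nat) (t : R) : 0 < t ->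
  is_derive t 1 (@wbess1 R m) (- (qbess m t * wbess m t)).
Proof.
move=> t0; have s0 : Num.sqrt t != 0 by rewrite gt_eqF ?sqrtr_gt0.
have tn0 : t != 0 by rewrite gt_eqF.
have ds := is_derive1_sqrt t0.
have dV : is_derive t 1 (fun s => (2 * Num.sqrt s)^-1) (- (4 * t * Num.sqrt t)^-1).
  apply: is_derive_eq (derV _ (derM (derC t 1 2) ds)) _; first by rewrite mulf_neq0.
  by rewrite mul0r add0r -{3}(sqr_sqrtr (ltW t0)); field.
have := derD (derM dV (is_derive_bess m t)) (derM ds (is_derive_bess1 m tn0)).
move=> D; apply: is_derive_eq D _; rewrite /qbess /wbess.
move: (bess m t) (bess1 m t) => v v1.
have := esym (sqr_sqrtr (ltW t0)); move: (Num.sqrt t) s0 => s s0 E.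
by rewrite E; field.
Qed.

(* Positive zeros of the Bessel function [J_m]. *)
Definition bzero (R : realType) (m : nat) (t : R) : Prop :=
  0 < t /\ phi m (- (t ^+ 2 / 4)) = 0.

Lemma bzero_wbess (R : realType) (m : nat) (t : R) : 0 < t ->
  wbess m t = 0 <-> bzero m t.
Proof.
move=> t0; rewrite /wbess /bess; split=> [/eqP|[_ ->]]; last by rewrite !mulr0.
rewrite !mulf_eq0 expf_eq0 (gt_eqF t0) andbF /= gt_eqF ?sqrtr_gt0//= => /eqP.
by split.
Qed.

Lemma wbess1_neq0 (R : realType) (m : nat) (t : R) : bzero m t -> wbess1 m t != 0.
Proof.
move=> [t0 pt]; rewrite /wbess1 /bess /bess1 pt !mulr0 sub0r add0r mulrN oppr_eq0.
rewrite !mulf_eq0 !negb_or gt_eqF ?sqrtr_gt0//= phi_simple_zero// andbT.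
by rewrite expf_eq0 gt_eqF//= invr_eq0 pnatr_eq0.
Qed.

Lemma continuous_qbess (R : realType) (m : nat) (t : R) : 0 < t ->
  {for t, continuous (@qbess R m)}.
Proof.
move=> t0; apply: (@der_cvg _ _ _ (- ((m%:R ^+ 2 - 4^-1) * (- (2 * t) / (t ^+ 2) ^+ 2)))).
have t2 : t ^+ 2 != 0 by rewrite expf_eq0 gt_eqF.
have := derB (derC t 1 1) (derZ (m%:R ^+ 2 - 4^-1) (@derV _ (fun s => s ^+ 2) t _ t2 (derX 2 (derI t)))).
by move=> D; apply: is_derive_eq D _; rewrite /= expr1; ring.
Qed.

Lemma is_derive_sin_affine (R : realType) (Q a c t : R) :
  is_derive t 1 (fun s => sin (Q * (s - a) + c)) (Q * cos (Q * (t - a) + c)).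
Proof.
have D : is_derive t 1 (fun s => Q * (s - a) + c) Q.
  apply: is_derive_eq (derD (derZ Q (derB (derI t) (derC t 1 a))) (derC t 1 c)) _.
  by rewrite subr0 mulr1 addr0.
by apply: is_derive_eq (der_comp (is_derive_sin _) D) _; rewrite mulrC.
Qed.

Lemma is_derive_cos_affine (R : realType) (Q a c t : R) :
  is_derive t 1 (fun s => Q * cos (Q * (s - a) + c))
                (- (Q ^+ 2 * sin (Q * (t - a) + c))).
Proof.
have D : is_derive t 1 (fun s => Q * (s - a) + c) Q.
  apply: is_derive_eq (derD (derZ Q (derB (derI t) (derC t 1 a))) (derC t 1 c)) _.
  by rewrite subr0 mulr1 addr0.
by apply: is_derive_eq (derZ Q (der_comp (is_derive_cos _) D)) _; ring.
Qed.

(** * Sturm comparison and the gaps between zeros *)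

Lemma bzero_gap (R : realType) (m : nat) (a b Q : R) : 0 < Q -> a < b ->
  bzero m a -> bzero m b -> (forall t, a <= t <= b -> qbess m t <= Q ^+ 2) ->
  pi <= Q * (b - a).
Proof.
move=> Q0 ab za zb qQ; rewrite leNgt; apply/negP => lt_pi.
have [a0 _] := za; have [b0 _] := zb.
(* The phase centres an arch of the sine on [[a, b]], so that the sine is positive up to both
   ends. *)
pose c := (pi - Q * (b - a)) / 2; have c0 : 0 < c by rewrite /c; lra.
apply: (@picone _ (@wbess R m) (@wbess1 R m) (fun s => sin (Q * (s - a) + c))
  (fun s => Q * cos (Q * (s - a) + c)) (@qbess R m) (fun=> Q ^+ 2) a b ab).
- by move=> t /andP[at_ _]; apply: is_derive_wbess; lra.
- by move=> t /andP[at_ _]; apply: is_derive_wbess1; lra.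
- by move=> t _; exact: is_derive_sin_affine.
- by move=> t _; exact: is_derive_cos_affine.
- exact: qQ.
- move=> t /andP[at_ tb]; rewrite gt_eqF// sin_gt0_pi//; apply/andP; split.
    have : 0 <= Q * (t - a) by rewrite mulr_ge0 ?(ltW Q0)// subr_ge0.
    by lra.
  have : Q * (t - a) <= Q * (b - a) by rewrite ler_wpM2l ?(ltW Q0)//; lra.
  by rewrite /c; lra.
- exact: continuous_qbess.
- exact: cst_continuous.
- exact/bzero_wbess.
- exact/bzero_wbess.
- exact: wbess1_neq0.
Qed.

(** The roles are exchanged: the sine vanishes at both ends of the interval, and a [wbess] without
    zeros would be the nonvanishing solution of the equation with the larger potential. *)
Lemma bzero_in_itv (R : realType) (m : nat) (a Q : R) : 0 < a -> 0 < Q ->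
  (forall t, a <= t <= a + pi / Q -> Q ^+ 2 <= qbess m t) ->
  exists2 t, a <= t <= a + pi / Q & bzero m t.
Proof.
move=> a0 Q0 qQ; apply: contrapT => noz.
have ab : a < a + pi / Q by rewrite ltrDl divr_gt0// pi_gt0.
apply: (@picone _ (fun s => sin (Q * (s - a) + 0)) (fun s => Q * cos (Q * (s - a) + 0))
  (@wbess R m) (@wbess1 R m) (fun=> Q ^+ 2) (@qbess R m) a (a + pi / Q) ab).
- by move=> t _; exact: is_derive_sin_affine.
- by move=> t _; exact: is_derive_cos_affine.
- by move=> t /andP[at_ _]; apply: is_derive_wbess; lra.
- by move=> t /andP[at_ _]; apply: is_derive_wbess1; lra.
- exact: qQ.
- move=> t tab; apply/eqP => wt; apply: noz; exists t => //.
  by apply/bzero_wbess => //; case/andP: tab => *; lra.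
- exact: cst_continuous.
- exact: continuous_qbess.
- by rewrite subrr mulr0 addr0 sin0.
- by rewrite addr0 addrAC subrr add0r mulrCA mulfV ?gt_eqF// mulr1 sinpi.
- by rewrite subrr mulr0 addr0 cos0 mulr1 gt_eqF.
Qed.

(* Monotonicity of [t J_m' J_m] where [t <= m]. *)
Lemma bzero_ge (R : realType) (m : nat) (a : R) : (0 < m)%N -> bzero m a -> m%:R <= a.
Proof.
move=> m0 [a0 za]; rewrite leNgt; apply/negP => am.
pose F (t : R) : R := t * bess1 m t * bess m t.
pose F' (t : R) : R := (m%:R ^+ 2 - t ^+ 2) / t * bess m t ^+ 2 + t * bess1 m t ^+ 2.
have DF (t : R) : 0 < t -> is_derive t 1 F (F' t).
  move=> t0; have tn0 : t != 0 by rewrite gt_eqF.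
  have := derM (derM (derI t) (is_derive_bess1 m tn0)) (is_derive_bess m t).
  by move=> D; apply: is_derive_eq D _; rewrite /F'; field.
have Fa : F a = 0 by rewrite /F /bess za !mulr0.
(* [F] vanishes at the origin; its sign just to the right of it is that of the factor [G], with
   [G 0 = m phi_m(0) ^ 2 > 0]. *)
have FE (t : R) : 0 < t -> F t = t ^+ (m + m) * (phi m (- (t ^+ 2 / 4)) *
   (m%:R * phi m (- (t ^+ 2 / 4)) - t ^+ 2 / 2 * phi m.+1 (- (t ^+ 2 / 4)))).
  move=> t0; rewrite /F /bess /bess1; case: m m0 {F F' DF Fa za am} => // k _ /=.
  by rewrite exprD !exprS; field.
pose G (t : R) := phi m (- (t ^+ 2 / 4)) *
   (m%:R * phi m (- (t ^+ 2 / 4)) - t ^+ 2 / 2 * phi m.+1 (- (t ^+ 2 / 4))) : R.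
have G0 : 0 < G 0.
  rewrite /G expr0n /= !mul0r oppr0 !phi0 addr0 !mulr_gt0 ?invr_gt0 ?ltr0n ?fact_gt0//.
have cG : {for 0, continuous G}.
  have c1 k : {for (0:R), continuous (fun t : R => phi k (- (t ^+ 2 / 4)))}.
    exact: der_cvg (is_derive_phi_sq k 0).
  have c2 : {for (0:R), continuous (fun t : R => t ^+ 2 / 2)}.
    exact: der_cvg (derM (derX 2 (derI (0:R))) (derC (0:R) 1 2^-1)).
  apply: cvgM; first exact: c1.
  apply: cvgB; first by apply: cvgM; [exact: cvg_cst|exact: c1].
  by apply: cvgM; [exact: c2|exact: c1].
have cG' : G t @[t --> 0] --> G 0 by exact: cG.
have : \forall t \near (0:R), 0 < G t by apply: (cvgr_gt _ cG').
move=> /nbhs_ballP[d /= d0 Hd].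
pose e := Num.min a (d / 2).
have e0 : 0 < e by rewrite lt_min a0 divr_gt0.
have ea : e <= a by rewrite ge_min lexx.
have ed : e <= d / 2 by rewrite ge_min lexx orbT.
have Fe : 0 < F e.
  rewrite FE// mulr_gt0 ?exprn_gt0//; apply: Hd.
  by rewrite /ball /= sub0r normrN gtr0_norm//; lra.
have : F e <= F a.
  apply: (der_ge0_le (f' := F')) => // t /andP[et ta]; first by apply: DF; lra.
  have t0 : 0 < t by lra.
  have tm : t ^+ 2 <= m%:R ^+ 2 by rewrite lerXn2r ?nnegrE//; lra.
  apply: addr_ge0; apply: mulr_ge0; rewrite ?sqr_ge0//; last lra.
  by apply: mulr_ge0; [rewrite subr_ge0|rewrite invr_ge0; lra].
by rewrite Fa; lra.
Qed.

(** For [a < 1] the constant term 1 of [phi 0] dominates the rest of the series. The potential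
    [qbess 0] exceeds 1 and is unbounded near the origin, so the zeros of order 0 have to be kept
    away from it. *)
Lemma bzero0_ge1 (R : realType) (a : R) : bzero 0 a -> 1 <= a.
Proof.
move=> [a0 za]; rewrite leNgt; apply/negP => a1.
set z := - (a ^+ 2 / 4) in za.
have z0 : 0 <= `|z| by [].
have z1 : `|z| < 4^-1.
  rewrite /z normrN ger0_norm ?divr_ge0 ?sqr_ge0//.
  have : a ^+ 2 < 1 by rewrite expr_lt1 ?(ltW a0).
  by lra.
have := @psum_tail _ (phi_coef R 0) z `|z| `|z| 1 (rapid_phi_coef R 0).
have c0 : phi_coef R 0 0 = 1 by rewrite /phi_coef addn0 fact0 mulr1 invr1.
rewrite -/(phi 0 z) za big_nat1 expr0 mulr1 c0 sub0r normrN1 => H.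
have {H} : 1 <= `|z| * expR `|z|.
  apply: H => i; rewrite normrM normrX add1n exprS /phi_coef addn0.
  rewrite ger0_norm ?invr_ge0 ?mulr_ge0// mulrC -mulrA ler_wpM2l// ler_wpM2l ?exprn_ge0//.
  rewrite lef_pV2 ?posrE ?mulr_gt0 ?ltr0n ?fact_gt0// -natrM ler_nat.
  by apply: leq_trans (leq_pmulr _ (fact_gt0 _)); rewrite factS leq_pmull.
have h1 := expR_ge1Dx (- `|z|); have h2 := expR_gt0 `|z|.
have h3 : expR `|z| * expR (- `|z|) = 1 by rewrite -expRD subrr expR0.
by nra.
Qed.

(** * Sums over the zeros *)

Definition next_in (R : realType) (P : R -> Prop) (a b : R) : Prop :=
  [/\ a < b, P a, P b & forall t, P t -> a < t -> t < b -> False].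

Fixpoint chain (T : Type) (r : T -> T -> Prop) (x : T) (s : seq T) : Prop :=
  if s is y :: s' then r x y /\ chain r y s' else True.

Lemma chain_rcons (T : Type) (r : T -> T -> Prop) (x y : T) (s : seq T) :
  chain r x s -> r (last x s) y -> chain r x (rcons s y).
Proof. by elim: s x => [|z s IH] x //= [xz zs] ly; split=> //; exact: IH. Qed.

(** Induction on the number of steps of length [g] needed to reach [x]. The supremum of the points
    before [x] is attained, since a point closer to it than [g] has no successor before [x]. *)
Lemma separated_enum (R : realType) (P : R -> Prop) (g : R) : 0 < g ->
  (forall a b, P a -> P b -> a < b -> g <= b - a) -> (forall a, P a -> 0 < a) ->
  forall x, P x -> exists (z : R) (s : seq R),
  [/\ chain (next_in P) z s, last z s = x, P z, forall t, P t -> z <= t &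
   uniq (z :: s) /\ forall t, t \in z :: s <-> P t /\ t <= x].
Proof.
move=> g0 sep pos x Px.
have [n xn] : exists n : nat, x <= n%:R * g.
  exists (Num.bound (x / g)); rewrite -ler_pdivrMr//.
  by rewrite ltW// archi_boundP// divr_ge0 ?ltW// pos.
elim: n x Px xn => [|n IH] x Px xn.
  by exfalso; have := pos _ Px; rewrite mul0r in xn; lra.
have [[y0 [Py0 y0x]]|nolt] := pselect (exists y, P y /\ y < x); last first.
  have minx t : P t -> x <= t.
    by move=> Pt; rewrite leNgt; apply/negP => tx; apply: nolt; exists t.
  exists x, [::]; split=> //; split=> // t; rewrite inE; split.
    by move=> /eqP ->; split.
  by move=> [Pt tx]; apply/eqP/le_anti; rewrite tx minx.
pose S := [set y | P y /\ y < x].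
have supS : has_sup S by split; [exists y0|exists x => y [_ /ltW]].
have [y [Py yx] ysup] := sup_adherent g0 supS.
have ymax t : P t -> t < x -> t <= y.
  move=> Pt tx; rewrite leNgt; apply/negP => yt.
  have := sep _ _ Py Pt yt.
  have tS : t <= sup S by apply: sup_upper_bound; [|split].
  by lra.
have yn : y <= n%:R * g.
  have := sep _ _ Py Px yx; move: xn; rewrite -natr1 mulrDl mul1r; lra.
have [z [s [zs ls Pz zmin [us ms]]]] := IH y Py yn.
exists z, (rcons s x); split=> //.
- apply: chain_rcons => //; rewrite ls; split=> // t Pt yt tx.
  by have := ymax _ Pt tx; lra.
- by rewrite last_rcons.
- split.
    rewrite -rcons_cons rcons_uniq us andbT; apply/negP => /ms[_ xy]; lra.
  move=> t; rewrite -rcons_cons mem_rcons inE; split.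
    by move=> /orP[/eqP ->|/ms[Pt ty]]; split=> //; lra.
  move=> [Pt tx]; have [->|tnx] := eqVneq t x; first by rewrite ?eqxx.
  apply/orP; right; apply/ms; split=> //; apply: ymax => //.
  by rewrite lt_neqAle tnx.
Qed.

(** With [y = m / a] in [[0, 1]], the bound [1 - y ^ 2 >= (1 - y) ^ 2] provides a frequency that is
    rational in [a] and [m]. *)
Lemma qbess_ge (R : realType) (m : nat) (a t : R) : 0 < a -> a <= t -> m%:R <= a ->
  ((a - m%:R) / a) ^+ 2 <= qbess m t.
Proof.
move=> a0 at_ ma; rewrite /qbess.
pose y := m%:R / a; have y0 : 0 <= y by rewrite divr_ge0// ltW.
have y1 : y <= 1 by rewrite ler_pdivrMr// mul1r.
have -> : (a - m%:R) / a = 1 - y by rewrite /y; field; rewrite gt_eqF.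
apply: (@le_trans _ _ (1 - y ^+ 2)); first by nra.
have t0 : 0 < t by lra.
have h : (m%:R ^+ 2 - 4^-1) / t ^+ 2 <= y ^+ 2.
  rewrite ler_pdivrMr ?exprn_gt0// /y expr_div_n.
  have h1 : m%:R ^+ 2 <= m%:R ^+ 2 / a ^+ 2 * t ^+ 2.
    rewrite mulrAC -mulrA ler_peMr ?sqr_ge0// ler_pdivlMr ?exprn_gt0// mul1r.
    by apply: lerXn2r; rewrite ?nnegrE //; lra.
  by lra.
by lra.
Qed.

Lemma bzero_ge_nat (R : realType) (m : nat) (a : R) : bzero m a -> m%:R <= a.
Proof.
case: m => [[a0 _]|m]; first exact: ltW.
exact: bzero_ge.
Qed.

Lemma bzero_after (R : realType) (m : nat) (e A : R) : 0 < e -> 0 < A ->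
  (1 + e) * m%:R <= A ->
  exists2 t, A <= t <= A + pi * ((1 + e) / e) & bzero m t.
Proof.
move=> e0 A0 mA.
have Q0 : 0 < e / (1 + e) by rewrite divr_gt0//; lra.
have -> : pi * ((1 + e) / e) = pi / (e / (1 + e)) :> R.
  by field; rewrite !gt_eqF//; lra.
apply: bzero_in_itv => // t /andP[At _].
have em : 0 <= e * m%:R by rewrite mulr_ge0// ltW.
have mA' : m%:R <= A by lra.
apply: le_trans (qbess_ge A0 At mA').
rewrite lerXn2r ?nnegrE ?(ltW Q0) ?divr_ge0 ?subr_ge0 ?(ltW A0)//.
rewrite ler_pdivlMr// mulrAC ler_pdivrMr; last lra.
by nra.
Qed.

(** A zero is sought from [a + e m + 1 / 2] on, which is beyond [(1 + e) m] because [a >= m]. The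
    result is a gap small compared with [m], also close to the turning point [m] where the frequency
    degenerates. *)
Lemma bzero_next_gap (R : realType) (m : nat) (e a b : R) : 0 < e ->
  next_in (@bzero R m) a b -> b - a <= e * m%:R + (pi * ((1 + e) / e) + 1).
Proof.
move=> e0 [ab za zb noz]; rewrite leNgt; apply/negP => big.
have [a0 _] := za; have ma := bzero_ge_nat za.
have em : 0 <= e * m%:R by rewrite mulr_ge0// ltW.
have [||t /andP[h1 h2] zt] := @bzero_after R m e (a + e * m%:R + 1 / 2) e0; try lra.
by apply: (noz t zt); lra.
Qed.

Lemma bzero_first_le (R : realType) (m : nat) (e z : R) : 0 < e ->
  (forall t, bzero m t -> z <= t) ->
  z <= (1 + e) * m%:R + (pi * ((1 + e) / e) + 1).
Proof.
move=> e0 zmin; have em : 0 <= (1 + e) * m%:R by rewrite mulr_ge0//; lra.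
have [||t /andP[h1 h2] zt] := @bzero_after R m e ((1 + e) * m%:R + 1) e0; try lra.
by have := zmin _ zt; lra.
Qed.

(** To the right of [a] the frequency is at least [(a - m) / a]. Unlike the previous bound it keeps
    the constant [pi], on which the leading term of the sum depends. *)
Lemma bzero_next_upper (R : realType) (m : nat) (a b : R) :
  next_in (@bzero R m) a b -> (a - m%:R) * (b - a) <= pi * a.
Proof.
move=> [ab za zb noz]; have [a0 _] := za; have ma := bzero_ge_nat za.
have [->|am] := eqVneq a m%:R; first by rewrite subrr mul0r mulr_ge0 ?pi_ge0// ltW.
have am' : 0 < a - m%:R by rewrite subr_gt0 lt_neqAle eq_sym am.
rewrite leNgt; apply/negP => big.
pose Q := (a - m%:R) / a; have Q0 : 0 < Q by rewrite divr_gt0.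
have big' : pi / Q < b - a.
  rewrite ltr_pdivrMr// /Q mulrA ltr_pdivlMr//; lra.
(* The shift [d] moves the start off the zero [a] itself and still leaves the end of the interval
   before [b]. *)
pose d := (b - a - pi / Q) / 2; have d0 : 0 < d by rewrite /d; lra.
have [t /andP[h1 h2] zt] : exists2 t, a + d <= t <= a + d + pi / Q & bzero m t.
  apply: bzero_in_itv => //; first by lra.
  by move=> t /andP[adt _]; apply: qbess_ge => //; lra.
by apply: (noz t zt); [lra|move: h2; rewrite /d; lra].
Qed.

(** For [m >= 1] the potential is at most 1. For [m = 0] it is at most [5 / 4], the zeros being at
    least 1, and [5 / 4 <= (9 / 8) ^ 2]. *)
Lemma bzero_separation (R : realType) (m : nat) (a b : R) :
  bzero m a -> bzero m b -> a < b ->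
  pi <= (if m is 0%N then 9 / 8 else 1) * (b - a).
Proof.
move=> za zb ab; have [a0 _] := za.
apply: (@bzero_gap _ m); rewrite //; first by case: (m) => [|k]; lra.
case: m za zb => [|m] za zb t /andP[at_ tb]; rewrite /qbess.
  have a1 := bzero0_ge1 za.
  have t1 : 1 <= t ^+ 2 by rewrite exprn_ege1//; lra.
  rewrite expr0n /= sub0r mulNr opprK.
  have : 4^-1 / t ^+ 2 <= 4^-1 by rewrite ler_pdivrMr; nra.
  by lra.
have : 0 <= (m.+1%:R ^+ 2 - 4^-1) / t ^+ 2.
  rewrite divr_ge0 ?sqr_ge0// subr_ge0.
  have : 1 <= m.+1%:R :> R by rewrite ler1n.
  by nra.
by rewrite expr1n; lra.
Qed.

Lemma bzero_enum (R : realType) (m : nat) (x : R) : bzero m x ->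
  exists (z : R) (s : seq R),
  [/\ chain (next_in (@bzero R m)) z s, last z s = x, bzero m z,
      forall t, bzero m t -> z <= t &
      uniq (z :: s) /\ forall t, t \in z :: s <-> bzero m t /\ t <= x].
Proof.
apply: (@separated_enum _ _ (pi * (8 / 9))); last by move=> a [].
  by rewrite mulr_gt0 ?pi_gt0//; lra.
move=> a b za zb ab; have := bzero_separation za zb ab.
by have := pi_gt0 R; case: (m) => [|k]; lra.
Qed.

(** For consecutive zeros [2 pi a <= 2 Q a (b - a) <= Q (b ^ 2 - a ^ 2)], which telescopes; the last
    zero is left out of the sum. *)
Lemma chain_sum_upper (R : realType) (P : R -> Prop) (Q z : R) (s : seq R) :
  (forall a, P a -> 0 < a) ->
  (forall a b, P a -> P b -> a < b -> pi <= Q * (b - a)) -> 0 <= Q ->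
  chain (next_in P) z s ->
  2 * pi * (\sum_(t <- z :: s) t - last z s) <= Q * (last z s ^+ 2 - z ^+ 2).
Proof.
move=> pos sep Q0; elim: s z => [|y s IH] z /=; first by rewrite big_seq1 !subrr !mulr0.
move=> [[zy Pz Py _] ys]; have := IH y ys; rewrite !big_cons.
have := sep _ _ Pz Py zy; have := pos _ Pz; set l := last y s; set S := \sum_(j <- s) j.
move=> z0 pQ H.
have h1 : 2 * pi * z <= Q * (y ^+ 2 - z ^+ 2).
  have : pi * z <= Q * (y - z) * z by rewrite ler_wpM2r// ltW.
  have : 0 <= Q * ((y - z) * (y - z)) by rewrite mulr_ge0// mulr_ge0 ?subr_ge0 ?ltW.
  by lra.
by lra.
Qed.

(** For consecutive zeros [2 pi a >= 2 (a - m) (b - a) = (b - m) ^ 2 - (a - m) ^ 2 - (b - a) ^ 2];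
    the squares of the gaps add up to at most [g] times the total length. *)
Lemma chain_sum_lower (R : realType) (P : R -> Prop) (m g z : R) (s : seq R) :
  (forall a b, next_in P a b -> (a - m) * (b - a) <= pi * a) ->
  (forall a b, next_in P a b -> b - a <= g) ->
  chain (next_in P) z s ->
  (last z s - m) ^+ 2 - (z - m) ^+ 2 - g * (last z s - z) <=
  2 * pi * (\sum_(t <- z :: s) t - last z s).
Proof.
move=> up gap; elim: s z => [|y s IH] z /=.
  by rewrite big_seq1 !subrr !mulr0 subr0.
move=> [zy ys]; have := IH y ys; rewrite !big_cons.
have := up _ _ zy; have := gap _ _ zy; case: zy => zy _ _ _.
set l := last y s; set S := \sum_(j <- s) j => h1 h2 H.
have : (y - z) * (y - z) <= g * (y - z) by rewrite ler_wpM2r// subr_ge0 ltW.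
by lra.
Qed.

Definition bzeros_below (R : realType) (m : nat) (x : R) (l : seq R) : Prop :=
  uniq l /\ forall t, t \in l <-> bzero m t /\ t < x.

Lemma bzeros_below_chain (R : realType) (m : nat) (x : R) (l : seq R) :
  bzero m x -> bzeros_below m x l -> exists (z : R) (s : seq R),
  [/\ chain (next_in (@bzero R m)) z s, last z s = x, bzero m z,
      forall t, bzero m t -> z <= t &
      \sum_(t <- l) t = \sum_(t <- z :: s) t - last z s].
Proof.
move=> zx [ul ml]; have [z [s [cs ls zz zmin [us ms]]]] := bzero_enum zx.
exists z, s; split=> //; rewrite ls.
have P : perm_eq (x :: l) (z :: s).
  apply: uniq_perm => //=.
    by rewrite ul andbT; apply/negP => /ml[_]; rewrite ltxx.
  move=> t; apply/idP/idP.
    by rewrite inE => /orP[/eqP ->|/ml[zt /ltW tx]]; apply/ms.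
  move=> /ms[zt]; rewrite le_eqVlt => /orP[/eqP ->|tx]; first by rewrite inE eqxx.
  by rewrite inE; apply/orP; right; apply/ml.
by rewrite -(perm_big _ P) big_cons addrAC subrr add0r.
Qed.

Lemma bzeros_below_exists (R : realType) (m : nat) (x : R) : bzero m x ->
  exists l, bzeros_below m x l.
Proof.
move=> zx; have [z [s [_ _ _ _ [us ms]]]] := bzero_enum zx.
exists (rem x (z :: s)); split; first exact: rem_uniq.
move=> t; rewrite mem_rem_uniq// inE; split.
  by move=> /andP[tx /ms[zt]]; rewrite le_eqVlt (negbTE tx).
by move=> [zt tx]; rewrite /= lt_eqF//=; apply/ms; split=> //; exact: ltW.
Qed.

(** For [m >= 1] the sum contributes at most [x ^ 2 - z ^ 2 <= x ^ 2 - m ^ 2], and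
    [2 m x - m ^ 2 <= x ^ 2]. For [m = 0] the constant [9 / 8] is below 2. *)
Lemma bzeros_upper (R : realType) (m : nat) (x : R) (l : seq R) :
  bzero m x -> bzeros_below m x l ->
  2 * pi * (\sum_(t <- l) t) + 2 * m%:R * x <= 2 * x ^+ 2.
Proof.
move=> zx xl; have [z [s [cs ls zz zmin ->]]] := bzeros_below_chain zx xl.
have [x0 _] := zx; have [z0 _] := zz.
have mz := bzero_ge_nat zz; have mx := bzero_ge_nat zx.
have Q0 : 0 <= (if m is 0%N then 9 / 8 else 1) :> R by case: (m) => *; lra.
have := chain_sum_upper (fun a => @proj1 _ _) (@bzero_separation R m) Q0 cs.
rewrite ls; set S := _ - x => H.
case: m zx xl zz zmin mz mx cs H Q0 => [|m] zx xl zz zmin mz mx cs H Q0.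
  have : 0 <= z ^+ 2 by apply: sqr_ge0.
  have : 0 <= x ^+ 2 by apply: sqr_ge0.
  by lra.
have : m.+1%:R ^+ 2 <= z ^+ 2 by apply: lerXn2r; rewrite ?nnegrE//; lra.
have : 0 <= (x - m.+1%:R) ^+ 2 by apply: sqr_ge0.
by lra.
Qed.

(** Mode 1 and not mode 0 serves for the small ratios: the separation constant must be exactly 1
    here, where [m = 0] has only [9 / 8]. *)
Lemma bzeros_upper1 (R : realType) (x : R) (l : seq R) :
  bzero 1 x -> bzeros_below 1 x l ->
  2 * pi * (\sum_(t <- l) t) <= x ^+ 2.
Proof.
move=> zx xl; have [z [s [cs ls zz zmin ->]]] := bzeros_below_chain zx xl.
have := chain_sum_upper (fun a => @proj1 _ _) (@bzero_separation R 1) ler01 cs.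
by rewrite ls mul1r; have := sqr_ge0 z; lra.
Qed.

(** The bound must be uniform in [m]. Since [(x - m) ^ 2 + 2 m x = x ^ 2 + m ^ 2], there is an
    [m ^ 2] to pay for the square [(z - m) ^ 2] at the first zero [z], which may be as large as a
    multiple of [m ^ 2]. *)
Lemma bzeros_lower (R : realType) (e : R) : 0 < e ->
  exists2 X : R, 0 < X & forall (m : nat) (x : R) (l : seq R), X <= x ->
    bzero m x -> bzeros_below m x l ->
    (1 - e) * x ^+ 2 <= 2 * pi * (\sum_(t <- l) t) + 2 * m%:R * x.
Proof.
(* [d <= e / 2] is for the error [d x ^ 2], and [d <= 1 / 2] keeps [2 (d m) ^ 2] below [m ^ 2]. *)
move=> e0; pose d := Num.min (e / 2) (1 / 2).
have d0 : 0 < d by rewrite lt_min; apply/andP; split; lra.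
have de : d <= e / 2 by rewrite ge_min lexx.
have d1 : d <= 1 / 2 by rewrite ge_min lexx orbT.
pose C : R := pi * ((1 + d) / d) + 1.
have C0 : 0 < C.
  have : 0 < pi * ((1 + d) / d) :> R by rewrite mulr_gt0 ?pi_gt0 ?divr_gt0//; lra.
  by rewrite /C; lra.
have T : 0 <= (C + 2 * C ^+ 2) / (e / 2).
  apply: divr_ge0; last lra.
  by apply: addr_ge0; [exact: ltW|rewrite mulr_ge0 ?sqr_ge0].
exists ((C + 2 * C ^+ 2) / (e / 2) + 1); first by lra.
move=> m x l Xx zx xl; have [z [s [cs ls zz zmin ->]]] := bzeros_below_chain zx xl.
have [x0 _] := zx; have [z0 _] := zz.
have mz := bzero_ge_nat zz; have mx := bzero_ge_nat zx.
pose g := d * m%:R + C.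
have := @chain_sum_lower _ _ m%:R g z s (@bzero_next_upper R m)
  (fun a b => @bzero_next_gap R m d a b d0) cs.
have zm := bzero_first_le d0 zmin; rewrite -/C in zm.
rewrite ls; set S := \sum_(t <- _) t; set M := m%:R in mz mx g zm *.
have M0 : 0 <= M by rewrite /M.
have dM : 0 <= d * M by rewrite mulr_ge0// ltW.
have g0 : 0 <= g by rewrite /g; lra.
have zg : (z - M) ^+ 2 <= g ^+ 2.
  by apply: lerXn2r; rewrite ?nnegrE //; rewrite /g; lra.
have g2 : g ^+ 2 <= M ^+ 2 + 2 * C ^+ 2.
  have : (d * M) ^+ 2 <= (1 / 2 * M) ^+ 2.
    by apply: lerXn2r; rewrite ?nnegrE//; [lra|rewrite ler_wpM2r].
  have : 0 <= (d * M - C) ^+ 2 by apply: sqr_ge0.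
  have : 0 <= M ^+ 2 by apply: sqr_ge0.
  by rewrite /g; lra.
have gx : g * (x - z) <= d * x ^+ 2 + C * x.
  have h1 : g * (x - z) <= g * x by rewrite ler_wpM2l//; lra.
  have h2 : d * M * x <= d * x * x by rewrite ler_wpM2r ?ler_wpM2l// ltW.
  by move: h1; rewrite /g; lra.
have big : C * x + 2 * C ^+ 2 <= e / 2 * x ^+ 2.
  have X1 : 1 <= x by lra.
  have : (C + 2 * C ^+ 2) / (e / 2) <= x by lra.
  rewrite ler_pdivrMr; last lra.
  have C2 : 0 <= C ^+ 2 by apply: sqr_ge0.
  move=> h; have h' : (C + 2 * C ^+ 2) * x <= x * (e / 2) * x by rewrite ler_wpM2r// ltW.
  by nra.
have dx : d * x ^+ 2 <= e / 2 * x ^+ 2 by rewrite ler_wpM2r ?sqr_ge0.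
by move=> H; lra.
Qed.

Lemma bzero_unbounded (R : realType) (m : nat) (B : R) :
  exists2 t, B <= t & bzero m t.
Proof.
pose A := `|B| + 2 * m%:R + 1.
have A0 : 0 < A.
  have : 0 <= 2 * m%:R :> R by rewrite mulr_ge0.
  by have := normr_ge0 B; rewrite /A; lra.
have [|t /andP[h1 h2] zt] := @bzero_after R m 1 A ltr01 A0.
  by rewrite /A; have := normr_ge0 B; lra.
exists t => //; have := ler_norm B.
have : 0 <= 2 * m%:R :> R by rewrite mulr_ge0.
by move: h1; rewrite /A; lra.
Qed.

Lemma phi_zeros_unbounded (R : realType) (m : nat) (B : R) :
  exists2 z : R, B < `|z| & phi m z = 0.
Proof.
have [t Bt [t0 zt]] := @bzero_unbounded R m (4 * (`|B| + 1)).
exists (- (t ^+ 2 / 4)) => //; rewrite normrN ger0_norm ?divr_ge0 ?sqr_ge0//.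
have := ler_norm B; have := normr_ge0 B; nra.
Qed.

Lemma bzero_first (R : realType) (m : nat) :
  exists2 x : R, bzero m x & bzeros_below m x [::].
Proof.
have [t _ zt] := @bzero_unbounded R m 0.
have [z [s [_ _ zz zmin _]]] := bzero_enum zt.
exists z => //; split=> // x; split=> // -[zx].
by rewrite ltNge zmin.
Qed.

(** The first zero satisfies [m <= x <= (1 + e / 2) m] for [m] large: one [e / 4] comes from the
    factor of [m], the other absorbs the constant [C]. *)
Lemma bzero_first_ratio (R : realType) (e X : R) : 0 < e -> exists (m : nat) (x : R),
  [/\ (0 < m)%N, X <= x, bzero m x, bzeros_below m x [::] & (2 - e) * x ^+ 2 <= 2 * m%:R * x].
Proof.
move=> e0; pose d := Num.min (e / 4) 1.
have d0 : 0 < d by rewrite lt_min; apply/andP; split; lra.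
have de : d <= e / 4 by rewrite ge_min lexx.
pose C : R := pi * ((1 + d) / d) + 1.
have C0 : 0 < C.
  have : 0 < pi * ((1 + d) / d) :> R by rewrite mulr_gt0 ?pi_gt0 ?divr_gt0//; lra.
  by rewrite /C; lra.
pose Y := `|X| + C / (e / 4) + 1.
have CY : 0 <= C / (e / 4) by rewrite divr_ge0 ?ltW//; lra.
have Y0 : 0 <= Y by rewrite /Y; have := normr_ge0 X; lra.
pose m := Num.bound Y; have Ym := archi_boundP Y0; rewrite -/m in Ym.
have [x zx lx] := bzero_first R m; exists m, x.
have mx := bzero_ge_nat zx.
have xmin t : bzero m t -> x <= t.
  move=> zt; rewrite leNgt; apply/negP => tx.
  by have [_ /(_ t)[_ /(_ (conj zt tx))]] := lx.
have xle := bzero_first_le d0 xmin; rewrite -/C in xle.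
have := ler_norm X; have nX := normr_ge0 X.
have Cm : C <= e / 4 * m%:R.
  have : C / (e / 4) <= m%:R by rewrite /Y in Ym; lra.
  by rewrite ler_pdivrMr; lra.
move=> Xn; split=> //.
- by rewrite /Y in Ym; lra.
- have x0 : 0 < x by case: zx.
  rewrite expr2 mulrA ler_wpM2r//; first exact: ltW.
  have dm : d * m%:R <= e / 4 * m%:R by rewrite ler_wpM2r.
  have em : e * m%:R <= e * x by rewrite ler_wpM2l// ltW.
  by lra.
Qed.

(** * Separation of variables in polar coordinates *)

Lemma mvt_between (R : realType) (f f' : R -> R) (x X : R) :
  (forall s, `|s - x| <= `|X - x| -> is_derive s 1 f (f' s)) ->
  exists2 xi, `|xi - x| <= `|X - x| & f X - f x = (X - x) * f' xi.
Proof.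
move=> D; case: (ltgtP x X) => [xX|Xx|->]; last first.
- by exists X; rewrite // !subrr mul0r.
- have D' t : X <= t <= x -> is_derive t 1 f (f' t).
    by move=> /andP[h1 h2]; apply: D; rewrite !ler0_norm; lra.
  have [|c cab E] := @MVT_segment _ f f' X x (ltW Xx) _ (is_derive_continuous_itv D').
    by move=> t; rewrite in_itv /= => /andP[/ltW h1 /ltW h2]; apply: D'; rewrite h1.
  move: cab; rewrite in_itv /= => /andP[h1 h2]; exists c; last by lra.
  by rewrite !ler0_norm; lra.
- have D' t : x <= t <= X -> is_derive t 1 f (f' t).
    by move=> /andP[h1 h2]; apply: D; rewrite !ger0_norm; lra.
  have [|c cab E] := @MVT_segment _ f f' x X (ltW xX) _ (is_derive_continuous_itv D').
    by move=> t; rewrite in_itv /= => /andP[/ltW h1 /ltW h2]; apply: D'; rewrite h1.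
  move: cab; rewrite in_itv /= => /andP[h1 h2]; exists c; last by lra.
  by rewrite !ger0_norm; lra.
Qed.

Lemma continuous_norm2 (R : realType) :
  continuous (fun p : R * R => p.1 ^+ 2 + p.2 ^+ 2).
Proof.
move=> p; apply: cvgD.
  by rewrite /GRing.exp /=; apply: cvgM; exact: cvg_fst.
by rewrite /GRing.exp /=; apply: cvgM; exact: cvg_snd.
Qed.

Lemma nbhs_disc (R : realType) (r : R) (p : R * R) : disc r p -> nbhs p (disc r).
Proof.
move=> rp; have cp := @continuous_norm2 R p.
exact: (cvgr_lt _ cp).
Qed.

Lemma disc_square (R : realType) (r : R) (p : R * R) : disc r p ->
  exists2 d, 0 < d & forall X Y, `|X - p.1| < d -> `|Y - p.2| < d -> disc r (X, Y).
Proof.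
move=> /nbhs_disc/nbhs_ballP[d d0 H]; exists d => // X Y Xd Yd.
by apply: H; split; rewrite /ball /= distrC.
Qed.

Lemma is_derive_fst (R : realType) (v : R * R -> R) (x y : R) :
  derivable v (x, y) (basis_vec R false) ->
  is_derive x 1 (fun s => v (s, y)) (pderiv false v (x, y)).
Proof.
move=> dv.
have E : (fun h : R => h^-1 *: (v (h *: basis_vec R false + (x, y)) - v (x, y))) =
    (fun h : R => h^-1 *: (v (h *: 1 + x, y) - v (x, y))).
  apply/funext => h; rewrite /basis_vec; congr (_ *: (v _ - _)).
  by congr pair; rewrite /= scaler0 add0r.
by apply: DeriveDef; [move: dv; rewrite /derivable E|rewrite /pderiv /derive E].
Qed.

Lemma is_derive_snd (R : realType) (v : R * R -> R) (x y : R) :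
  derivable v (x, y) (basis_vec R true) ->
  is_derive y 1 (fun s => v (x, s)) (pderiv true v (x, y)).
Proof.
move=> dv.
have E : (fun h : R => h^-1 *: (v (h *: basis_vec R true + (x, y)) - v (x, y))) =
    (fun h : R => h^-1 *: (v (x, h *: 1 + y) - v (x, y))).
  apply/funext => h; rewrite /basis_vec; congr (_ *: (v _ - _)).
  by congr pair; rewrite /= scaler0 add0r.
by apply: DeriveDef; [move: dv; rewrite /derivable E|rewrite /pderiv /derive E].
Qed.

(** The increment is split along two sides of a rectangle, with one mean value theorem for each. *)
Lemma C1_increment (R : realType) (r : R) (v : R * R -> R) (p : R * R) (e : R) :
  C1_on (disc r) v -> disc r p -> 0 < e -> exists2 d, 0 < d &
  forall X Y, `|X - p.1| < d -> `|Y - p.2| < d -> exists c1 c2,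
    [/\ `|c1 - pderiv false v p| < e, `|c2 - pderiv true v p| < e &
        v (X, Y) - v p = (X - p.1) * c1 + (Y - p.2) * c2].
Proof.
move=> C1 rp e0; have [_ dp] := C1 _ rp.
have [d0 d00 Hd0] := disc_square rp.
have near_e i : exists2 d, 0 < d & forall X Y, `|X - p.1| < d -> `|Y - p.2| < d ->
    `|pderiv i v (X, Y) - pderiv i v p| < e.
  have [_ ci] := dp i.
  have cp : pderiv i v q @[q --> p] --> pderiv i v p by exact: ci.
  have : \forall q \near p, `|pderiv i v p - pderiv i v q| < e.
    by move/cvgrPdist_lt : cp; apply.
  move=> /nbhs_ballP[d dd H]; exists d => // X Y Xd Yd.
  rewrite distrC; apply: (H (X, Y)).
  by split; rewrite /ball /= distrC.
have [d1 d10 H1] := near_e false; have [d2 d20 H2] := near_e true.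
exists (Num.min d0 (Num.min d1 d2)); first by rewrite !lt_min d00 d10.
move=> X Y; rewrite !lt_min => /andP[X0 /andP[X1 X2]] /andP[Y0 /andP[Y1 Y2]].
have pE : p = (p.1, p.2) by case: (p).
have [|xi xiX E1] := @mvt_between _ (fun s => v (s, Y)) (fun s => pderiv false v (s, Y)) p.1 X.
  move=> s sX; apply: is_derive_fst; have [|_ /(_ false)[]//] := C1 (s, Y).
  by apply: Hd0 => //; exact: le_lt_trans sX X0.
have [|eta etaY E2] := @mvt_between _ (fun s => v (p.1, s)) (fun s => pderiv true v (p.1, s)) p.2 Y.
  move=> s sY; apply: is_derive_snd; have [|_ /(_ true)[]//] := C1 (p.1, s).
  by apply: Hd0; [rewrite subrr normr0|exact: le_lt_trans sY Y0].
exists (pderiv false v (xi, Y)), (pderiv true v (p.1, eta)); split.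
- by apply: H1 => //; exact: le_lt_trans xiX X1.
- by apply: H2; [rewrite subrr normr0|exact: le_lt_trans etaY Y2].
- by rewrite -E1 -E2 -pE; ring.
Qed.

Lemma dist_lin_comb (R : realType) (a b P Q A B c1 c2 e : R) :
  `|a - A| < e -> `|b - B| < e -> `|c1 - P| < e -> `|c2 - Q| < e -> e <= 1 ->
  `|a * P + b * Q - (A * c1 + B * c2)| <= e * (`|a| + 1 + `|b| + 1 + `|P| + `|Q|).
Proof.
move=> ha hb h1 h2 e1.
have -> : a * P + b * Q - (A * c1 + B * c2) =
    ((a - A) * P + (b - B) * Q) - (A * (c1 - P) + B * (c2 - Q)) by ring.
have nA : `|A| <= `|a| + 1.
  have -> : A = a - (a - A) by ring.
  by apply: le_trans (ler_normB _ _) _; lra.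
have nB : `|B| <= `|b| + 1.
  have -> : B = b - (b - B) by ring.
  by apply: le_trans (ler_normB _ _) _; lra.
apply: le_trans (ler_normB _ _) _.
apply: le_trans (lerD (ler_normD _ _) (ler_normD _ _)) _; rewrite !normrM.
have k1 : `|a - A| * `|P| <= e * `|P| by rewrite ler_wpM2r// ltW.
have k2 : `|b - B| * `|Q| <= e * `|Q| by rewrite ler_wpM2r// ltW.
have k3 : `|A| * `|c1 - P| <= (`|a| + 1) * e by apply: ler_pM => //; exact: ltW.
have k4 : `|B| * `|c2 - Q| <= (`|b| + 1) * e by apply: ler_pM => //; exact: ltW.
by lra.
Qed.

(** [C1_on] provides derivatives along the axes; the chain rule for a curve in another direction
    rests on their continuity, through [C1_increment]. *)
Lemma is_derive_C1_comp (R : realType) (r : R) (v : R * R -> R) (x y : R -> R)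
    (t a b : R) : C1_on (disc r) v -> disc r (x t, y t) ->
  is_derive t 1 x a -> is_derive t 1 y b ->
  is_derive t 1 (fun s => v (x s, y s))
    (a * pderiv false v (x t, y t) + b * pderiv true v (x t, y t)).
Proof.
move=> C1 rp dx dy.
set p := (x t, y t); set P := pderiv false v p; set Q := pderiv true v p.
suff L : h^-1 *: (v (x (h *: 1 + t), y (h *: 1 + t)) - v p) @[h --> 0^'] --> a * P + b * Q.
  by apply: DeriveDef; [apply/cvg_ex; eexists; exact: L|exact: (cvg_lim _ L)].
have cvx : h^-1 *: (x (h *: 1 + t) - x t) @[h --> 0^'] --> a.
  by case: dx => /cvg_ex[l cl] <-; rewrite /derive (cvg_lim _ cl).
have cvy : h^-1 *: (y (h *: 1 + t) - y t) @[h --> 0^'] --> b.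
  by case: dy => /cvg_ex[l cl] <-; rewrite /derive (cvg_lim _ cl).
apply/cvgrPdist_le => /= e e0.
pose K := `|a| + 1 + `|b| + 1 + `|P| + `|Q|.
have K0 : 0 < K by rewrite /K; have := normr_ge0 a; have := normr_ge0 b;
  have := normr_ge0 P; have := normr_ge0 Q; lra.
pose e1 := Num.min 1 (e / K).
have e10 : 0 < e1 by rewrite lt_min ltr01 divr_gt0.
have e11 : e1 <= 1 by rewrite ge_min lexx.
have e1K : e1 * K <= e by rewrite -ler_pdivlMr// ge_min lexx orbT.
have [d d0 Hd] := C1_increment C1 rp e10.
have shift_cvg : (fun h : R => h *: 1 + t) @ 0^' --> t.
  apply: cvg_trans (_ : (fun h : R => h *: 1 + t) @ nbhs 0 --> t).
    by apply: cvg_app; exact: nbhs_dnbhs.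
  rewrite -[X in _ --> X]add0r; apply: cvgD; last exact: cvg_cst.
  by rewrite -[X in _ --> X](scale0r (1 : R)); apply: cvgZl; exact: cvg_id.
have cx : x (h *: 1 + t) @[h --> 0^'] --> x t.
  by apply: (cvg_comp _ _ shift_cvg); exact: der_cvg dx.
have cy : y (h *: 1 + t) @[h --> 0^'] --> y t.
  by apply: (cvg_comp _ _ shift_cvg); exact: der_cvg dy.
near=> h.
have hx : `|x (h *: 1 + t) - x t| < d.
  by rewrite distrC; near: h; move/cvgrPdist_lt : cx; apply.
have hy : `|y (h *: 1 + t) - y t| < d.
  by rewrite distrC; near: h; move/cvgrPdist_lt : cy; apply.
have ha : `|a - h^-1 *: (x (h *: 1 + t) - x t)| < e1.
  by near: h; move/cvgrPdist_lt : cvx; apply.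
have hb : `|b - h^-1 *: (y (h *: 1 + t) - y t)| < e1.
  by near: h; move/cvgrPdist_lt : cvy; apply.
have [c1 [c2 [c1P c2Q E]]] := Hd _ _ hx hy.
have -> : h^-1 *: (v (x (h *: 1 + t), y (h *: 1 + t)) - v p) =
    h^-1 *: (x (h *: 1 + t) - x t) * c1 + h^-1 *: (y (h *: 1 + t) - y t) * c2.
  by rewrite E scalerDr !scalerAl.
exact: le_trans (dist_lin_comb ha hb c1P c2Q e11) e1K.
Unshelve. all: by end_near.
Qed.

Lemma compact_closed_disc (R : realType) (r : R) : 0 <= r -> compact (@closed_disc R r).
Proof.
move=> r0; apply: (@subclosed_compact _ _ (`[- r, r] `*` `[- r, r])).
- have -> : @closed_disc R r =
      (fun p : R * R => p.1 ^+ 2 + p.2 ^+ 2) @^-1` [set x | x <= r ^+ 2] by [].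
  apply: closed_comp; last exact: closed_le.
  by move=> p _; exact: continuous_norm2.
- by apply: compact_setX; exact: segment_compact.
- move=> p /= pr; have h1 := sqr_ge0 p.1; have h2 := sqr_ge0 p.2.
  have {}pr : p.1 ^+ 2 + p.2 ^+ 2 <= r ^+ 2 := pr.
  have H (z : R) : z ^+ 2 <= r ^+ 2 -> - r <= z <= r.
    by move=> zr; rewrite -ler_norml -(ger0_norm r0) -ler_sqr ?nnegrE// !real_normK ?num_real.
  by split; rewrite /= in_itv /=; apply: H; lra.
Qed.

Lemma bounded_on_closed_disc (R : realType) (s : R) (w : R * R -> R) : 0 <= s ->
  {within closed_disc s, continuous w} ->
  exists2 M, 0 <= M & forall p, closed_disc s p -> `|w p| <= M.
Proof.
move=> s0 cw.
have ne : @closed_disc R s !=set0.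
  by exists (0, 0); rewrite /closed_disc /= expr0n /= addr0 sqr_ge0.
have [|c cs H] := compact_EVT_max (f := fun p => `|w p|) ne (compact_closed_disc s0).
  by move=> p; apply: cvg_norm; exact: cw.
by exists `|w c| => // p ps; apply: H; rewrite inE.
Qed.

(** * Integrals over the angle and polar derivatives *)

Definition cint (R : realType) (g : R -> R) : R :=
  \int[@lebesgue_measure R]_(x in `[0, 2 * pi]) g x.

Lemma twopi_gt0 (R : realType) : 0 < 2 * pi :> R.
Proof. by rewrite mulr_gt0// pi_gt0. Qed.

Lemma cint_integrable (R : realType) (g : R -> R) : continuous g ->
  (@lebesgue_measure R).-integrable `[0, 2 * pi] (EFin \o g).
Proof.
move=> cg; apply: continuous_compact_integrable; first exact: segment_compact.
exact: continuous_subspaceT.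
Qed.

Lemma eq_cint (R : realType) (f g : R -> R) : f =1 g -> cint f = cint g.
Proof. by move=> fg; apply: eq_Rintegral => x _; exact: fg. Qed.

Lemma cintD (R : realType) (f g : R -> R) : continuous f -> continuous g ->
  cint (fun x => f x + g x) = cint f + cint g.
Proof. by move=> cf cg; rewrite /cint RintegralD//; exact: cint_integrable. Qed.

Lemma cintB (R : realType) (f g : R -> R) : continuous f -> continuous g ->
  cint (fun x => f x - g x) = cint f - cint g.
Proof. by move=> cf cg; rewrite /cint RintegralB//; exact: cint_integrable. Qed.

Lemma cintZ (R : realType) (c : R) (f : R -> R) : continuous f ->
  cint (fun x => c * f x) = c * cint f.
Proof. by move=> cf; rewrite /cint RintegralZl//; exact: cint_integrable. Qed.

Lemma cint_le (R : realType) (f g : R -> R) : continuous f -> continuous g ->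
  (forall x, 0 <= x <= 2 * pi -> f x <= g x) -> cint f <= cint g.
Proof.
move=> cf cg fg; apply: le_Rintegral => //; try exact: cint_integrable.
Qed.

Lemma cint_cst (R : realType) (c : R) : cint (fun=> c) = c * (2 * pi).
Proof.
rewrite /cint Rintegral_cst//= lebesgue_measure_itv /= lte_fin twopi_gt0.
by rewrite -EFinB subr0.
Qed.

Lemma cint_norm_le (R : realType) (g : R -> R) (M : R) : continuous g ->
  (forall x, 0 <= x <= 2 * pi -> `|g x| <= M) -> `|cint g| <= M * (2 * pi).
Proof.
move=> cg gM; rewrite ler_norml -!cint_cst -mulN1r -cintZ; last exact: cst_continuous.
apply/andP; split; apply: cint_le => //; try (by move=> x; exact: cvg_cst).
- by move=> x /gM; rewrite ler_norml mulN1r => /andP[].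
- by move=> x /gM; rewrite ler_norml => /andP[].
Qed.

Lemma cint_FTC (R : realType) (G g : R -> R) : continuous g ->
  (forall x : R, is_derive x 1 G (g x)) -> cint g = G (2 * pi) - G 0.
Proof.
move=> cg DG; rewrite /cint /Rintegral (@continuous_FTC2 _ _ G) ?twopi_gt0//.
- exact: continuous_subspaceT.
- have cG x : G y @[y --> x] --> G x by exact: der_cvg (DG x).
  split.
  + by move=> x _; case: (DG x).
  + exact: cvg_at_right_filter.
  + exact: cvg_at_left_filter.
- by move=> x _; rewrite derive1E; case: (DG x).
Qed.

Lemma is_derive_cint (R : realType) (f f1 : R -> R -> R) (s a M : R) : `|a| < s ->
  (forall x, `|x| < s -> continuous (f x)) ->
  (forall x y : R, `|x| < s -> is_derive x 1 (f ^~ y) (f1 x y)) ->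
  (forall x y, `|x| < s -> `|f1 x y| <= M) ->
  is_derive a 1 (fun x => cint (f x)) (cint (f1 a)).
Proof.
move=> as_ cf df fM.
have M0 : 0 <= M by apply: le_trans (fM 0 0 _) => //; rewrite normr0 (le_lt_trans _ as_).
have I x : `]- s, s[%classic x -> `|x| < s by rewrite /= in_itv /= ltr_norml.
have Ia : `]- s, s[%classic a by rewrite /= in_itv /= -ltr_norml.
have d1 x y : `|x| < s -> partial1of2 f x y = f1 x y.
  by move=> xs; rewrite partial1of2E; case: (df x y xs).
have h1 x : `]- s, s[%classic x ->
    (@lebesgue_measure R).-integrable `[0, 2 * pi] (EFin \o f x).
  by move=> /I xs; apply: cint_integrable; exact: cf.
have h2 x y : `]- s, s[%classic x -> `[0, 2 * pi]%classic y -> derivable (f ^~ y) x 1.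
  by move=> /I xs _; case: (df x y xs).
have h3 : (@lebesgue_measure R).-integrable `[0, 2 * pi] (EFin \o (fun=> M)).
  by apply: cint_integrable => x; exact: cvg_cst.
have h4 x y : `]- s, s[%classic x -> `[0, 2 * pi]%classic y -> `|partial1of2 f x y| <= M.
  by move=> /I xs _; rewrite d1// fM.
have D1 : derivable (fun x => cint (f x)) a 1.
  by apply: (derivable_under_integral _ Ia h1 h2 (fun=> M0) h3 h4).
have D2 : derive1 (fun x => cint (f x)) a = cint (partial1of2 f a).
  by apply: (differentiation_under_integral _ Ia h1 h2 (fun=> M0) h3 h4).
apply: DeriveDef; first exact: D1.
rewrite -derive1E D2; apply: eq_Rintegral => y _; exact: d1.
Qed.

(** Negative [rho] is allowed. Fourier coefficients are then differentiable on a neighbourhood of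
    [rho = 0], which is how their regularity at the origin is obtained. *)
Definition pol (R : realType) (rho th : R) : R * R := (rho * cos th, rho * sin th).

Lemma pol_norm2 (R : realType) (rho th : R) :
  (pol rho th).1 ^+ 2 + (pol rho th).2 ^+ 2 = rho ^+ 2.
Proof. by rewrite /= !exprMn -mulrDr cos2Dsin2 mulr1. Qed.

Lemma disc_pol (R : realType) (r rho th : R) : `|rho| < r -> disc r (pol rho th).
Proof.
move=> h; rewrite /disc /= -/(pol rho th).1 -/(pol rho th).2.
have := pol_norm2 rho th; rewrite /= => ->.
by rewrite -[rho ^+ 2]real_normK ?num_real// ltr_sqr ?nnegrE// (le_trans _ (ltW h)).
Qed.

Lemma continuous_pol_r (R : realType) (th : R) : continuous (fun rho => pol rho th).
Proof.
move=> x.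
apply: (@cvg_pair _ _ _ _ (nbhs (x * cos th)) (nbhs (x * sin th))).
  by apply: cvgM; [exact: cvg_id|exact: cvg_cst].
by apply: cvgM; [exact: cvg_id|exact: cvg_cst].
Qed.

Lemma continuous_pol_th (R : realType) (rho : R) : continuous (pol rho).
Proof.
move=> x.
apply: (@cvg_pair _ _ _ _ (nbhs (rho * cos x)) (nbhs (rho * sin x))).
  by apply: cvgM; [exact: cvg_cst|exact: continuous_cos].
by apply: cvgM; [exact: cvg_cst|exact: continuous_sin].
Qed.

Lemma continuous_disc_pol (R : realType) (r rho : R) (w : R * R -> R) :
  (forall p, disc r p -> {for p, continuous w}) -> `|rho| < r ->
  continuous (fun th => w (pol rho th)).
Proof.
move=> cw h th; apply: (cvg_comp _ _ (@continuous_pol_th R rho th)).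
by apply: cw; exact: disc_pol.
Qed.

Lemma cos_periodic_nat (R : realType) (m : nat) (x : R) :
  cos (m%:R * (2 * pi) + x) = cos x.
Proof.
have -> : m%:R * (2 * pi) = (pi *+ 2) *+ m :> R by rewrite !mulr_natl.
by rewrite addrC (periodicn (@cosD2pi R)).
Qed.

Lemma sin_periodic_nat (R : realType) (m : nat) (x : R) :
  sin (m%:R * (2 * pi) + x) = sin x.
Proof.
have -> : m%:R * (2 * pi) = (pi *+ 2) *+ m :> R by rewrite !mulr_natl.
by rewrite addrC (periodicn (@sinD2pi R)).
Qed.

Definition pol_r (R : realType) (u : R * R -> R) (rho th : R) : R :=
  cos th * pderiv false u (pol rho th) + sin th * pderiv true u (pol rho th).

Definition pol_rr (R : realType) (u : R * R -> R) (rho th : R) : R :=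
  cos th * pol_r (pderiv false u) rho th + sin th * pol_r (pderiv true u) rho th.

Definition pol_t (R : realType) (u : R * R -> R) (rho th : R) : R :=
  - rho * sin th * pderiv false u (pol rho th) + rho * cos th * pderiv true u (pol rho th).

Definition pol_tt (R : realType) (u : R * R -> R) (rho th : R) : R :=
  - rho * cos th * pderiv false u (pol rho th)
  - rho * sin th * pol_t (pderiv false u) rho th
  - rho * sin th * pderiv true u (pol rho th)
  + rho * cos th * pol_t (pderiv true u) rho th.

(** The polar expression of the Laplacian, multiplied by [rho ^ 2] so as to hold at the origin as
    well. Each of the two mixed derivatives cancels by itself. *)
Lemma pol_laplacian (R : realType) (u : R * R -> R) (rho th : R) :
  rho ^+ 2 * pol_rr u rho th + pol_tt u rho th + rho * pol_r u rho th =
  rho ^+ 2 * laplacian u (pol rho th).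
Proof.
rewrite /pol_rr /pol_tt /pol_r /pol_t /laplacian.
move: (pderiv false (pderiv false u) _) (pderiv true (pderiv false u) _) => a b.
move: (pderiv false (pderiv true u) _) (pderiv true (pderiv true u) _) => c d.
have E := cos2Dsin2 th.
transitivity (rho ^+ 2 * ((cos th ^+ 2 + sin th ^+ 2) * (a + d))); last by rewrite E mul1r.
by ring.
Qed.

Lemma continuous_C1 (R : realType) (D : set (R * R)) (v : R * R -> R) :
  C1_on D v -> forall p, D p -> {for p, continuous v}.
Proof. by move=> C1 p /C1[]. Qed.

Lemma continuous_pderiv (R : realType) (D : set (R * R)) (v : R * R -> R) (i : bool) :
  C1_on D v -> forall p, D p -> {for p, continuous (pderiv i v)}.
Proof. by move=> C1 p /C1[_ /(_ i)[]]. Qed.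

Lemma is_derive_pol_r (R : realType) (r : R) (v : R * R -> R) (rho th : R) :
  C1_on (disc r) v -> `|rho| < r ->
  is_derive rho 1 (fun x => v (pol x th)) (pol_r v rho th).
Proof.
move=> C1 h.
have d1 (c : R) : is_derive rho 1 (fun x => x * c) c.
  by apply: is_derive_eq (derM (derI rho) (derC rho 1 c)) _; rewrite mul1r mulr0 addr0.
exact: (@is_derive_C1_comp _ r v (fun x => x * cos th) (fun x => x * sin th) rho
  _ _ C1 (disc_pol th h) (d1 _) (d1 _)).
Qed.

Lemma is_derive_pol_t (R : realType) (r : R) (v : R * R -> R) (rho th : R) :
  C1_on (disc r) v -> `|rho| < r ->
  is_derive th 1 (fun x => v (pol rho x)) (pol_t v rho th).
Proof.
move=> C1 h.
have d1 : is_derive th 1 (fun x => rho * cos x) (- rho * sin th).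
  by apply: is_derive_eq (derZ rho (is_derive_cos th)) _; rewrite mulrN mulNr.
have d2 : is_derive th 1 (fun x => rho * sin x) (rho * cos th).
  exact: derZ rho (is_derive_sin th).
exact: (@is_derive_C1_comp _ r v (fun x => rho * cos x) (fun x => rho * sin x) th
  _ _ C1 (disc_pol th h) d1 d2).
Qed.

Lemma is_derive_pol_rr (R : realType) (r : R) (u : R * R -> R) (rho th : R) :
  C2_on (disc r) u -> `|rho| < r ->
  is_derive rho 1 (fun x => pol_r u x th) (pol_rr u rho th).
Proof.
move=> [_ C2] h; apply: derD; apply: derZ.
  exact: is_derive_pol_r (C2 false) h.
exact: is_derive_pol_r (C2 true) h.
Qed.

Lemma is_derive_pol_tt (R : realType) (r : R) (u : R * R -> R) (rho th : R) :
  C2_on (disc r) u -> `|rho| < r ->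
  is_derive th 1 (pol_t u rho) (pol_tt u rho th).
Proof.
move=> [_ C2] h.
have D1 := derM (derZ (- rho) (is_derive_sin th)) (is_derive_pol_t th (C2 false) h).
have D2 := derM (derZ rho (is_derive_cos th)) (is_derive_pol_t th (C2 true) h).
apply: is_derive_eq (derD D1 D2) _.
rewrite /pol_tt; move: (pol_t (pderiv false u) rho th) (pol_t (pderiv true u) rho th).
move: (pderiv false u (pol rho th)) (pderiv true u (pol rho th)) => a b c d.
by ring.
Qed.

Lemma continuous_th_pol_r (R : realType) (r rho : R) (v : R * R -> R) :
  C1_on (disc r) v -> `|rho| < r -> continuous (pol_r v rho).
Proof.
move=> C1 h x.
have cd i : pderiv i v (pol rho y) @[y --> x] --> pderiv i v (pol rho x).
  exact: (@continuous_disc_pol _ r rho (pderiv i v) (continuous_pderiv C1) h x).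
by apply: cvgD; apply: cvgM => //; (exact: continuous_cos || exact: continuous_sin).
Qed.

Lemma continuous_th_pol_rr (R : realType) (r rho : R) (u : R * R -> R) :
  C2_on (disc r) u -> `|rho| < r -> continuous (pol_rr u rho).
Proof.
move=> [_ C2] h x.
have cd i : pol_r (pderiv i u) rho y @[y --> x] --> pol_r (pderiv i u) rho x.
  exact: (continuous_th_pol_r (C2 i) h).
by apply: cvgD; apply: cvgM => //; (exact: continuous_cos || exact: continuous_sin).
Qed.

Lemma continuous_th_pol_t (R : realType) (r rho : R) (v : R * R -> R) :
  C1_on (disc r) v -> `|rho| < r -> continuous (pol_t v rho).
Proof.
move=> C1 h x.
have cd i : pderiv i v (pol rho y) @[y --> x] --> pderiv i v (pol rho x).
  exact: (@continuous_disc_pol _ r rho (pderiv i v) (continuous_pderiv C1) h x).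
by apply: cvgD; apply: cvgM => //; apply: cvgM;
  (exact: cvg_cst || exact: continuous_cos || exact: continuous_sin).
Qed.

Lemma continuous_th_pol_tt (R : realType) (r rho : R) (u : R * R -> R) :
  C2_on (disc r) u -> `|rho| < r -> continuous (pol_tt u rho).
Proof.
move=> [C1 C2] h x.
have cs : rho * sin y @[y --> x] --> rho * sin x.
  by apply: cvgM; [exact: cvg_cst|exact: continuous_sin].
have cc : rho * cos y @[y --> x] --> rho * cos x.
  by apply: cvgM; [exact: cvg_cst|exact: continuous_cos].
have cNc : - rho * cos y @[y --> x] --> - rho * cos x.
  by apply: cvgM; [exact: cvg_cst|exact: continuous_cos].
have cd i : pderiv i u (pol rho y) @[y --> x] --> pderiv i u (pol rho x).
  exact: (@continuous_disc_pol _ r rho (pderiv i u) (continuous_pderiv C1) h x).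
have ct i : pol_t (pderiv i u) rho y @[y --> x] --> pol_t (pderiv i u) rho x.
  exact: (continuous_th_pol_t (C2 i) h).
by apply: cvgD; [apply: cvgB; [apply: cvgB; apply: cvgM|apply: cvgM]|apply: cvgM].
Qed.

Lemma norm_cos_sin_le (R : realType) (a b M1 M2 th : R) :
  `|a| <= M1 -> `|b| <= M2 -> `|cos th * a + sin th * b| <= M1 + M2.
Proof.
move=> k1 k2; apply: le_trans (ler_normD _ _) _; rewrite !normrM.
have c1 : `|cos th| <= 1 by rewrite ler_norml cos_geN1 cos_le1.
have s1 : `|sin th| <= 1 by rewrite ler_norml sin_geN1 sin_le1.
by apply: lerD; rewrite -[leRHS]mul1r; apply: ler_pM.
Qed.

Lemma pol_r_bounded (R : realType) (r s : R) (v : R * R -> R) : 0 <= s -> s < r ->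
  C1_on (disc r) v ->
  exists2 M, 0 <= M & forall rho th, `|rho| <= s -> `|pol_r v rho th| <= M.
Proof.
move=> s0 sr C1.
have sub : @closed_disc R s `<=` disc r.
  move=> p; rewrite /closed_disc /disc /= => ps; apply: le_lt_trans ps _.
  by rewrite ltr_sqr ?nnegrE//; lra.
have cpt i : exists2 M, 0 <= M & forall p, closed_disc s p -> `|pderiv i v p| <= M.
  apply: bounded_on_closed_disc => //.
  apply: (@continuous_in_subspaceT _ _ (@closed_disc R s)) => p; rewrite inE => ps.
  exact: (continuous_pderiv C1 (sub _ ps)).
have [M1 M10 H1] := cpt false; have [M2 M20 H2] := cpt true.
exists (M1 + M2); first exact: addr_ge0.
move=> rho th h.
have ps : closed_disc s (pol rho th).
  rewrite /closed_disc /=; have := pol_norm2 rho th; rewrite /= => ->.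
  by rewrite -[rho ^+ 2]real_normK ?num_real// ler_sqr ?nnegrE.
exact: norm_cos_sin_le (H1 _ ps) (H2 _ ps).
Qed.

(** The phase unites the cosines, [ph = 0], and the sines, [ph = - (pi / 2)], in one family closed
    under translation. *)
Definition harm (R : realType) (m : nat) (ph th : R) : R := cos (m%:R * th + ph).

Definition fcoef (R : realType) (u : R * R -> R) (m : nat) (ph rho : R) : R :=
  cint (fun th => u (pol rho th) * harm m ph th).

Definition fcoef1 (R : realType) (u : R * R -> R) (m : nat) (ph rho : R) : R :=
  cint (fun th => pol_r u rho th * harm m ph th).

Lemma is_derive_affine (R : realType) (m : nat) (ph th : R) :
  is_derive th 1 (fun x : R => m%:R * x + ph) m%:R.
Proof.
apply: is_derive_eq (derD (derZ m%:R (derI th)) (derC th 1 ph)) _.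
by rewrite mulr1 addr0.
Qed.

Lemma is_derive_harm (R : realType) (m : nat) (ph th : R) :
  is_derive th 1 (@harm R m ph) (- (m%:R * sin (m%:R * th + ph))).
Proof.
apply: is_derive_eq (der_comp (is_derive_cos _) (is_derive_affine m ph th)) _.
by rewrite mulNr mulrC.
Qed.

Lemma is_derive_harm1 (R : realType) (m : nat) (ph th : R) :
  is_derive th 1 (fun x => - (m%:R * sin (m%:R * x + ph))) (- (m%:R ^+ 2 * harm m ph th)).
Proof.
apply: is_derive_eq (derN (derZ m%:R (der_comp (is_derive_sin _) (is_derive_affine m ph th)))) _.
by rewrite /harm; ring.
Qed.

Lemma continuous_harm (R : realType) (m : nat) (ph : R) : continuous (@harm R m ph).
Proof. by move=> x; exact: der_cvg (is_derive_harm m ph x). Qed.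

Lemma harm_le1 (R : realType) (m : nat) (ph th : R) : `|harm m ph th| <= 1.
Proof. by rewrite ler_norml cos_geN1 cos_le1. Qed.

Lemma is_derive_fcoef (R : realType) (r : R) (u : R * R -> R) (m : nat) (ph rho : R) :
  C2_on (disc r) u -> `|rho| < r ->
  is_derive rho 1 (fcoef u m ph) (fcoef1 u m ph rho).
Proof.
move=> C2 h; have [C1 _] := C2.
pose s := (`|rho| + r) / 2; have s0 : 0 <= s by rewrite /s; have := normr_ge0 rho; lra.
have sr : s < r by rewrite /s; lra.
have rs : `|rho| < s by rewrite /s; lra.
have [M M0 HM] := pol_r_bounded s0 sr C1.
apply: (@is_derive_cint _ (fun x th => u (pol x th) * harm m ph th)
  (fun x th => pol_r u x th * harm m ph th) s rho M rs).
- move=> x xs y; apply: cvgM; last exact: continuous_harm.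
  exact: (@continuous_disc_pol _ r x u (continuous_C1 C1) (lt_trans xs sr) y).
- move=> x y xs; have D := derM (is_derive_pol_r y C1 (lt_trans xs sr)) (derC x 1 (harm m ph y)).
  by apply: is_derive_eq D _; rewrite mulr0 addr0.
- move=> x y xs; rewrite normrM -[leRHS]mulr1; apply: ler_pM => //; last exact: harm_le1.
  exact: HM (ltW xs).
Qed.

Definition fcoef2 (R : realType) (u : R * R -> R) (m : nat) (ph rho : R) : R :=
  cint (fun th => pol_rr u rho th * harm m ph th).

Lemma is_derive_fcoef1 (R : realType) (r : R) (u : R * R -> R) (m : nat) (ph rho : R) :
  C2_on (disc r) u -> `|rho| < r ->
  is_derive rho 1 (fcoef1 u m ph) (fcoef2 u m ph rho).
Proof.
move=> C2 h; have [C1 C2'] := C2.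
pose s := (`|rho| + r) / 2; have s0 : 0 <= s by rewrite /s; have := normr_ge0 rho; lra.
have sr : s < r by rewrite /s; lra.
have rs : `|rho| < s by rewrite /s; lra.
have [M1 M10 H1] := pol_r_bounded s0 sr (C2' false).
have [M2 M20 H2] := pol_r_bounded s0 sr (C2' true).
apply: (@is_derive_cint _ (fun x th => pol_r u x th * harm m ph th)
  (fun x th => pol_rr u x th * harm m ph th) s rho (M1 + M2) rs).
- move=> x xs y; apply: cvgM; last exact: continuous_harm.
  by apply: (continuous_th_pol_r C1 (lt_trans xs sr)).
- move=> x y xs; have D := derM (is_derive_pol_rr y C2 (lt_trans xs sr)) (derC x 1 (harm m ph y)).
  by apply: is_derive_eq D _; rewrite mulr0 addr0.
- move=> x y xs; rewrite normrM -[leRHS]mulr1; apply: ler_pM => //; last exact: harm_le1.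
  exact: norm_cos_sin_le (H1 _ y (ltW xs)) (H2 _ y (ltW xs)).
Qed.

Lemma fcoef_ode (R : realType) (r lam : R) (u : R * R -> R) (m : nat) (ph rho : R) :
  C2_on (disc r) u -> (forall p, disc r p -> - laplacian u p = lam * u p) ->
  `|rho| < r -> rho != 0 ->
  is_derive rho 1 (fcoef1 u m ph)
    (- (fcoef1 u m ph rho / rho) - (lam - m%:R ^+ 2 / rho ^+ 2) * fcoef u m ph rho).
Proof.
move=> C2 pde h rho0; have [C1 C2'] := C2.
apply: is_derive_eq (is_derive_fcoef1 m ph C2 h) _; set A2 := fcoef2 _ _ _ _.
pose g := harm m ph; pose g1 x := - (m%:R * sin (m%:R * x + ph)).
have cg : continuous g by exact: continuous_harm.
have cU : continuous (fun th => u (pol rho th)).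
  exact: (@continuous_disc_pol _ r rho u (continuous_C1 C1) h).
have cUr : continuous (pol_r u rho) by exact: continuous_th_pol_r C1 h.
have cUrr : continuous (pol_rr u rho) by exact: continuous_th_pol_rr C2 h.
have cUtt : continuous (pol_tt u rho) by exact: continuous_th_pol_tt C2 h.
have cM (f1 f2 : R -> R) : continuous f1 -> continuous f2 -> continuous (fun x => f1 x * f2 x).
  by move=> c1 c2 x; apply: cvgM; [exact: c1|exact: c2].
have cZ (c : R) (f1 : R -> R) : continuous f1 -> continuous (fun x => c * f1 x).
  by move=> c1 x; apply: cvgM; [exact: cvg_cst|exact: c1].
have cD (f1 f2 : R -> R) : continuous f1 -> continuous f2 -> continuous (fun x => f1 x + f2 x).
  by move=> c1 c2 x; apply: cvgD; [exact: c1|exact: c2].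
(* integration by parts twice, in the angular variable *)
have parts : cint (fun th => pol_tt u rho th * g th + m%:R ^+ 2 * (u (pol rho th) * g th)) = 0.
  pose G th := pol_t u rho th * g th - u (pol rho th) * g1 th.
  have DG (x : R) : is_derive x 1 G (pol_tt u rho x * g x + m%:R ^+ 2 * (u (pol rho x) * g x)).
    have D1 := derM (is_derive_pol_tt x C2 h) (is_derive_harm m ph x).
    have D2 := derM (is_derive_pol_t x C1 h) (is_derive_harm1 m ph x).
    apply: is_derive_eq (derB D1 D2) _; rewrite -/g /=.
    move: (pol_tt u rho x) (pol_t u rho x) (u (pol rho x)) (g x) => a b c d.
    by ring.
  have cG : continuous (fun th => pol_tt u rho th * g th + m%:R ^+ 2 * (u (pol rho th) * g th)).
    by apply: (cD) => //; [exact: cM|apply: (cZ); exact: cM].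
  rewrite (cint_FTC cG DG).
  have c2 : cos (2 * pi) = 1 :> R by rewrite mulr_natl cos2pi.
  have s2 : sin (2 * pi) = 0 :> R by rewrite mulr_natl sin2pi.
  have pE : pol rho (2 * pi) = pol rho 0 by rewrite /pol c2 s2 cos0 sin0.
  rewrite /G /pol_t /g /g1 /harm pE c2 s2 cos0 sin0 cos_periodic_nat sin_periodic_nat.
  by rewrite !mulr0 !add0r subrr.
have E : rho ^+ 2 * A2 + rho * fcoef1 u m ph rho + (lam * rho ^+ 2 - m%:R ^+ 2) * fcoef u m ph rho
   = - cint (fun th => pol_tt u rho th * g th + m%:R ^+ 2 * (u (pol rho th) * g th)).
  rewrite /A2 /fcoef2 /fcoef1 /fcoef -!cintZ; try exact: cM.
  rewrite -[RHS]mulN1r -[RHS]cintZ; last by apply: (cD); [exact: cM|apply: (cZ); exact: cM].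
  rewrite -!cintD; try (by apply: (cZ); exact: cM); last first.
    by apply: (cD); apply: (cZ); exact: cM.
  apply: eq_cint => th.
  have P := pol_laplacian u rho th; have L := pde _ (disc_pol th h).
  have {L} L : laplacian u (pol rho th) = - (lam * u (pol rho th)) by rewrite -L opprK.
  rewrite L in P.
  move: (pol_tt u rho th) (pol_rr u rho th) (pol_r u rho th) (u (pol rho th)) P.
  rewrite -/(g th); move: (g th) => y a b c d P.
  have -> : a = - (rho ^+ 2 * (lam * d)) - rho ^+ 2 * b - rho * c by move: P; lra.
  by ring.
rewrite parts oppr0 in E.
have -> : A2 = (rho ^+ 2 * A2) / rho ^+ 2 by field.
have -> : rho ^+ 2 * A2 = - (rho * fcoef1 u m ph rho) -
   (lam * rho ^+ 2 - m%:R ^+ 2) * fcoef u m ph rho by move: E; lra.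
by field.
Qed.

Lemma der0_constant (R : realType) (f : R -> R) (a b x y : R) :
  (forall t : R, a < t < b -> is_derive t 1 f 0) -> a < x < b -> a < y < b -> f x = f y.
Proof.
move=> D; wlog xy : x y / x < y => [W hx hy|].
  have [xy|yx|-> //] := ltgtP x y; first exact: W.
  by apply/esym; exact: W.
move=> /andP[ax xb] /andP[ay yb].
have D' t : x <= t <= y -> is_derive t 1 f 0 by move=> /andP[h1 h2]; apply: D; lra.
have [|c _ E] := @MVT _ f (fun=> 0) x y xy _ (is_derive_continuous_itv D').
  by move=> t; rewrite in_itv /= => /andP[h1 h2]; apply: D'; lra.
by apply/esym/eqP; rewrite -subr_eq0 E mul0r.
Qed.

(* Two solutions of [y'' = - y' / t - q y] that are regular at the origin have
   vanishing Wronskian [t (A B' - A' B)], hence are proportional; the factor is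
   [(A B + A' B') / (B ^+ 2 + B' ^+ 2)]. *)
Lemma regular_solutions_proportional (R : realType) (A A1 B B1 q : R -> R) (r : R) :
  0 < r ->
  (forall t : R, `|t| < r -> is_derive t 1 A (A1 t)) ->
  (forall t : R, `|t| < r -> is_derive t 1 B (B1 t)) ->
  {for 0, continuous A1} -> {for 0, continuous B1} ->
  (forall t : R, 0 < t < r -> is_derive t 1 A1 (- (A1 t / t) - q t * A t)) ->
  (forall t : R, 0 < t < r -> is_derive t 1 B1 (- (B1 t / t) - q t * B t)) ->
  (forall t : R, 0 < t < r -> B t ^+ 2 + B1 t ^+ 2 != 0) ->
  exists c, forall t, 0 < t < r -> A t = c * B t.
Proof.
move=> r0 dA dB cA1 cB1 dA1 dB1 nz.
pose W t := t * (A t * B1 t - A1 t * B t).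
have itv t : 0 < t < r -> `|t| < r by move=> /andP[h1 h2]; rewrite gtr0_norm.
have dW (t : R) : 0 < t < r -> is_derive t 1 W 0.
  move=> tr; have tn0 : t != 0 by case/andP: tr => *; rewrite gt_eqF.
  have := derM (derI t) (derB (derM (dA t (itv _ tr)) (dB1 t tr))
    (derM (dA1 t tr) (dB t (itv _ tr)))).
  by move=> D; apply: is_derive_eq D _; field.
have cW0 : {for 0, continuous W}.
  have r0' : `|0 : R| < r by rewrite normr0.
  have c1 : A t @[t --> 0] --> A 0 by exact: der_cvg (dA 0 r0').
  have c2 : B t @[t --> 0] --> B 0 by exact: der_cvg (dB 0 r0').
  by apply: cvgM; [exact: cvg_id|apply: cvgB; apply: cvgM].
have W0 t : 0 < t < r -> W t = 0.
  move=> /andP[t0 tr].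
  have cW : {within `[0, t], continuous W}.
    apply: (@continuous_in_subspaceT _ _ `[0, t]%classic) => x; rewrite inE /= in_itv /=.
    move=> /andP[]; rewrite le_eqVlt => /orP[/eqP <- _|x0 xt]; first exact: cW0.
    by apply: der_cvg (dW x _); lra.
  have [|c _ E] := @MVT _ W (fun=> 0) 0 t t0 _ cW.
    by move=> x; rewrite in_itv /= => /andP[x0 xt]; apply: dW; lra.
  by move: E; rewrite mul0r {2}/W mul0r subr0.
have AB t : 0 < t < r -> A t * B1 t = A1 t * B t.
  move=> tr; have tn0 : t != 0 by case/andP: tr => *; rewrite gt_eqF.
  by have /eqP := W0 t tr; rewrite mulf_eq0 (negbTE tn0) subr_eq0 => /eqP.
pose E t := B t ^+ 2 + B1 t ^+ 2.
pose N t := A t * B t + A1 t * B1 t.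
pose c t := N t * (E t)^-1.
have cE t : 0 < t < r -> A t = c t * B t.
  move=> tr; have := nz _ tr; have := AB _ tr; rewrite /c /N /E => ab e0.
  apply: (mulIf e0).
  transitivity ((A t * B t) * B t + (A t * B1 t) * B1 t); first by ring.
  rewrite ab; transitivity ((A t * B t + A1 t * B1 t) * B t); first by ring.
  by field.
have cE1 t : 0 < t < r -> A1 t = c t * B1 t.
  move=> tr; have := nz _ tr; have := AB _ tr; rewrite /c /N /E => ab e0.
  apply: (mulIf e0).
  transitivity ((A1 t * B t) * B t + (A1 t * B1 t) * B1 t); first by ring.
  rewrite -ab; transitivity ((A t * B t + A1 t * B1 t) * B1 t); first by ring.
  by field.
have dc (t : R) : 0 < t < r -> is_derive t 1 c 0.
  move=> tr; have tn0 : t != 0 by case/andP: tr => *; rewrite gt_eqF.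
  have e0 : E t != 0 by exact: nz.
  have d1 := dA t (itv _ tr); have d2 := dB t (itv _ tr).
  have DE := derD (derX 2 d2) (derX 2 (dB1 t tr)).
  have DN := derD (derM d1 d2) (derM (dA1 t tr) (dB1 t tr)).
  apply: is_derive_eq (derM DN (@derV _ E t _ e0 DE)) _.
  rewrite -/(N t) /= !expr1.
  have -> : N t = c t * E t by rewrite /c mulfVK.
  rewrite (cE t tr) (cE1 t tr); rewrite /E in e0 *.
  move: (c t) (B t) (B1 t) (q t) e0 => k b b1 s e0.
  by field; rewrite e0.
exists (c (r / 2)) => t tr; rewrite (cE t tr); congr (_ * _).
by apply: (der0_constant dc tr); lra.
Qed.

Lemma fcoef_bess (R : realType) (r lam : R) (u : R * R -> R) (m : nat) (ph : R) :
  0 < r -> 0 < lam -> C2_on (disc r) u ->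
  (forall p, disc r p -> - laplacian u p = lam * u p) ->
  exists c, forall rho, 0 < rho < r ->
    fcoef u m ph rho = c * bess m (Num.sqrt lam * rho).
Proof.
move=> r0 lam0 C2 pde; set k := Num.sqrt lam.
have k0 : 0 < k by rewrite sqrtr_gt0.
have kk : lam = k ^+ 2 by rewrite sqr_sqrtr// ltW.
have dk (t : R) : is_derive t 1 (fun s => k * s) k.
  by apply: is_derive_eq (derZ k (derI t)) _; rewrite mulr1.
apply: (@regular_solutions_proportional _ (fcoef u m ph) (fcoef1 u m ph)
  (fun t => bess m (k * t)) (fun t => k * bess1 m (k * t))
  (fun t => lam - m%:R ^+ 2 / t ^+ 2) r r0).
- by move=> t tr; exact: is_derive_fcoef C2 tr.
- move=> t _; apply: is_derive_eq (der_comp (is_derive_bess m _) (dk t)) _.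
  by rewrite mulrC.
- by apply: der_cvg (is_derive_fcoef1 m ph C2 _); rewrite normr0.
- have D1 (t : R) := derM (derM (derC t 1 m%:R) (derX m.-1 (derI t))) (is_derive_phi_sq m t).
  have D2 (t : R) := derM (derM (derX m.+1 (derI t)) (derC t 1 2^-1)) (is_derive_phi_sq m.+1 t).
  exact: der_cvg (derZ k (der_comp (derB (D1 _) (D2 _)) (dk 0))).
- by move=> t /andP[t0 tr]; apply: fcoef_ode C2 pde _ _; rewrite ?gt_eqF// gtr0_norm.
- move=> t /andP[t0 tr]; have kt0 : k * t != 0 by rewrite mulf_neq0 ?gt_eqF.
  apply: is_derive_eq (derZ k (der_comp (is_derive_bess1 m kt0) (dk t))) _.
  rewrite kk; move: (bess m _) (bess1 m _) => b b1.
  by field; rewrite !gt_eqF.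
(* A common zero of the Bessel function and its derivative would contradict the simplicity of the
   zeros of [phi m]. *)
- move=> t /andP[t0 tr]; apply/negP.
  rewrite paddr_eq0 ?sqr_ge0// !expf_eq0 /= !mulf_eq0 (gt_eqF k0) /=.
  move=> /andP[]; rewrite expf_eq0 (gt_eqF (mulr_gt0 k0 t0)) andbF /= /bess1.
  move=> /eqP z; rewrite z mulr0 sub0r oppr_eq0 !mulf_eq0 (negbTE (phi_simple_zero z)) orbF.
  by rewrite expf_eq0 (gt_eqF (mulr_gt0 k0 t0)) /= invr_eq0 pnatr_eq0.
Qed.

(** Compactness of the interval of angles makes the approach to the boundary values uniform, so that
    the limit passes under the integral. *)
Lemma circle_limit (R : realType) (r e : R) (u : R * R -> R) : 0 < r -> 0 < e ->
  {within closed_disc r, continuous u} -> (forall p, circle r p -> u p = 0) ->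
  \forall rho \near r^'-, forall th, 0 <= th <= 2 * pi -> `|u (pol rho th)| < e.
Proof.
move=> r0 e0 cu bu.
have K : compact (`[0, 2 * pi]%classic : set R) by exact: segment_compact.
move/compact_near_coveringP : K => K.
suff H : forall th, `[0, 2 * pi]%classic th ->
    \forall th' \near th & rho \near r^'-, `|u (pol rho th')| < e.
  have FF : Filter r^'- by exact: _.
  have := K R (r^'-) (fun rho th => `|u (pol rho th)| < e) FF H.
  by apply: filterS => rho H' th thI; apply: H'; rewrite /= in_itv.
move=> th _ /=.
have cp : circle r (pol r th) by rewrite /circle /=; exact: pol_norm2.
have cd : closed_disc r (pol r th) by rewrite /closed_disc /=; have := pol_norm2 r th; rewrite /= => ->.
have /subspace_continuousP/(_ _ cd) /cvgrPdist_lt/(_ _ e0) := cu.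
rewrite /from_subspace (bu _ cp) => near0.
have cpol : pol z.2 z.1 @[z --> (th, r)] --> pol r th.
  apply: (@cvg_pair _ _ _ _ (nbhs (r * cos th)) (nbhs (r * sin th))).
    apply: cvgM; first exact: cvg_snd.
    by apply: (cvg_comp _ _ (@cvg_fst _ _ (nbhs th) (nbhs r) _)); exact: continuous_cos.
  apply: cvgM; first exact: cvg_snd.
  by apply: (cvg_comp _ _ (@cvg_fst _ _ (nbhs th) (nbhs r) _)); exact: continuous_sin.
have /cpol [[U V] [/= Uth Vr] UV] : nbhs (pol r th) [set q | closed_disc r q -> `|u q| < e].
  by move: near0; apply: filterS => q /=; rewrite sub0r normrN.
have V' : \forall rho \near r^'-, V rho /\ 0 < rho < r.
  near=> rho; split; first by near: rho; exact: cvg_within Vr.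
  apply/andP; split; near: rho; [exact: nbhs_left_gt|exact: nbhs_left_lt].
exists (U, [set rho | V rho /\ 0 < rho < r]) => //= -[th' rho] /= [Uth' [Vrho /andP[rho0 rhor]]].
apply: (UV (th', rho)) => //=.
rewrite /closed_disc /=; have := pol_norm2 rho th'; rewrite /= => ->.
by rewrite ler_sqr ?nnegrE; lra.
Unshelve. all: by end_near.
Qed.

(** * Completeness of the trigonometric system *)

Lemma continuous_M (R : realType) (f g : R -> R) :
  continuous f -> continuous g -> continuous (fun x => f x * g x).
Proof. by move=> cf cg x; apply: cvgM; [exact: cf|exact: cg]. Qed.

Lemma continuous_X (R : realType) (f : R -> R) (n : nat) :
  continuous f -> continuous (fun x => f x ^+ n).
Proof.
move=> cf; elim: n => [|n IH]; first by move=> x; exact: cvg_cst.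
by under eq_fun do rewrite exprS; exact: continuous_M.
Qed.

Lemma continuous_cosB (R : realType) (c t0 : R) : continuous (fun x : R => c + cos (x - t0)).
Proof.
move=> x; apply: cvgD; first exact: cvg_cst.
apply: (@continuous_comp _ _ _ (fun x : R => x - t0) cos); last exact: continuous_cos.
by apply: cvgB; [exact: cvg_id|exact: cvg_cst].
Qed.

Lemma cint_pos (R : realType) (s : R -> R) (t k : R) : continuous s ->
  (forall x, 0 <= s x) -> 0 < t < 2 * pi -> 0 < k -> k < s t -> 0 < cint s.
Proof.
move=> cs s0 /andP[t0 t2] k0 kst.
have /cvgrPdist_lt/(_ (s t - k)) := cs t.
rewrite subr_gt0 => /(_ kst) /nbhs_ballP[d0 /= d00 Hd0].
have [d dp [dd0 dt dt2]] : exists2 d, 0 < d & [/\ d < d0, d < t & d < 2 * pi - t].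
  exists (Num.min d0 (Num.min t (2 * pi - t)) / 2).
    by rewrite divr_gt0// !lt_min d00 t0 subr_gt0 t2.
  have m0 : 0 < Num.min d0 (Num.min t (2 * pi - t)) by rewrite !lt_min d00 t0 subr_gt0 t2.
  have h : Num.min d0 (Num.min t (2 * pi - t)) / 2 < Num.min d0 (Num.min t (2 * pi - t)) by lra.
  by split; apply: lt_le_trans h _; rewrite !ge_min lexx ?orbT.
have sub : `[t - d, t + d]%classic `<=` `[0, 2 * pi]%classic.
  move=> x /=; rewrite !in_itv /= => /andP[h1 h2]; apply/andP; lra.
have ks (x : R) : x \in `[t - d, t + d] -> k <= s x.
  rewrite in_itv /= => /andP[h1 h2].
  have := Hd0 x; rewrite /ball /= => H.
  have : `|t - x| < d0 by rewrite ltr_norml; lra.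
  by move/H; rewrite ltr_norml; lra.
apply: (@lt_le_trans _ _ (k * (d + d))); first by rewrite mulr_gt0// addr_gt0.
have int (a b : R) : (@lebesgue_measure R).-integrable `[a, b] (EFin \o s).
  apply: continuous_compact_integrable; first exact: segment_compact.
  exact: continuous_subspaceT.
have mes (a b : R) := measurable_int _ (int a b).
rewrite -lee_fin /cint /Rintegral fineK; last first.
  exact: integrable_fin_num (cint_integrable cs).
have le1 : (\int[@lebesgue_measure R]_(x in `[(t - d)%R, (t + d)%R]) (s x)%:E <=
    \int[@lebesgue_measure R]_(x in `[0%R, (2 * pi)%R]) (s x)%:E)%E.
  apply: ge0_subset_integral => //.
  by move=> x _; rewrite lee_fin.
apply: le_trans le1.
have -> : (k * (d + d))%:E = (\int[@lebesgue_measure R]_(x in `[(t - d)%R, (t + d)%R]) k%:E)%E.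
  rewrite integral_cst//= lebesgue_measure_itv /= lte_fin ifT; last by lra.
  by rewrite -EFinB -EFinM; congr (_%:E); ring.
by apply: ge0_le_integral => //; move=> x _; rewrite lee_fin ltW.
Qed.

(** The hypothesis [|x| <= 2 pi - d] excludes the neighbourhoods of the next maxima of the
    cosine. *)
Lemma cos_gt_near (R : realType) (x d : R) : 0 < d -> d < pi -> `|x| <= 2 * pi - d ->
  cos d < cos x -> `|x| < d.
Proof.
move=> d0 dpi; rewrite -[cos x]cos_norm; have := normr_ge0 x; move: `|x| => y y0 yd c.
rewrite ltNge; apply/negP => dy; move: c; rewrite ltNge => /negP; apply.
have [ypi|piy] := leP y pi.
  by rewrite leNgt ltr_cos ?in_itv /= -?leNgt; rewrite ?(ltW d0) ?(ltW dpi) ?y0 ?ypi.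
have -> : cos y = cos (2 * pi - y).
  by have -> : 2 * pi - y = - y + pi *+ 2; [ring|rewrite cosD2pi cosN].
rewrite leNgt ltr_cos ?in_itv /= -?leNgt; lra.
Qed.

Lemma cosD_harm (R : realType) (m : nat) (ph t0 th : R) :
  2 * (harm m.+1 ph th * cos (th - t0)) =
  harm m.+2 (ph - t0) th + harm m (ph + t0) th.
Proof.
rewrite /harm -[m.+2%:R]natr1 -[m.+1%:R]natr1.
have -> : (m%:R + 1 + 1) * th + (ph - t0) = ((m%:R + 1) * th + ph) + (th - t0) by ring.
have -> : m%:R * th + (ph + t0) = ((m%:R + 1) * th + ph) - (th - t0) by ring.
by move: ((m%:R + 1) * th + ph) => z; rewrite (cosD z) (cosB z); ring.
Qed.

(** Multiplication by [cos (x - t0)] turns a harmonic into harmonics of the neighbouring orders, so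
    orthogonality to all of them is inherited by the powers. Order 0 is apart, having no order below
    it. *)
Lemma cint_harm_pow (R : realType) (g : R -> R) (t0 c : R) (n m : nat) (ph : R) :
  continuous g -> (forall m ph, cint (fun x => g x * harm m ph x) = 0) ->
  cint (fun x => g x * harm m ph x * (c + cos (x - t0)) ^+ n) = 0.
Proof.
move=> cg g0; elim: n m ph => [|n IH] m ph.
  by rewrite -(g0 m ph); apply: eq_cint => x; rewrite expr0 mulr1.
have cpow : continuous (fun x : R => (c + cos (x - t0)) ^+ n).
  by apply: continuous_X; exact: continuous_cosB.
have cI k a : continuous (fun x => g x * harm k a x * (c + cos (x - t0)) ^+ n).
  by apply: continuous_M => //; apply: continuous_M => //; exact: continuous_harm.
case: m => [|m].
  transitivity (cint (fun x => c * (g x * harm 0 ph x * (c + cos (x - t0)) ^+ n) +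
      cos ph * (g x * harm 1 (- t0) x * (c + cos (x - t0)) ^+ n))).
    by apply: eq_cint => x; rewrite /harm exprS mul0r add0r mul1r; ring.
  by rewrite cintD ?cintZ ?IH ?mulr0 ?addr0// => x; apply: cvgM; (exact: cvg_cst || exact: cI).
transitivity (cint (fun x => c * (g x * harm m.+1 ph x * (c + cos (x - t0)) ^+ n) +
    2^-1 * (g x * harm m.+2 (ph - t0) x * (c + cos (x - t0)) ^+ n +
            g x * harm m (ph + t0) x * (c + cos (x - t0)) ^+ n))).
  apply: eq_cint => x; rewrite exprS -mulrDl -mulrDr -cosD_harm.
  by field.
have cS : continuous (fun x => g x * harm m.+2 (ph - t0) x * (c + cos (x - t0)) ^+ n +
            g x * harm m (ph + t0) x * (c + cos (x - t0)) ^+ n).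
  by move=> x; apply: cvgD; exact: cI.
rewrite cintD ?cintZ ?cintD ?IH ?mulr0 ?addr0//.
- by rewrite add0r mulr0.
- by move=> x; apply: cvgM; (exact: cvg_cst || exact: cI).
- by move=> x; apply: cvgM; (exact: cvg_cst || exact: cS).
Qed.

(* The powers of [1 + cos (x - t0) - cos d] peak at [t0]: they stay below [1]
   away from it and grow linearly with the exponent near it. *)
Lemma fourier_complete_pos (R : realType) (g : R -> R) (t0 : R) : continuous g ->
  (forall m ph, cint (fun x => g x * harm m ph x) = 0) -> 0 < t0 < 2 * pi -> g t0 <= 0.
Proof.
move=> cg g0 /andP[t00 t02]; rewrite leNgt; apply/negP => gp.
have /cvgrPdist_lt/(_ (g t0 / 2)) := cg t0.
rewrite divr_gt0// => /(_ isT) /nbhs_ballP[d0 /= d00 Hd0].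
have pi0 := @pi_gt0 R.
have [d dp [dd0 dt dt2 dpi]] : exists2 d : R, 0 < d &
    [/\ d < d0, d < t0, d < 2 * pi - t0 & d < pi].
  have m0 : 0 < Num.min (Num.min d0 pi) (Num.min t0 (2 * pi - t0)).
    by rewrite !lt_min d00 t00 subr_gt0 t02 pi0.
  exists (Num.min (Num.min d0 pi) (Num.min t0 (2 * pi - t0)) / 2); first by rewrite divr_gt0.
  have h : Num.min (Num.min d0 pi) (Num.min t0 (2 * pi - t0)) / 2 <
      Num.min (Num.min d0 pi) (Num.min t0 (2 * pi - t0)) by lra.
  by split; apply: lt_le_trans h _; rewrite !ge_min lexx ?orbT.
pose s (x : R) := Num.max 0 (cos (x - t0) - cos d).
have ccos : continuous (fun x : R => cos (x - t0)).
  have -> : (fun x : R => cos (x - t0)) = (fun x : R => 0 + cos (x - t0)).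
    by apply/funext => x; rewrite add0r.
  exact: continuous_cosB.
have cs : continuous s.
  move=> x; apply: (@continuous_max _ _ (fun=> 0) (fun x => cos (x - t0) - cos d)).
    exact: cvg_cst.
  by apply: cvgB; [exact: ccos|exact: cvg_cst].
have cd1 : cos d < 1 by rewrite -(@cos0 R) ltr_cos ?in_itv /= ?lexx ?ltW.
have s0 x : 0 <= s x by rewrite le_max lexx.
have Is : 0 < cint s.
  apply: (@cint_pos _ s t0 ((1 - cos d) / 2)) => //; first by apply/andP.
    by rewrite divr_gt0// subr_gt0.
  by rewrite /s subrr cos0 lt_max; apply/orP; right; lra.
have cgseg : {within `[0, 2 * pi], continuous g} by exact: continuous_subspaceT.
have [M0 M00 gM] : exists2 M, 0 <= M & forall x, 0 <= x <= 2 * pi -> `|g x| <= M.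
  have tp := @twopi_gt0 R.
  have [|c _ Hc] := @EVT_max _ (fun x => `|g x|) 0 (2 * pi) (ltW tp).
    by apply: continuous_subspaceT => x; apply: cvg_norm; exact: cg.
  by exists `|g c| => // x xI; apply: Hc; rewrite in_itv.
pose c := 1 - cos d.
pose T n := cint (fun x => g x * harm 0 0 x * (c + cos (x - t0)) ^+ n).
have T0 n : T n = 0 by exact: cint_harm_pow.
have cT n : continuous (fun x => g x * harm 0 0 x * (c + cos (x - t0)) ^+ n).
  apply: continuous_M; first by apply: continuous_M => //; exact: continuous_harm.
  by apply: continuous_X; exact: continuous_cosB.
have lb n x : 0 <= x <= 2 * pi ->
    (g t0 / 2 * n%:R) * s x - M0 <= g x * harm 0 0 x * (c + cos (x - t0)) ^+ n.
  move=> xI; rewrite /harm mul0r add0r cos0 mulr1 /s.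
  have [h|h] := leP (cos (x - t0)) (cos d).
    rewrite max_l; last by lra.
    rewrite mulr0 add0r.
    suff: `|g x * (c + cos (x - t0)) ^+ n| <= M0 by rewrite ler_norml => /andP[].
    rewrite normrM -[leRHS]mulr1; apply: ler_pM => //; first exact: gM.
    rewrite normrX exprn_ile1// ler_norml /c.
    by have := cos_geN1 (x - t0); lra.
  rewrite max_r; last by lra.
  have xd : `|x - t0| < d.
    apply: cos_gt_near => //; rewrite ler_norml; lra.
  have gx : g t0 / 2 < g x.
    have := Hd0 x; rewrite /ball /= distrC => /(_ (lt_trans xd dd0)).
    by rewrite ltr_norml; lra.
  have bern : 1 + n%:R * (cos (x - t0) - cos d) <= (c + cos (x - t0)) ^+ n.
    have -> : c + cos (x - t0) = 1 + (cos (x - t0) - cos d) by rewrite /c; ring.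
    have : 0 <= cos (x - t0) - cos d by lra.
    move: (cos (x - t0) - cos d) => y y0; elim: (n) => [|k IH]; first by rewrite mul0r addr0.
    rewrite exprS -natr1; apply: le_trans (ler_wpM2l _ IH); last by lra.
    have : 0 <= k%:R * (y * y) by rewrite !mulr_ge0.
    by move=> h2; have -> : (1 + y) * (1 + k%:R * y) = 1 + (k%:R + 1) * y + k%:R * (y * y);
      [ring|lra].
  have : g t0 / 2 * (1 + n%:R * (cos (x - t0) - cos d)) <= g x * (c + cos (x - t0)) ^+ n.
    apply: ler_pM => //; [lra| |exact: ltW].
    by apply: addr_ge0 => //; apply: mulr_ge0 => //; lra.
  by rewrite mulrDr mulr1 mulrA; lra.
have key n : (g t0 / 2 * n%:R) * cint s <= M0 * (2 * pi).
  have c1 : continuous (fun x => (g t0 / 2 * n%:R) * s x).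
    by apply: continuous_M => // x; exact: cvg_cst.
  have c2 : continuous (fun x => (g t0 / 2 * n%:R) * s x - M0).
    by move=> x; apply: cvgB; [exact: c1|exact: cvg_cst].
  have := cint_le c2 (cT n) (lb n); rewrite -/(T n) T0.
  rewrite cintB//; last by move=> x; exact: cvg_cst.
  by rewrite cintZ// cint_cst subr_le0.
have e0 : 0 < g t0 / 2 * cint s by rewrite mulr_gt0// divr_gt0.
have q0 : 0 <= M0 * (2 * pi) / (g t0 / 2 * cint s).
  by rewrite divr_ge0 ?(ltW e0)// mulr_ge0// ltW// twopi_gt0.
have := archi_boundP q0; rewrite ltr_pdivrMr//; apply/negP; rewrite -leNgt.
by rewrite mulrA [_ * (g t0 / 2)]mulrC; exact: key.
Qed.

(** The one-sided bound is applied to [g] and to [- g] inside the interval; the two ends follow by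
    continuity. *)
Lemma fourier_complete (R : realType) (g : R -> R) : continuous g ->
  (forall m ph, cint (fun x => g x * harm m ph x) = 0) ->
  forall t, 0 <= t <= 2 * pi -> g t = 0.
Proof.
move=> cg g0.
have gI t : 0 < t < 2 * pi -> g t = 0.
  move=> tI; apply/eqP; rewrite eq_le fourier_complete_pos//=.
  rewrite -oppr_le0; apply: (@fourier_complete_pos _ (fun x => - g x)) => //.
    by move=> x; apply: cvgN; exact: cg.
  move=> m ph; transitivity (cint (fun x => -1 * (g x * harm m ph x))).
    by apply: eq_cint => x; ring.
  by rewrite cintZ ?g0 ?mulr0//; apply: continuous_M => //; exact: continuous_harm.
have g00 : g 0 = 0.
  have h1 : g x @[x --> 0^'+] --> g 0 by apply: cvg_at_right_filter; exact: cg.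
  have h2 : g x @[x --> 0^'+] --> (0 : R).
    apply: cvg_near_cst; near=> x; apply: gI; apply/andP; split; near: x.
      exact: nbhs_right_gt.
    exact: nbhs_right_lt (twopi_gt0 R).
  exact: (cvg_unique _ h1 h2).
have g2 : g (2 * pi) = 0.
  have h1 : g x @[x --> (2 * pi)^'-] --> g (2 * pi) by apply: cvg_at_left_filter; exact: cg.
  have h2 : g x @[x --> (2 * pi)^'-] --> (0 : R).
    apply: cvg_near_cst; near=> x; apply: gI; apply/andP; split; near: x.
      exact: nbhs_left_gt (twopi_gt0 R).
    exact: nbhs_left_lt.
  exact: (cvg_unique _ h1 h2).
move=> t /andP[]; rewrite le_eqVlt => /orP[/eqP <- //|t0].
by rewrite le_eqVlt => /orP[/eqP -> //|t2]; apply: gI; rewrite t0.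
Unshelve. all: by end_near.
Qed.

Lemma polar_exists (R : realType) (p : R * R) :
  exists rho th, [/\ 0 <= rho, 0 <= th < 2 * pi & p = pol rho th].
Proof.
case: p => x y; have pi0 := @pi_gt0 R.
pose rho := Num.sqrt (x ^+ 2 + y ^+ 2); have rho0 : 0 <= rho by exact: sqrtr_ge0.
have rho2 : rho ^+ 2 = x ^+ 2 + y ^+ 2 by rewrite sqr_sqrtr// addr_ge0// sqr_ge0.
have [r0|rn0] := eqVneq rho 0.
  have [/eqP x0 /eqP y0] : x == 0 /\ y == 0.
    apply/andP; have := rho2; rewrite r0 expr0n /= => /esym/eqP.
    by rewrite paddr_eq0 ?sqr_ge0// !expf_eq0.
  exists 0, 0; split => //; first by rewrite lexx mulr_gt0.
  by rewrite /pol !mul0r x0 y0.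
have rp : 0 < rho by rewrite lt_neqAle eq_sym rn0.
have xr : -1 <= x / rho <= 1.
  have : (x / rho) ^+ 2 <= 1.
    by rewrite expr_div_n ler_pdivrMr ?exprn_gt0// mul1r rho2 lerDl sqr_ge0.
  by move=> h; rewrite -ler_norml -(@ler_pXn2r _ 2) ?nnegrE// expr1n real_normK ?num_real.
pose a := acos (x / rho).
have a0 : 0 <= a by exact: acos_ge0.
have api : a <= pi by exact: acos_lepi.
have ca : rho * cos a = x by rewrite acosK// mulrC divfK.
have sa0 : 0 <= sin a by apply: sin_ge0_pi; rewrite a0.
have sa : rho * sin a = `|y|.
  apply/eqP; rewrite -(@eqrXn2 _ 2)// ?mulr_ge0// real_normK ?num_real//.
  rewrite exprMn; apply/eqP; have := cos2Dsin2 a => h.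
  have -> : sin a ^+ 2 = 1 - cos a ^+ 2 by rewrite -h; ring.
  by rewrite mulrBr mulr1 -exprMn ca rho2; ring.
have [y0|y0] := leP 0 y.
  exists rho, a; split => //; first by rewrite a0; lra.
  by rewrite /pol ca sa ger0_norm.
have an0 : 0 < a.
  rewrite lt_neqAle a0 andbT; apply/eqP => a0'; move: sa.
  by rewrite -a0' sin0 mulr0 => /esym/eqP; rewrite normr_eq0 lt_eqF.
exists rho, (- a + pi *+ 2); split => //; first by rewrite mulr2n; lra.
by rewrite /pol cosD2pi sinD2pi cosN sinN ca mulrN sa ltr0_norm// opprK.
Qed.

Lemma cint_harm (R : realType) (k : nat) (a : R) :
  cint (harm k a) = if k == 0%N then 2 * pi * cos a else 0.
Proof.
case: eqP => [->|/eqP k0].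
  rewrite -(@mulrC _ (cos a)) -cint_cst; apply: eq_cint => x.
  by rewrite /harm mul0r add0r.
have kR : k%:R != 0 :> R by rewrite pnatr_eq0.
have D (x : R) : is_derive x 1 (fun x => k%:R^-1 * sin (k%:R * x + a)) (harm k a x).
  apply: is_derive_eq (derZ k%:R^-1 (der_comp (is_derive_sin _) (is_derive_affine k a x))) _.
  by rewrite /harm mulrCA mulVf// mulr1.
rewrite (cint_FTC (@continuous_harm R k a) D) sin_periodic_nat mulr0 add0r.
by rewrite subrr.
Qed.

Lemma harmM (R : realType) (m n : nat) (a b th : R) : (n <= m)%N ->
  harm m a th * harm n b th = 2^-1 * harm (m + n) (a + b) th + 2^-1 * harm (m - n) (a - b) th.
Proof.
move=> nm; rewrite /harm natrD natrB//.
have -> : (m%:R + n%:R) * th + (a + b) = (m%:R * th + a) + (n%:R * th + b) by ring.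
have -> : (m%:R - n%:R) * th + (a - b) = (m%:R * th + a) - (n%:R * th + b) by ring.
move: (m%:R * th + a) (n%:R * th + b) => x y.
by rewrite cosD cosB; field.
Qed.

Lemma cint_harmM (R : realType) (m n : nat) (a b : R) :
  cint (fun x => harm m a x * harm n b x) =
  if m == n then (if m == 0%N then 2 * pi * (cos a * cos b) else pi * cos (a - b)) else 0.
Proof.
wlog nm : m n a b / (n <= m)%N => [W|].
  have [|/ltnW] := leqP n m; first exact: W.
  move=> /W E; rewrite eq_sym (_ : cint _ = cint (fun x => harm n b x * harm m a x)).
    by rewrite E; case: eqP => // ->; rewrite (mulrC (cos b)) -[b - a]opprB cosN.
  by apply: eq_cint => x; rewrite mulrC.
have ch k c : continuous (fun x => 2^-1 * @harm R k c x).
  by apply: continuous_M; [move=> x; exact: cvg_cst|exact: continuous_harm].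
rewrite (eq_cint (fun x => harmM a b x nm)) cintD// !cintZ ?cint_harm; try exact: continuous_harm.
have [->|mn] := eqVneq m n.
  rewrite subnn eqxx addn_eq0 andbb; case: eqP => _; last by rewrite mulr0 add0r; field.
  by rewrite cosD cosB; field.
rewrite subn_eq0 leqNgt ltn_neqAle [n == m]eq_sym mn nm /= addn_eq0.
case: eqP => [m0|_]; last by rewrite !mulr0 addr0.
by move: nm mn; rewrite m0 leqn0 => /eqP ->.
Qed.

Lemma continuous_u_pol (R : realType) (r rho : R) (u : R * R -> R) :
  C2_on (disc r) u -> `|rho| < r -> continuous (fun th => u (pol rho th)).
Proof. by move=> [C1 _]; exact: continuous_disc_pol (continuous_C1 C1). Qed.

(** Once the expected mode is subtracted, orthogonality of the harmonics leaves a function with no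
    Fourier coefficient, which is zero by completeness. *)
Lemma single_mode (R : realType) (g : R -> R) (m : nat) : continuous g ->
  (forall n ph, n != m -> cint (fun x => g x * harm n ph x) = 0) ->
  forall t, 0 <= t <= 2 * pi ->
  g t = if m == 0%N then (2 * pi)^-1 * cint (fun x => g x * harm 0 0 x)
        else pi^-1 * (cint (fun x => g x * harm m 0 x) * cos (m%:R * t) +
                      cint (fun x => g x * harm m (- (pi / 2)) x) * sin (m%:R * t)).
Proof.
move=> cg g0 t tI.
have pin0 : pi != 0 :> R by rewrite gt_eqF// pi_gt0.
have ch k c := @continuous_harm R k c.
have cgh k c : continuous (fun x => g x * harm k c x) by exact: continuous_M.
have hs k x : harm k (- (pi / 2)) x = sin (k%:R * x) :> R by rewrite /harm cosBpihalf.
have hc k x : harm k 0 x = cos (k%:R * x) :> R by rewrite /harm addr0.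
set A := cint (fun x => g x * harm m 0 x).
set B := cint (fun x => g x * harm m (- (pi / 2)) x).
have cZ (c : R) (f : R -> R) : continuous f -> continuous (fun x => c * f x).
  by move=> cf; apply: continuous_M => // x; exact: cvg_cst.
have [m0|mn0] := eqVneq m 0%N.
  pose h x := g x - (2 * pi)^-1 * A * harm 0 0 x.
  have chh : continuous h by move=> x; apply: cvgB; [exact: cg|exact: cZ].
  have -> : cint (fun x => g x * harm 0 0 x) = A by rewrite /A m0.
  have : h t = 0.
    apply: fourier_complete => // n ph.
    transitivity (cint (fun x => g x * harm n ph x - (2 * pi)^-1 * A * (harm 0 0 x * harm n ph x))).
      by apply: eq_cint => x; rewrite /h mulrBl mulrA.
    rewrite cintB// ?cintZ ?cint_harmM//;
      try (by apply: continuous_M); try (by apply: cZ; apply: continuous_M).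
    case: eqVneq => [<-|n0]; last by rewrite mulr0 subr0 g0// m0 eq_sym.
    rewrite (_ : cint _ = cos ph * A).
      by rewrite cos0 /= mul1r mulrACA mulVf ?gt_eqF ?twopi_gt0// mul1r mulrC subrr.
    rewrite /A m0 -cintZ; last exact: cgh.
    by apply: eq_cint => x; rewrite /harm mul0r !add0r cos0; ring.
  by rewrite /h /harm mul0r addr0 cos0 mulr1 => /subr0_eq.
pose h x := g x - (pi^-1 * A * harm m 0 x + pi^-1 * B * harm m (- (pi / 2)) x).
have chh : continuous h.
  by move=> x; apply: cvgB; [exact: cg|apply: cvgD; exact: cZ].
have : h t = 0.
  apply: fourier_complete => // n ph.
  transitivity (cint (fun x => g x * harm n ph x - (pi^-1 * A * (harm m 0 x * harm n ph x)
      + pi^-1 * B * (harm m (- (pi / 2)) x * harm n ph x)))).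
    by apply: eq_cint => x; rewrite /h; ring.
  have cM k c : continuous (fun x => harm k c x * harm n ph x) by exact: continuous_M.
  rewrite cintB// ?cintD ?cintZ ?cint_harmM//; try (by apply: cM); try (by apply: cZ; apply: cM);
    try (by move=> x; apply: cvgD; exact: (cZ _ _ (cM _ _))).
  rewrite (negbTE mn0); case: eqVneq => [<-|n0]; last by rewrite !mulr0 addr0 subr0 g0// eq_sym.
  rewrite (_ : cint _ = cos ph * A - sin ph * B).
    have -> : cos (- (pi / 2) - ph) = - sin ph :> R by rewrite -opprD cosN addrC cosDpihalf.
    rewrite sub0r cosN ![_ * _ * (pi * _)]mulrACA mulVf// !mul1r; ring.
  rewrite -!cintZ -?cintB//; try exact: cZ.
  apply: eq_cint => x; rewrite hc hs /harm cosD; ring.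
rewrite /h hc hs => /subr0_eq ->; ring.
Qed.

(** * Reduction to a single mode *)

Lemma continuous_bess (R : realType) (m : nat) (k : R) : continuous (fun x => bess m (k * x)).
Proof.
move=> x; apply: (@continuous_comp _ _ _ (fun x : R => k * x) (bess m)).
  by apply: cvgM; [exact: cvg_cst|exact: cvg_id].
exact: der_cvg (is_derive_bess m (k * x)).
Qed.

Lemma fcoef_boundary (R : realType) (r : R) (u : R * R -> R) (m : nat) (ph : R) :
  0 < r -> C2_on (disc r) u -> {within closed_disc r, continuous u} ->
  (forall p, circle r p -> u p = 0) -> fcoef u m ph rho @[rho --> r^'-] --> 0.
Proof.
move=> r0 C2 cu bu; apply/cvgrPdist_le => e e0.
have e1 : 0 < e / (2 * pi) by rewrite divr_gt0// twopi_gt0.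
have H := circle_limit r0 e1 cu bu.
near=> rho.
have rr : `|rho| < r.
  have h1 : 0 < rho by near: rho; exact: nbhs_left_gt.
  have h2 : rho < r by near: rho; exact: nbhs_left_lt.
  by rewrite gtr0_norm.
rewrite sub0r normrN -[e](@divfK _ (2 * pi)); last by rewrite gt_eqF// twopi_gt0.
apply: cint_norm_le.
  by apply: continuous_M; [exact: continuous_u_pol C2 rr|exact: continuous_harm].
move=> th thI; rewrite normrM -[leRHS]mulr1; apply: ler_pM => //; last exact: harm_le1.
by apply: ltW; move: th thI; near: rho.
Unshelve. all: by end_near.
Qed.

(** The coefficient has limit 0 at the boundary circle, and its expression inside the disc is
    continuous up to it. *)
Lemma fcoef_factor (R : realType) (r lam : R) (u : R * R -> R) (m : nat) (ph : R) :
  0 < r -> 0 < lam -> dirichlet_eigenfunction r lam u ->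
  exists2 c, c * bess m (Num.sqrt lam * r) = 0 &
    forall rho, 0 < rho < r -> fcoef u m ph rho = c * bess m (Num.sqrt lam * rho).
Proof.
move=> r0 lam0 [C2 cu pde bu _].
have [c Hc] := fcoef_bess m ph r0 lam0 C2 pde; exists c => //.
have h1 := fcoef_boundary m ph r0 C2 cu bu.
have h2 : c * bess m (Num.sqrt lam * rho) @[rho --> r^'-] --> c * bess m (Num.sqrt lam * r).
  by apply: cvg_at_left_filter; apply: cvgM; [exact: cvg_cst|exact: continuous_bess].
have h3 : fcoef u m ph rho @[rho --> r^'-] --> c * bess m (Num.sqrt lam * r).
  apply: cvg_trans h2; apply: near_eq_cvg; near=> rho; apply/esym/Hc; apply/andP; split; near: rho.
    exact: nbhs_left_gt.
  exact: nbhs_left_lt.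
exact: (cvg_unique _ h3 h1).
Unshelve. all: by end_near.
Qed.

Lemma polar_extend (R : realType) (r th : R) (u : R * R -> R) (F : R -> R) :
  0 < r -> C2_on (disc r) u -> (forall rho, 0 < rho < r -> u (pol rho th) = F rho) ->
  continuous F -> forall rho, 0 <= rho < r -> u (pol rho th) = F rho.
Proof.
move=> r0 [C1 _] H cF rho /andP[]; rewrite le_eqVlt => /orP[/eqP <- _|h1 h2]; last first.
  by rewrite H// h1.
have h1 : u (pol x th) @[x --> 0^'+] --> u (pol 0 th).
  apply: cvg_at_right_filter.
  apply: (@continuous_comp _ _ _ (fun x : R => pol x th) u); first exact: continuous_pol_r.
  by apply: (continuous_C1 C1); apply: disc_pol; rewrite normr0.
have h2 : F x @[x --> 0^'+] --> F 0 by apply: cvg_at_right_filter; exact: cF.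
have h3 : u (pol x th) @[x --> 0^'+] --> F 0.
  apply: cvg_trans h2; apply: near_eq_cvg; near=> x; apply/esym/H; apply/andP; split; near: x.
    exact: nbhs_right_gt.
  exact: nbhs_right_lt.
exact: (cvg_unique _ h1 h3).
Unshelve. all: by end_near.
Qed.

Lemma disc_polar (R : realType) (r : R) (p : R * R) : 0 < r -> disc r p ->
  exists rho th, [/\ 0 <= rho < r, 0 <= th < 2 * pi & p = pol rho th].
Proof.
move=> r0; have [rho [th [h1 h2 ->]]] := polar_exists p => D.
exists rho, th; split => //; rewrite h1 /=; move: D; rewrite /disc /=.
by have := pol_norm2 rho th; rewrite /= => ->; rewrite ltr_sqr ?nnegrE// ltW.
Qed.

(** The clause on [m = 0] matters for the nodal set: there the harmonic is the constant [cos ph],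
    and [ph = 0] makes it 1. *)
Lemma dirichlet_polar (R : realType) (r lam : R) (u : R * R -> R) :
  0 < r -> 0 < lam -> dirichlet_eigenfunction r lam u ->
  exists m C ph, [/\ C != 0, bzero m (Num.sqrt lam * r), (m = 0%N -> ph = 0) &
    forall rho th, 0 <= rho < r -> 0 <= th <= 2 * pi ->
      u (pol rho th) = C * bess m (Num.sqrt lam * rho) * harm m ph th].
Proof.
move=> r0 lam0 E; set k := Num.sqrt lam.
have [C2 cu pde bu [p0 p0d p0n]] := E.
have k0 : 0 < k by rewrite sqrtr_gt0.
have kr0 : 0 < k * r by exact: mulr_gt0.
have rr rho : 0 < rho < r -> `|rho| < r by move=> /andP[h1 h2]; rewrite gtr0_norm.
have nz : ~ (forall rho th, 0 <= rho < r -> 0 <= th <= 2 * pi -> u (pol rho th) = 0).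
  move=> z; have [rho [th [h1 /andP[h2 /ltW h3] E0]]] := disc_polar r0 p0d.
  by move/eqP: p0n; rewrite E0; apply; apply: z => //; rewrite h2.
have fz n ph : phi n (- ((k * r) ^+ 2 / 4)) != 0 ->
    forall rho, 0 < rho < r -> fcoef u n ph rho = 0.
  move=> pn rho rhor; have [c c0 ->//] := fcoef_factor n ph r0 lam0 E.
  move/eqP: c0; rewrite -/k mulf_eq0 /bess mulf_eq0 (negbTE pn) orbF expf_eq0 (gt_eqF kr0) andbF orbF.
  by move/eqP => ->; rewrite mul0r.
have [m pm] : exists m, phi m (- ((k * r) ^+ 2 / 4)) = 0.
  apply: contrapT => /forallNP H; apply: nz => rho th rhor thI.
  apply: (@polar_extend _ r th u (fun=> 0) r0 C2) => //; last by move=> x; exact: cvg_cst.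
  move=> x xr; apply: (@fourier_complete _ (fun th => u (pol x th))) => //.
    exact: continuous_u_pol C2 (rr _ xr).
  by move=> n ph; apply: fz => //; apply/eqP; exact: H.
have al0 : - ((k * r) ^+ 2 / 4) != 0.
  by rewrite oppr_eq0 mulf_neq0 ?expf_neq0 ?gt_eqF// invr_gt0.
(* Bourget's hypothesis is applied from the smaller of the two orders to the larger. *)
have unq n : n != m -> phi n (- ((k * r) ^+ 2 / 4)) != 0.
  rewrite neq_ltn => /orP[nm|mn].
    apply/negP => /eqP pn.
    have := @bourget R n (m - n).-1 _ (@phi_zeros_unbounded R n) al0 pn.
    by rewrite prednK ?subn_gt0// subnKC ?(ltnW nm)// pm eqxx.
  have := @bourget R m (n - m).-1 _ (@phi_zeros_unbounded R m) al0 pm.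
  by rewrite prednK ?subn_gt0// subnKC ?(ltnW mn).
have fz' rho n ph : 0 < rho < r -> n != m -> fcoef u n ph rho = 0.
  by move=> h /unq h2; exact: fz.
have bz : bzero m (k * r) by [].
have done_ C ph : (m = 0%N -> ph = 0) ->
    (forall rho th, 0 < rho < r -> 0 <= th <= 2 * pi ->
      u (pol rho th) = C * bess m (k * rho) * harm m ph th) ->
    exists m C ph, [/\ C != 0, bzero m (k * r), (m = 0%N -> ph = 0) &
    forall rho th, 0 <= rho < r -> 0 <= th <= 2 * pi ->
      u (pol rho th) = C * bess m (k * rho) * harm m ph th].
  move=> m0 H.
  have H' rho th : 0 <= rho < r -> 0 <= th <= 2 * pi ->
      u (pol rho th) = C * bess m (k * rho) * harm m ph th.
    move=> rhor thI.
    apply: (@polar_extend _ r th u (fun x => C * bess m (k * x) * harm m ph th) r0 C2) => //.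
      by move=> x xr; exact: H.
    apply: continuous_M; last by move=> x; exact: cvg_cst.
    by apply: continuous_M; [move=> x; exact: cvg_cst|exact: continuous_bess].
  exists m, C, ph; split => //; apply/eqP => C0; apply: nz => rho th rhor thI.
  by rewrite H'// C0 !mul0r.
have [c0 _ Hc0] := fcoef_factor m 0 r0 lam0 E.
have [c1 _ Hc1] := fcoef_factor m (- (pi / 2)) r0 lam0 E.
have mode rho th : 0 < rho < r -> 0 <= th <= 2 * pi -> _ :=
  fun h => @single_mode R _ m (continuous_u_pol C2 (rr _ h)) (fun n ph => @fz' rho n ph h) th.
have [m0|mn0] := eqVneq m 0%N.
  apply: (done_ ((2 * pi)^-1 * c0) 0) => // rho th rhor thI.
  rewrite (mode rho th)// m0 eqxx -/(fcoef u 0 0 rho).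
  by have := Hc0 _ rhor; rewrite m0 => ->; rewrite /harm mul0r addr0 cos0 mulr1 mulrA.
(* Polar coordinates of the pair of coefficients merge the cosine and the sine into one shifted
   cosine. *)
have [S [psi [_ _ [E0 E1]]]] := polar_exists (c0, c1).
apply: (done_ (pi^-1 * S) (- psi)) => [m0|rho th rhor thI]; first by rewrite m0 in mn0.
rewrite (mode rho th)// (negbTE mn0) -/(fcoef u m 0 rho) -/(fcoef u m (- (pi / 2)) rho).
rewrite Hc0// Hc1// E0 E1 /harm cosB -/k.
ring.
Qed.

(** * Existence of eigenfunctions *)

(** The eigenvalue determines the mode: every eigenfunction for a zero of [J_m] has the nodal
    pattern of order [m]. *)
Lemma bzero_inj (R : realType) (m n : nat) (x : R) : bzero m x -> bzero n x -> m = n.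
Proof.
wlog mn : m n / (m < n)%N => [W hm hn|[x0 pm] [_ pn]].
  by have [h|h|//] := ltngtP m n; [exact: W|apply/esym; exact: W].
have al0 : - (x ^+ 2 / 4) != 0.
  by rewrite oppr_eq0 mulf_neq0 ?expf_neq0 ?gt_eqF// invr_gt0.
have := @bourget R m (n - m).-1 _ (@phi_zeros_unbounded R m) al0 pm.
by rewrite prednK ?subn_gt0// subnKC ?(ltnW mn)// pn eqxx.
Qed.

(** The partial derivatives are carried along as explicit functions, so that sum and product rules
    compute them; two applications yield [C2_on] and the Laplacian. *)
Definition C1_with (R : realType) (v vx vy : R * R -> R) : Prop :=
  [/\ continuous v, continuous vx, continuous vy,
      forall x y : R, is_derive x 1 (fun s => v (s, y)) (vx (x, y))
    & forall x y : R, is_derive y 1 (fun s => v (x, s)) (vy (x, y))].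

Lemma C1_with_pderiv (R : realType) (v vx vy : R * R -> R) : C1_with v vx vy ->
  [/\ pderiv false v = vx, pderiv true v = vy & forall D, C1_on D v].
Proof.
move=> [cv cx cy dx dy].
have E1 x y : is_derive (x, y) (basis_vec R false) v (vx (x, y)).
  have E : (fun h : R => h^-1 *: (v (h *: basis_vec R false + (x, y)) - v (x, y))) =
      (fun h : R => h^-1 *: (v (h *: 1 + x, y) - v (x, y))).
    by apply/funext => h; congr (_ *: (v _ - _)); congr pair; rewrite /= scaler0 add0r.
  have [d1 d2] := dx x y; split.
    by rewrite /derivable E.
  by rewrite /derive E.
have E2 x y : is_derive (x, y) (basis_vec R true) v (vy (x, y)).
  have E : (fun h : R => h^-1 *: (v (h *: basis_vec R true + (x, y)) - v (x, y))) =
      (fun h : R => h^-1 *: (v (x, h *: 1 + y) - v (x, y))).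
    by apply/funext => h; congr (_ *: (v _ - _)); congr pair; rewrite /= scaler0 add0r.
  have [d1 d2] := dy x y; split.
    by rewrite /derivable E.
  by rewrite /derive E.
have F1 : pderiv false v = vx by apply/funext => -[x y]; have [_ <-] := E1 x y.
have F2 : pderiv true v = vy by apply/funext => -[x y]; have [_ <-] := E2 x y.
split => // D [x y] _; split; first exact: cv.
case; [have [d _] := E2 x y; rewrite F2|have [d _] := E1 x y; rewrite F1]; split => //.
  exact: cy.
exact: cx.
Qed.

Lemma C1_with_eq (R : realType) (v vx vy wx wy : R * R -> R) : C1_with v vx vy -> vx =1 wx -> vy =1 wy -> C1_with v wx wy.
Proof. by move=> H /funext <- /funext <-. Qed.

Lemma continuous_add (R : realType) (v w : R * R -> R) : continuous v -> continuous w -> continuous (fun p => v p + w p).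
Proof. by move=> cv cw p; apply: cvgD; [exact: cv|exact: cw]. Qed.

Lemma continuous_mul (R : realType) (v w : R * R -> R) : continuous v -> continuous w -> continuous (fun p => v p * w p).
Proof. by move=> cv cw p; apply: cvgM; [exact: cv|exact: cw]. Qed.

Lemma C1_withD (R : realType) (v vx vy w wx wy : R * R -> R) : C1_with v vx vy -> C1_with w wx wy ->
  C1_with (fun p => v p + w p) (fun p => vx p + wx p) (fun p => vy p + wy p).
Proof.
move=> [cv cvx cvy dvx dvy] [cw cwx cwy dwx dwy].
by split; [exact: continuous_add|exact: continuous_add|exact: continuous_add|
  move=> x y; exact: (derD (dvx x y) (dwx x y))|move=> x y; exact: (derD (dvy x y) (dwy x y))].
Qed.

Lemma C1_withM (R : realType) (v vx vy w wx wy : R * R -> R) : C1_with v vx vy -> C1_with w wx wy ->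
  C1_with (fun p => v p * w p) (fun p => vx p * w p + v p * wx p)
    (fun p => vy p * w p + v p * wy p).
Proof.
move=> [cv cvx cvy dvx dvy] [cw cwx cwy dwx dwy].
by split; [exact: continuous_mul|apply: continuous_add; exact: continuous_mul
  |apply: continuous_add; exact: continuous_mul|
  move=> x y; exact: (derM (dvx x y) (dwx x y))|move=> x y; exact: (derM (dvy x y) (dwy x y))].
Qed.

Lemma C1_with_cst (R : realType) (c : R) : C1_with (fun=> c) (fun=> 0) (fun=> 0).
Proof.
by split; [move=> x; exact: cvg_cst|move=> x; exact: cvg_cst|move=> x; exact: cvg_cst
  |move=> x y; exact: derC|move=> x y; exact: derC].
Qed.

Lemma C1_with_fst (R : realType) : C1_with (@fst R R) (fun=> 1) (fun=> 0).
Proof.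
by split; [move=> x; exact: cvg_fst|move=> x; exact: cvg_cst|move=> x; exact: cvg_cst
  |move=> x y; exact: derI|move=> x y; exact: derC].
Qed.

Lemma C1_with_snd (R : realType) : C1_with (@snd R R) (fun=> 0) (fun=> 1).
Proof.
by split; [move=> x; exact: cvg_snd|move=> x; exact: cvg_cst|move=> x; exact: cvg_cst
  |move=> x y; exact: derC|move=> x y; exact: derI].
Qed.

(* The real and imaginary parts of [(x + i y) ^ m]. *)
Fixpoint cpow (R : realType) (m : nat) (p : R * R) : R * R :=
  if m is n.+1 then
    (p.1 * (cpow n p).1 - p.2 * (cpow n p).2, p.1 * (cpow n p).2 + p.2 * (cpow n p).1)
  else (1, 0).

Lemma C1_with_cpow (R : realType) (m : nat) :
  C1_with (fun p : R * R => (cpow m p).1) (fun p => m%:R * (cpow m.-1 p).1)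
    (fun p => - (m%:R * (cpow m.-1 p).2)) /\
  C1_with (fun p : R * R => (cpow m p).2) (fun p => m%:R * (cpow m.-1 p).2)
    (fun p => m%:R * (cpow m.-1 p).1).
Proof.
elim: m => [|m [H G]].
  split; (apply: (C1_with_eq (C1_with_cst _)) => p /=; rewrite mul0r ?oppr0 //).
have X := C1_with_fst R; have Y := C1_with_snd R.
have E p : m%:R * (cpow m p).1 =
    p.1 * (m%:R * (cpow m.-1 p).1) - p.2 * (m%:R * (cpow m.-1 p).2) :> R.
  by case: (m) => [|k] /=; [rewrite !mul0r !mulr0 subr0|ring].
have F p : m%:R * (cpow m p).2 =
    p.1 * (m%:R * (cpow m.-1 p).2) + p.2 * (m%:R * (cpow m.-1 p).1) :> R.
  by case: (m) => [|k] /=; [rewrite !mul0r !mulr0 addr0|ring].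
split.
- have -> : (fun p : R * R => (cpow m.+1 p).1) =
      (fun p => p.1 * (cpow m p).1 + (-1) * (p.2 * (cpow m p).2)).
    by apply/funext => p /=; ring.
  apply: (C1_with_eq (C1_withD (C1_withM X H) (C1_withM (C1_with_cst (-1)) (C1_withM Y G)))).
    move=> p /=; rewrite -natr1 mulrDl E; ring.
  move=> p /=; rewrite -natr1 mulrDl F; ring.
- apply: (C1_with_eq (C1_withD (C1_withM X G) (C1_withM Y H))).
    move=> p /=; rewrite -natr1 mulrDl F; ring.
  move=> p /=; rewrite -natr1 mulrDl E; ring.
Qed.

Definition rphi (R : realType) (lam : R) (n : nat) (p : R * R) : R :=
  phi n (- (lam / 4) * (p.1 ^+ 2 + p.2 ^+ 2)).

Lemma C1_with_rphi (R : realType) (lam : R) (n : nat) :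
  C1_with (rphi lam n) (fun p => - (lam / 2) * (p.1 * rphi lam n.+1 p))
    (fun p => - (lam / 2) * (p.2 * rphi lam n.+1 p)).
Proof.
have c k : continuous (rphi lam k).
  move=> p; apply: (@continuous_comp _ _ _
    (fun p : R * R => - (lam / 4) * (p.1 ^+ 2 + p.2 ^+ 2)) (phi k)).
    by apply: cvgM; [exact: cvg_cst|exact: continuous_norm2].
  exact: continuous_phi.
have cf : continuous (@fst R R) by move=> p; exact: cvg_fst.
have cs : continuous (@snd R R) by move=> p; exact: cvg_snd.
have cc (a : R) : continuous (fun _ : R * R => a) by move=> p; exact: cvg_cst.
split => //.
- by apply: continuous_mul => //; exact: continuous_mul.
- by apply: continuous_mul => //; exact: continuous_mul.
- move=> x y.
  have D := derZ (- (lam / 4)) (derD (derX 2 (derI x)) (derC x 1 (y ^+ 2))).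
  apply: is_derive_eq (der_comp (is_derive_phi n _) D) _.
  by rewrite /rphi /=; field.
- move=> x y.
  have D := derZ (- (lam / 4)) (derD (derC y 1 (x ^+ 2)) (derX 2 (derI y))).
  apply: is_derive_eq (der_comp (is_derive_phi n _) D) _.
  by rewrite /rphi /=; field.
Qed.

(** The eigenfunction is [phi_m(- lam |p| ^ 2 / 4)] times the real part of [(x + i y) ^ m]. This
    Cartesian form is smooth at the origin, where polar coordinates are singular. *)
Lemma eigenfunction_exists (R : realType) (r lam : R) (m : nat) : 0 < r -> 0 < lam ->
  bzero m (Num.sqrt lam * r) -> exists u, dirichlet_eigenfunction r lam u.
Proof.
move=> r0 lam0 [_ bz].
pose u p := rphi lam m p * (cpow m p).1.
have [H G] := C1_with_cpow R m; have [H' G'] := C1_with_cpow R m.-1.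
have P0 := C1_with_rphi lam m; have P1 := C1_with_rphi lam m.+1.
have X := C1_with_fst R; have Y := C1_with_snd R.
have c k := C1_with_cst (k : R).
have U := C1_withM P0 H.
have Ux := C1_withD (C1_withM (C1_withM (c (- (lam / 2))) (C1_withM X P1)) H)
  (C1_withM P0 (C1_withM (c m%:R) H')).
have Uy := C1_withD (C1_withM (C1_withM (c (- (lam / 2))) (C1_withM Y P1)) H)
  (C1_withM P0 (C1_withM (c (- m%:R)) G')).
have [ux uy u1] := C1_with_pderiv U.
have Ey : pderiv true u = (fun p => - (lam / 2) * (p.2 * rphi lam m.+1 p) * (cpow m p).1 +
    rphi lam m p * (- m%:R * (cpow m.-1 p).2)).
  by rewrite uy; apply/funext => p; rewrite mulNr.
have [uxx _ ux1] := C1_with_pderiv Ux.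
have [_ uyy uy1] := C1_with_pderiv Uy.
have cu : continuous u by case: U.
exists u; split.
- split; first exact: u1.
  by case; [rewrite Ey; exact: uy1|rewrite ux; exact: ux1].
- exact: continuous_subspaceT.
- move=> p _; rewrite /laplacian Ey ux uxx uyy /u /rphi.
  set z := - (lam / 4) * (p.1 ^+ 2 + p.2 ^+ 2).
  have rec := phi_rec m z.
  (* Euler's identity for a homogeneous polynomial of degree [m]; for [m = 0] both sides are 0. *)
  have E : m%:R * (cpow m p).1 =
      p.1 * (m%:R * (cpow m.-1 p).1) - p.2 * (m%:R * (cpow m.-1 p).2) :> R.
    by case: (m) => [|k] /=; [rewrite !mul0r !mulr0 subr0|ring].
  have -> : phi m z * (cpow m p).1 = (z * phi m.+2 z + (m%:R + 1) * phi m.+1 z) * (cpow m p).1.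
    by rewrite natr1 rec.
  have zE : z = - (lam / 4) * (p.1 ^+ 2 + p.2 ^+ 2) by [].
  clearbody z; clear rec.
  move: (phi m z) (phi m.+1 z) (phi m.+2 z) (cpow m p).1 (cpow m.-1 p).1 (cpow m.-1 p).2 E => f0 f1 f2 h h' g' E.
  move: (m.-1%:R * (cpow m.-2 p).1) => k; move: (m%:R : R) E => M E.
  transitivity (lam * f1 * h + lam * f1 * (p.1 * (M * h') - p.2 * (M * g')) - z * - lam * f2 * h).
    by rewrite zE; field.
  by rewrite -E; ring.
- move=> p; rewrite /circle /= => pr; rewrite /u /rphi pr.
  rewrite (_ : _ * _ ^+ 2 = - ((Num.sqrt lam * r) ^+ 2 / 4)); first by rewrite bz mul0r.
  by rewrite exprMn sqr_sqrtr ?ltW//; field.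
- have D : phi m (- (lam / 4) * t ^+ 2) @[t --> 0^'+] --> phi m 0.
    have -> : phi m 0 = phi m (- (lam / 4) * 0 ^+ 2) by rewrite expr0n mulr0.
    apply: cvg_at_right_filter.
    apply: (@continuous_comp _ _ _ (fun t : R => - (lam / 4) * t ^+ 2) (phi m)).
      by apply: cvgM; [exact: cvg_cst|exact: exprn_continuous].
    exact: continuous_phi.
  have p0 : 0 < phi m (0 : R) by rewrite phi0 invr_gt0 ltr0n fact_gt0.
  have [t [t0 tr tp]] : exists t : R, [/\ 0 < t, t < r & 0 < phi m (- (lam / 4) * t ^+ 2)].
    have N : \forall t \near (0 : R)^'+, [/\ 0 < t, t < r & 0 < phi m (- (lam / 4) * t ^+ 2)].
      near=> t; split; near: t; [exact: nbhs_right_gt|exact: nbhs_right_lt|exact: (cvgr_gt _ D)].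
    exact: (filter_ex N).
  exists (t, 0); first by rewrite /disc /= expr0n addr0 ltr_sqr ?nnegrE// ltW.
  rewrite /u mulf_neq0//; first by rewrite /rphi /= expr0n addr0 gt_eqF.
  suff -> : cpow m (t, 0) = (t ^+ m, 0) by rewrite /= expf_neq0// gt_eqF.
  elim: (m) => [|k IH] //=; rewrite IH /= !mul0r subr0 mulr0 addr0 -exprS //.
Unshelve. all: by end_near.
Qed.

(** * Hausdorff length of circles and radii *)

(* MathComp-Analysis has its own [edist], on the extended reals. *)
Local Notation edist := Defs.edist.

Lemma euclid_ge0 (R : realType) (p q : R * R) : 0 <= edist p q.
Proof. exact: sqrtr_ge0. Qed.

Lemma euclidC (R : realType) (p q : R * R) : edist p q = edist q p.
Proof. by congr (Num.sqrt (_ + _)); rewrite -sqrrN opprB. Qed.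

Lemma ediam_ge0 (R : realType) (A : set (R * R)) : (0 <= ediam A)%E.
Proof. by rewrite /ediam le_max lexx. Qed.

Lemma edist_le_ediam (R : realType) (A : set (R * R)) (p q : R * R) :
  A p -> A q -> ((edist p q)%:E <= ediam A)%E.
Proof.
move=> Ap Aq; rewrite /ediam le_max; apply/orP; right.
by apply: ereal_sup_ubound; exists p, q.
Qed.

Lemma ediam_le (R : realType) (A : set (R * R)) (d : R) : 0 <= d ->
  (forall p q, A p -> A q -> edist p q <= d) -> (ediam A <= d%:E)%E.
Proof.
move=> d0 H; rewrite /ediam ge_max lee_fin d0 /=.
by apply: ge_ereal_sup => _ [p [q [Ap Aq ->]]]; rewrite lee_fin; exact: H.
Qed.

Lemma le_ediam (R : realType) (A B : set (R * R)) : A `<=` B -> (ediam A <= ediam B)%E.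
Proof.
move=> AB; rewrite {1}/ediam ge_max ediam_ge0 /=.
by apply: ge_ereal_sup => _ [p [q [Ap Aq ->]]]; apply: edist_le_ediam; exact: AB.
Qed.

Lemma ediam0 (R : realType) : ediam (@set0 (R * R)) = 0%E.
Proof. by apply/eqP; rewrite eq_le ediam_ge0 andbT; exact: ediam_le. Qed.

(** * Upper and lower bounds for Hausdorff length *)

(** Finite covers with bounds [d k] in place of the diameters themselves; in this form upper bounds
    add up over finite unions. *)
Definition fine_covers (R : realType) (A : set (R * R)) (L : R) : Prop :=
  forall delta : R, 0 < delta -> exists n (U : nat -> set (R * R)) (d : nat -> R),
    [/\ forall p, A p -> exists2 k, (k < n)%N & U k p,
        forall k, 0 <= d k <= delta,
        forall k p q, U k p -> U k q -> edist p q <= d k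
      & \sum_(0 <= k < n) d k <= L].

Lemma fine_covers_hausdorff (R : realType) (A : set (R * R)) (L : R) :
  fine_covers A L -> (hausdorff1 A <= L%:E)%E.
Proof.
move=> H; apply: ge_ereal_sup => _ [delta d0 ->].
have [n [U [d [cov dI dU sd]]]] := H _ d0.
pose V k := if (k < n)%N then U k else set0.
have dV k : (ediam (V k) <= (if (k < n)%N then d k else 0)%:E)%E.
  rewrite /V; case: ifP => _; last by rewrite ediam0.
  by apply: ediam_le (dU k); case/andP: (dI k).
apply: (@le_trans _ _ (\sum_(0 <= k <oo) ediam (V k))%E).
  apply: ereal_inf_lbound; exists V; split => //.
    by move=> p /cov[k kn Ukp]; exists k => //; rewrite /V kn.
  move=> k; apply: le_trans (dV k) _; rewrite lee_fin; case: ifP => _; last exact: ltW.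
  by case/andP: (dI k).
rewrite (nneseries_split 0 n); last by move=> k _; exact: ediam_ge0.
rewrite eseries0 ?adde0 ?add0n; last first.
  by move=> i ni _; rewrite /V ltnNge ni ediam0.
apply: (@le_trans _ _ (\sum_(0 <= k < n) (d k)%:E)%E).
  rewrite big_nat_cond [leRHS]big_nat_cond; apply: lee_sum => k /andP[/andP[_ kn] _].
  by have := dV k; rewrite kn.
by rewrite sumEFin lee_fin.
Qed.

Lemma fine_coversU (R : realType) (A B : set (R * R)) (L M : R) :
  fine_covers A L -> fine_covers B M -> fine_covers (A `|` B) (L + M).
Proof.
move=> HA HB delta d0.
have [n [U [d [covU dU U1 U2]]]] := HA _ d0.
have [m [V [e [covV eV V1 V2]]]] := HB _ d0.
exists (n + m)%N, (fun k => if (k < n)%N then U k else V (k - n)%N),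
  (fun k => if (k < n)%N then d k else e (k - n)%N); split.
- move=> p [/covU[k kn Up]|/covV[k km Vp]].
    by exists k; rewrite ?kn// ltn_addr.
  exists (n + k)%N; first by rewrite ltn_add2l.
  by rewrite ltnNge leq_addr /= addKn.
- by move=> k; case: ifP => _; [exact: dU|exact: eV].
- by move=> k p q; case: ifP => _; [exact: U1|exact: V1].
- rewrite (@big_cat_nat _ _ _ n) ?leq_addr//=; apply: lerD.
    rewrite big_nat_cond (eq_bigr d); first by rewrite -big_nat_cond.
    by move=> k /andP[/andP[_ ->]].
  rewrite -{1}[n]add0n big_addn addKn (eq_bigr e)// => k _.
  by rewrite ltnNge leq_addl /= addnK.
Qed.

Lemma fine_covers0 (R : realType) : fine_covers (@set0 (R * R)) 0.
Proof.
move=> delta d0; exists 0%N, (fun=> set0), (fun=> 0); split => //.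
- by move=> k; rewrite lexx ltW.
- by rewrite big_geq.
Qed.

Lemma fine_covers_sub (R : realType) (A B : set (R * R)) (L : R) :
  A `<=` B -> fine_covers B L -> fine_covers A L.
Proof.
move=> AB H delta /H[n [U [d [c1 c2 c3 c4]]]].
by exists n, U, d; split => // p /AB; exact: c1.
Qed.

Lemma fine_covers_bigcup (R : realType) (T : eqType) (s : seq T)
    (A : T -> set (R * R)) (L : T -> R) : (forall i, i \in s -> fine_covers (A i) (L i)) ->
  fine_covers [set p | exists2 i, i \in s & A i p] (\sum_(i <- s) L i).
Proof.
elim: s => [|i s IH] H; first by rewrite big_nil; apply: fine_covers_sub (@fine_covers0 R) => p [].
rewrite big_cons; apply: (@fine_covers_sub _ _ (A i `|` [set p | exists2 i, i \in s & A i p])).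
  move=> p [j]; rewrite inE => /orP[/eqP -> ?|js Ap]; [by left|by right; exists j].
by apply: fine_coversU; [|apply: IH => j js]; apply: H; rewrite inE ?eqxx// js orbT.
Qed.

Lemma fine_covers_curve (R : realType) (g : R -> R * R) (c l : R) : 0 <= c -> 0 <= l ->
  (forall s t, 0 <= s <= l -> 0 <= t <= l -> edist (g s) (g t) <= c * `|s - t|) ->
  fine_covers (g @` `[0, l]) (c * l).
Proof.
move=> c0 l0 lip delta d0.
have cl0 : 0 <= c * l / delta by rewrite divr_ge0 ?mulr_ge0// ltW.
pose n := (Num.bound (c * l / delta)).+1.
have n0 : 0 < n%:R :> R by rewrite ltr0n.
have nd : c * l / n%:R <= delta.
  rewrite ler_pdivrMr// [delta * _]mulrC -ler_pdivrMr//.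
  by apply: le_trans (ltW (archi_boundP cl0)) _; rewrite ler_nat.
pose h := l / n%:R; have h0 : 0 <= h by rewrite divr_ge0// ltW.
have nh : n%:R * h = l by rewrite /h mulrC divfK// gt_eqF.
exists n, (fun k => g @` [set t | 0 <= t <= l /\ k%:R * h <= t <= k.+1%:R * h]),
  (fun=> c * l / n%:R); split.
- move=> p [t]; rewrite /= in_itv /= => /andP[t0 tl] <-.
  suff [k kn tk] : exists2 k, (k < n)%N & k%:R * h <= t <= k.+1%:R * h.
    by exists k => //; exists t => //; split => //; rewrite t0.
  have : t <= n%:R * h by rewrite nh.
  have : (0 < n)%N by [].
  elim: (n) => // k IH _ tk; case: k IH tk => [|k] IH tk.
    by exists 0%N => //; rewrite mul0r t0.
  have [h1|h1] := leP t (k.+1%:R * h); last by exists k.+1 => //; rewrite tk (ltW h1).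
  by have [j jk tj] := IH isT h1; exists j => //; exact: ltnW.
- by move=> k; rewrite nd divr_ge0 ?mulr_ge0// ltW.
- move=> k _ _ [s [sI /andP[s1 s2]] <-] [t [tI /andP[t1 t2]] <-].
  apply: le_trans (lip _ _ sI tI) _; rewrite -mulrA -/h ler_wpM2l//.
  move: s1 s2 t1 t2; rewrite -natr1 mulrDl mul1r ler_norml; move: (k%:R * h) => x; lra.
- by rewrite sumr_const_nat subn0 -[_ *+ _]mulr_natr divfK// gt_eqF.
Qed.

Definition covers_ge (R : realType) (delta : R) (A : set (R * R)) (L : R) : Prop :=
  forall U : nat -> set (R * R), A `<=` \bigcup_k U k ->
    (forall k, (ediam (U k) <= delta%:E)%E) ->
    (L%:E <= \sum_(0 <= k <oo) ediam (U k))%E.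

(** Asking the bound at every small scale, and not of the supremum over scales, lets finitely many
    pieces be treated at a common scale. *)
Definition length_ge (R : realType) (A : set (R * R)) (L : R) : Prop :=
  \forall delta \near (0 : R)^'+, covers_ge delta A L.

Definition far_apart (R : realType) (A B : set (R * R)) : Prop :=
  \forall delta \near (0 : R)^'+, forall p q, A p -> B q -> delta < edist p q.

Lemma length_ge_hausdorff (R : realType) (A : set (R * R)) (L : R) :
  length_ge A L -> (L%:E <= hausdorff1 A)%E.
Proof.
move=> H.
have N : \forall delta \near (0 : R)^'+, 0 < delta /\ covers_ge delta A L.
  by near=> d; split; near: d => //; exact: nbhs_right_gt.
have [d [d0 Hd]] := filter_ex N.
apply: (@le_trans _ _ (hausdorff1_pre d A)); last by apply: ereal_sup_ubound; exists d.
by apply: le_ereal_inf_tmp => _ [U [c1 c2 ->]]; exact: Hd.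
Unshelve. all: by end_near.
Qed.

Lemma length_ge_sub (R : realType) (A B : set (R * R)) (L : R) :
  A `<=` B -> length_ge A L -> length_ge B L.
Proof.
move=> AB; apply: filterS => d H U c1; apply: H => p /AB; exact: c1.
Qed.

Lemma length_ge0 (R : realType) (A : set (R * R)) : length_ge A 0.
Proof.
near=> d => U _ _; apply: nneseries_ge0 => k _ _; exact: ediam_ge0.
Unshelve. all: by end_near.
Qed.

(* A set of diameter less than the distance between [A] and [B] meets only one
   of them, so that covers of the union split. *)
Lemma length_geU (R : realType) (A B : set (R * R)) (L M : R) : far_apart A B ->
  length_ge A L -> length_ge B M -> length_ge (A `|` B) (L + M).
Proof.
move=> S HA HB; near=> d => U cov dU.
have HdA : covers_ge d A L by near: d.
have HdB : covers_ge d B M by near: d.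
have Sd : forall p q, A p -> B q -> d < edist p q by near: d.
apply: (@le_trans _ _ (\sum_(0 <= k <oo) (ediam (U k `&` A) + ediam (U k `&` B)))%E).
  rewrite nneseriesD; try by move=> i _ _; exact: ediam_ge0.
  rewrite EFinD; apply: leeD.
    apply: HdA => [p Ap|k].
      by have [k _ Ukp] := cov p (or_introl Ap); exists k.
    by apply: le_trans (dU k); apply: le_ediam; exact: subIsetl.
  apply: HdB => [p Ap|k].
    by have [k _ Ukp] := cov p (or_intror Ap); exists k.
  by apply: le_trans (dU k); apply: le_ediam; exact: subIsetl.
apply: lee_nneseries => [k _ _|k _]; first by rewrite adde_ge0 ?ediam_ge0.
have [UA|/set0P[p [Up Ap]]] := eqVneq (U k `&` A) set0.
  by rewrite UA ediam0 add0e; apply: le_ediam; exact: subIsetl.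
have -> : U k `&` B = set0.
  rewrite -subset0 => q [Uq Bq]; have := Sd _ _ Ap Bq.
  by rewrite ltNge -lee_fin (le_trans (edist_le_ediam Up Uq) (dU k)).
by rewrite ediam0 adde0; apply: le_ediam; exact: subIsetl.
Unshelve. all: by end_near.
Qed.

Lemma far_apart_sym (R : realType) (A B : set (R * R)) : far_apart A B -> far_apart B A.
Proof. by rewrite /far_apart; apply: filterS => d H p q Bp Aq; rewrite euclidC; exact: H. Qed.

Lemma far_apart_bigcup (R : realType) (T : eqType) (s : seq T) (A : set (R * R))
    (B : T -> set (R * R)) : (forall i, i \in s -> far_apart A (B i)) ->
  far_apart A [set p | exists2 i, i \in s & B i p].
Proof.
rewrite /far_apart; elim: s => [|i s IH] H; first by near=> d => p q _ [].
have H1 : far_apart A (B i) by apply: H; rewrite mem_head.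
have H2 : far_apart A [set p | exists2 i, i \in s & B i p].
  by apply: IH => j js; apply: H; rewrite inE js orbT.
near=> d => p q Ap [j]; rewrite inE => /orP[/eqP ->|js] Bq.
  by move: p q Ap Bq; near: d.
have : [set p | exists2 i, i \in s & B i p] q by exists j.
by move: p q Ap {Bq}; near: d.
Unshelve. all: by end_near.
Qed.

Lemma length_ge_bigcup (R : realType) (T : eqType) (s : seq T)
    (A : T -> set (R * R)) (L : T -> R) : uniq s ->
  (forall i, i \in s -> length_ge (A i) (L i)) ->
  (forall i j, i \in s -> j \in s -> i != j -> far_apart (A i) (A j)) ->
  length_ge [set p | exists2 i, i \in s & A i p] (\sum_(i <- s) L i).
Proof.
elim: s => [|i s IH] u H S; first by rewrite big_nil; exact: length_ge0.
move: u => /= /andP[is_ us]; rewrite big_cons.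
apply: (@length_ge_sub _ (A i `|` [set p | exists2 i, i \in s & A i p])).
  by move=> p [Ap|[j js Ap]]; [exists i; rewrite ?mem_head|exists j; rewrite // inE js orbT].
apply: length_geU.
- apply: far_apart_bigcup => j js; apply: S; rewrite ?mem_head// ?inE ?js ?orbT//.
  by apply: contraNneq is_ => ->.
- by apply: H; rewrite mem_head.
- apply: IH => // [j js|j k js ks].
    by apply: H; rewrite inE js orbT.
  by apply: S; rewrite inE ?js ?ks orbT.
Qed.

(* Pull a cover back to the parameter and replace each piece by the smallest
   interval that contains it. *)
Lemma covers_ge_curve (R : realType) (g : R -> R * R) (E : set (measurableTypeR R))
    (c L a b delta : R) : 0 < c -> measurable E -> E `<=` `[a, b] ->
  (L%:E <= c%:E * @lebesgue_measure R E)%E ->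
  (forall s t, E s -> E t -> edist (g s) (g t) <= delta -> c * `|s - t| <= edist (g s) (g t)) ->
  covers_ge delta (g @` E) L.
Proof.
move=> c0 mE Eab EL H U cov dU.
pose V k := [set s | E s /\ U k (g s)].
have bound k s t : V k s -> V k t -> ((c * `|s - t|)%:E <= ediam (U k))%E.
  move=> [Es Us] [Et Ut]; have h := edist_le_ediam Us Ut.
  apply: le_trans h; rewrite lee_fin; apply: H => //.
  by rewrite -lee_fin; apply: le_trans (dU k); exact: edist_le_ediam.
have /choice[W HW] : forall k, exists W : set (measurableTypeR R),
    [/\ measurable W, V k `<=` W & (c%:E * @lebesgue_measure R W <= ediam (U k))%E].
  move=> k.
  have [V0|/set0P[s0 Vs0]] := eqVneq (V k) set0.
    by exists set0; rewrite V0 measure0 mule0 ediam_ge0; split.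
  have fU : ediam (U k) \is a fin_num.
    by rewrite ge0_fin_numE ?ediam_ge0//; apply: le_lt_trans (dU k) _; rewrite ltry.
  pose d := fine (ediam (U k)) / c.
  have Vd s t : V k s -> V k t -> s - t <= d.
    move=> Vs Vt; apply: le_trans (ler_norm _) _; rewrite ler_pdivlMr// mulrC.
    by rewrite -lee_fin fineK//; exact: bound.
  have hs : has_sup (V k).
    split; first by exists s0.
    by exists b => s [/Eab /=]; rewrite in_itv /= => /andP[].
  have hi : has_inf (V k).
    split; first by exists s0.
    by exists a => s [/Eab /=]; rewrite in_itv /= => /andP[].
  have si : sup (V k) <= inf (V k) + d.
    apply: ge_sup; first by exists s0.
    move=> s Vs; rewrite -lerBlDr; apply: lb_le_inf; first by exists s0.
    by move=> t Vt; rewrite lerBlDr -lerBlDl; exact: Vd.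
  have is_ : inf (V k) <= sup (V k).
    by apply: (@le_trans _ _ s0); [apply: ge_inf => //; case: hi|apply: ub_le_sup => //; case: hs].
  exists `[inf (V k), sup (V k)]%classic; split.
  - exact: measurable_itv.
  - move=> s Vs; rewrite /= in_itv /=; apply/andP; split.
      by apply: ge_inf => //; case: hi.
    by apply: ub_le_sup => //; case: hs.
  - rewrite lebesgue_measure_itv /= lte_fin; case: ifP => _; last by rewrite mule0 ediam_ge0.
    rewrite -EFinB -EFinM -[leRHS]fineK// lee_fin mulrC -ler_pdivlMr//.
    by rewrite lerBlDl.
have mW k : measurable (W k) by have [] := HW k.
have EW : E `<=` \bigcup_k W k.
  move=> s Es; have [k _ Uk] := cov (g s) (imageP g Es).
  by exists k => //; have [_ + _] := HW k; apply.
have sub := measure_sigma_subadditive (@lebesgue_measure R) mW mE EW.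
apply: le_trans EL _.
apply: (@le_trans _ _ (c%:E * \sum_(0 <= k <oo) @lebesgue_measure R (W k)))%E.
  by rewrite lee_pmul2l// ?lte_fin.
rewrite -nneseriesZl//; apply: lee_nneseries => [k _ _|k _]; first by rewrite mule_ge0// lee_fin ltW.
by have [] := HW k.
Qed.

Lemma edist_pol_sqr (R : realType) (a b s t : R) :
  edist (pol a s) (pol b t) ^+ 2 = a ^+ 2 + b ^+ 2 - 2 * (a * b) * cos (s - t).
Proof.
rewrite sqr_sqrtr ?addr_ge0 ?sqr_ge0//= cosB.
have h1 := cos2Dsin2 s; have h2 := cos2Dsin2 t.
transitivity (a ^+ 2 * (cos s ^+ 2 + sin s ^+ 2) + b ^+ 2 * (cos t ^+ 2 + sin t ^+ 2) -
  2 * (a * b) * (cos s * cos t + sin s * sin t)); first by ring.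
by rewrite h1 h2 !mulr1.
Qed.

Lemma edist_pol_ge (R : realType) (a b s t : R) : 0 <= a -> 0 <= b ->
  `|a - b| <= edist (pol a s) (pol b t).
Proof.
move=> a0 b0; rewrite -(@ler_pXn2r _ 2) ?nnegrE ?euclid_ge0// edist_pol_sqr.
rewrite real_normK ?num_real//; have := cos_le1 (s - t); have := mulr_ge0 a0 b0.
move: (cos (s - t)) => c ab c1.
have -> : a ^+ 2 + b ^+ 2 - 2 * (a * b) * c = (a - b) ^+ 2 + 2 * ((a * b) * (1 - c)) by ring.
by rewrite lerDl mulr_ge0// mulr_ge0// subr_ge0.
Qed.

Lemma edist_pol_ray (R : realType) (a b t : R) : edist (pol a t) (pol b t) = `|a - b|.
Proof.
apply/eqP; rewrite -(@eqrXn2 _ 2) ?euclid_ge0// edist_pol_sqr real_normK ?num_real//.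
by rewrite subrr cos0; apply/eqP; ring.
Qed.

Lemma cos_half (R : realType) (x : R) : cos x = 1 - 2 * sin (x / 2) ^+ 2.
Proof.
have {1}-> : x = x / 2 + x / 2 by field.
by rewrite cosD; have := cos2Dsin2 (x / 2); lra.
Qed.

Lemma edist_pol_circle (R : realType) (a s t : R) : 0 <= a ->
  edist (pol a s) (pol a t) = 2 * a * `|sin ((s - t) / 2)|.
Proof.
move=> a0; apply/eqP; rewrite -(@eqrXn2 _ 2) ?euclid_ge0// ?mulr_ge0//.
rewrite edist_pol_sqr cos_half exprMn real_normK ?num_real//.
by apply/eqP; ring.
Qed.

Lemma sin_le_id (R : realType) (x : R) : 0 <= x -> sin x <= x.
Proof.
move=> x0; rewrite -subr_ge0.
have := @der_ge0_le _ (fun t => t - sin t) (fun t => 1 - cos t) 0 x x0.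
rewrite sin0 subr0; by apply => t _; rewrite subr_ge0 cos_le1.
Qed.

Lemma sin_ge_cos_mul (R : realType) (a x : R) : 0 <= x <= a -> a <= pi -> x * cos a <= sin x.
Proof.
move=> /andP[x0 xa] api; rewrite -subr_ge0.
have := @der_ge0_le _ (fun t => sin t - t * cos a) (fun t => cos t - cos a) 0 x x0.
rewrite sin0 mul0r subr0; apply => t.
  move=> _; have D := derB (is_derive_sin t) (derM (derI t) (derC t 1 (cos a))).
  by apply: is_derive_eq D _; rewrite mulr0 addr0 mul1r.
move=> /andP[t0 tx]; rewrite subr_ge0 leNgt; apply/negP.
by rewrite ltr_cos ?in_itv /=; lra.
Qed.

Lemma norm_sin_le (R : realType) (x : R) : `|sin x| <= `|x|.
Proof.
wlog x0 : x / 0 <= x => [W|].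
  have [|/ltW x0] := leP 0 x; first exact: W.
  by rewrite -[x]opprK sinN normrN [leRHS]normrN; apply: W; rewrite oppr_ge0.
rewrite (ger0_norm x0) ler_norml sin_le_id// andbT.
have [h|h] := leP x pi.
  have := @sin_ge0_pi _ x; rewrite x0 h => /(_ isT); lra.
have := sin_geN1 x; have := @pihalf_ge1 R; lra.
Qed.

Definition arc_circle (R : realType) (z : R) : set (R * R) := pol z @` `[0, 2 * pi].

Lemma fine_covers_circle (R : realType) (z : R) : 0 <= z ->
  fine_covers (arc_circle z) (z * (2 * pi)).
Proof.
move=> z0; apply: fine_covers_curve => //; first exact/ltW/twopi_gt0.
move=> s t _ _; rewrite edist_pol_circle// [2 * z]mulrC -mulrA ler_wpM2l//.
apply: le_trans (ler_wpM2l _ (norm_sin_le _)) _ => //.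
by rewrite normrM [`|2^-1|]ger0_norm// mulrCA divff// mulr1.
Qed.

(** An arc of angle [eta] is removed because parameters near 0 and near [2 pi] give close points. On
    the rest, a chord shorter than [2 z sin (eta / 2)] subtends at most [eta], and is then at least
    [z cos (eta / 2)] times its angle. *)
Lemma length_ge_circle (R : realType) (z eta : R) : 0 < z -> 0 < eta < pi ->
  length_ge (arc_circle z) (z * cos (eta / 2) * (2 * pi - eta)).
Proof.
move=> z0 /andP[e0 epi]; have pi0 := @pi_gt0 R.
have s0 : 0 < sin (eta / 2) by apply: sin_gt0_pi; lra.
have c0 : 0 < cos (eta / 2) by apply: cos_gt0_pihalf; lra.
apply: (@length_ge_sub _ (pol z @` `[0, 2 * pi - eta])).
  move=> _ [t /= tI <-]; exists t => //; move: tI; rewrite /= !in_itv /= => /andP[h1 h2].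
  by rewrite h1; lra.
have sg : 0 < 2 * z * sin (eta / 2) by rewrite !mulr_gt0.
near=> d; apply: (@covers_ge_curve _ _ `[0, 2 * pi - eta]%classic (z * cos (eta / 2)) _ 0 (2 * pi - eta)).
- by rewrite mulr_gt0.
- exact: measurable_itv.
- by [].
- rewrite lebesgue_measure_itv /= lte_fin ifT; last by lra.
  by rewrite -EFinB subr0 -EFinM.
move=> s t; rewrite /= !in_itv /= => /andP[s1 s2] /andP[t1 t2].
rewrite (edist_pol_circle _ _ (ltW z0)) => hd.
have : 2 * z * `|sin ((s - t) / 2)| < 2 * z * sin (eta / 2).
  by apply: le_lt_trans hd _; near: d; exact: nbhs_right_lt.
rewrite ltr_pM2l; last by rewrite mulr_gt0.
have -> : `|sin ((s - t) / 2)| = `|sin (`|s - t| / 2)|.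
  have [h|h] := leP 0 (s - t); first by rewrite (ger0_norm h).
  by rewrite (ltr0_norm h) mulNr sinN normrN.
have xI : `|s - t| <= 2 * pi - eta by rewrite ler_norml; lra.
have := normr_ge0 (s - t); move: `|s - t| xI => x x2 x1.
rewrite ger0_norm; last by apply: sin_ge0_pi; lra.
move=> slt.
have xe : x / 2 <= eta / 2.
  rewrite leNgt; apply/negP => h; move: slt; rewrite ltNge => /negP; apply.
  rewrite -!cosBpihalf.
  have [h1|h1] := leP (x / 2) (pi / 2).
    rewrite -[leLHS]cosN -[leRHS]cosN leNgt ltr_cos ?in_itv /=; lra.
  rewrite -[leLHS]cosN leNgt ltr_cos ?in_itv /=; lra.
have := @sin_ge_cos_mul _ (eta / 2) (x / 2); rewrite xe andbT divr_ge0// => /(_ isT) H.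
have {}H : x / 2 * cos (eta / 2) <= sin (x / 2) by apply: H; lra.
have : 2 * z * (x / 2 * cos (eta / 2)) <= 2 * z * sin (x / 2) by rewrite ler_pM2l// mulr_gt0.
by apply: le_trans; rewrite le_eqVlt; apply/orP; left; apply/eqP; field.
Unshelve. all: by end_near.
Qed.

(** The parameters of a radius that stay at distance [eta] from all the circles; each circle costs
    at most [2 eta] of length. *)
Lemma trimmed_interval (R : realType) (a b eta : R) (l : seq R) : a <= b -> 0 < eta ->
  exists E : set (measurableTypeR R), [/\ measurable E, E `<=` `[a, b],
    forall s z, E s -> z \in l -> eta <= `|s - z|
    & ((b - a - 2 * eta * (size l)%:R)%:E <= @lebesgue_measure R E)%E].
Proof.
move=> ab e0; elim: l => [|z l [E [mE Eab El Em]]].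
  exists `[a, b]%classic; split => //.
  rewrite mulr0 subr0 lebesgue_measure_itv /= lte_fin; case: ifP => [//|/negbT].
  by rewrite -leNgt lee_fin subr_le0.
pose I : set (measurableTypeR R) := `]z - eta, z + eta[%classic.
have mI : measurable I by exact: measurable_itv.
have mD : measurable (E `\` I) by exact: measurableD.
exists (E `\` I); split => //.
- by move=> s [/Eab].
- move=> s y [Es /= ns]; rewrite inE => /orP[/eqP ->|]; last exact: El.
  rewrite leNgt; apply/negP => h; apply: ns; rewrite /I /= in_itv /=.
  by move: h; rewrite ltr_norml; lra.
- have mI2 : @lebesgue_measure R I = (2 * eta)%:E.
    rewrite lebesgue_measure_itv /= lte_fin ifT; last by lra.
    by rewrite -EFinB; congr (_%:E); ring.
  have : (@lebesgue_measure R E <= @lebesgue_measure R (E `\` I) + (2 * eta)%:E)%E.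
    rewrite -mI2; apply: (@le_trans _ _ (@lebesgue_measure R ((E `\` I) `|` I))).
      apply: le_measure; rewrite ?inE//; first exact: measurableU.
      by move=> s Es; have [h|h] := pselect (I s); [right|left].
    exact: measureU2.
  move=> /(le_trans Em); rewrite -leeBlDr//; apply: le_trans.
  by rewrite -EFinB lee_fin /= -natr1; lra.
Qed.

Lemma far_apart_circles (R : realType) (z y : R) : 0 < z -> 0 < y -> z != y ->
  far_apart (arc_circle z) (arc_circle y).
Proof.
move=> z0 y0 zy.
have N : \forall d \near (0 : R)^'+, d < `|z - y|.
  by apply: nbhs_right_lt; rewrite normr_gt0 subr_eq0.
apply: filterS N => d hd p q [s _ <-] [t _ <-].
exact: lt_le_trans hd (edist_pol_ge _ _ (ltW z0) (ltW y0)).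
Qed.

Lemma far_apart_circle_ray (R : realType) (z th eta : R) (E : set R) : 0 < z -> 0 < eta ->
  (forall s, E s -> 0 <= s /\ eta <= `|s - z|) ->
  far_apart (arc_circle z) ((fun s => pol s th) @` E).
Proof.
move=> z0 e0 HE; have N : \forall d \near (0 : R)^'+, d < eta by exact: nbhs_right_lt.
apply: filterS N => d hd p q [s _ <-] [t Et <-].
have [t0 te] := HE _ Et; apply: lt_le_trans (edist_pol_ge _ _ (ltW z0) t0).
by rewrite distrC; exact: lt_le_trans hd te.
Qed.

(** By the law of cosines. The rays meet at the origin, whence the lower bound [eta] on the
    parameters. *)
Lemma far_apart_rays (R : realType) (th ph eta : R) (E : set R) : 0 < eta ->
  cos (th - ph) < 1 -> (forall s, E s -> eta <= s) ->
  far_apart ((fun s => pol s th) @` E) ((fun s => pol s ph) @` E).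
Proof.
move=> e0 c1 HE; pose sg := Num.sqrt (2 * eta ^+ 2 * (1 - cos (th - ph))).
have arg0 : 0 < 2 * eta ^+ 2 * (1 - cos (th - ph)).
  by rewrite mulr_gt0 ?subr_gt0// mulr_gt0// exprn_gt0.
have N : \forall d \near (0 : R)^'+, d < sg by apply: nbhs_right_lt; rewrite sqrtr_gt0.
apply: filterS N => d hd p q [s Es <-] [t Et <-]; apply: lt_le_trans hd _.
rewrite -(@ler_pXn2r _ 2) ?nnegrE ?euclid_ge0 ?sqrtr_ge0// edist_pol_sqr (sqr_sqrtr (ltW arg0)).
have s0 := HE _ Es; have t0 := HE _ Et.
have -> : s ^+ 2 + t ^+ 2 - 2 * (s * t) * cos (th - ph) =
    (s - t) ^+ 2 + 2 * (s * t) * (1 - cos (th - ph)) by ring.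
have h : eta ^+ 2 <= s * t by rewrite expr2; apply: ler_pM => //; exact: ltW.
apply: (@le_trans _ _ (2 * (s * t) * (1 - cos (th - ph)))); last by rewrite lerDr sqr_ge0.
by apply: ler_wpM2r; [rewrite subr_ge0; exact: ltW|exact: ler_wpM2l].
Qed.

Lemma cos_lt1 (R : realType) (x : R) : 0 < x < 2 * pi -> cos x < 1.
Proof.
move=> xI; have : 0 < sin (x / 2) by apply: sin_gt0_pi; lra.
move=> s0; rewrite cos_half gtrBl mulr_gt0// exprn_gt0//.
Qed.

Lemma lee_limit (R : realType) (F : R -> R) (e0 : R) (H : \bar R) : 0 < e0 ->
  {for 0, continuous F} -> (forall e, 0 < e < e0 -> ((F e)%:E <= H)%E) -> ((F 0)%:E <= H)%E.
Proof.
move=> e00 cF HF; have cF' : F x @[x --> 0^'+] --> F 0 by apply: cvg_at_right_filter.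
case: H HF => [h|_|HF]; last 2 first.
- by rewrite leey.
- by have := HF (e0 / 2)%R; rewrite divr_gt0// gtr_pMr// invf_lt1// ltr1n => /(_ isT).
move=> HF; rewrite lee_fin leNgt; apply/negP => hF.
have N : \forall e \near (0 : R)^'+, [/\ 0 < e, e < e0 & h < F e].
  near=> e; split; near: e; [exact: nbhs_right_gt|exact: nbhs_right_lt|exact: (cvgr_gt _ cF')].
have [e [h1 h2 h3]] := filter_ex N.
by have := HF e; rewrite h1 h2 => /(_ isT); rewrite lee_fin leNgt h3.
Unshelve. all: by end_near.
Qed.

(* The [m] nodal diameters are counted as [2 m] radii. *)
Definition circles_and_radii (R : realType) (r : R) (s : seq R) (m : nat) (t0 : R) :
    set (R * R) :=
  [set p | (exists2 z, z \in s & arc_circle z p) \/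
    exists2 j, (j < m.*2)%N & exists2 x, 0 <= x < r & p = pol x (t0 + j%:R * (pi / m%:R))].

Lemma hausdorff_circles_and_radii (R : realType) (r : R) (s : seq R) (m : nat) (t0 : R) :
  0 < r -> uniq s -> (forall z, z \in s -> 0 < z) ->
  hausdorff1 (circles_and_radii r s m t0) =
    (2 * pi * (\sum_(z <- s) z) + 2 * m%:R * r)%:E.
Proof.
move=> r0 us s0; pose th j := t0 + j%:R * (pi / m%:R) : R.
have pi0 := @pi_gt0 R.
have cardJ (c : R) : \sum_(j <- iota 0 m.*2) c = 2 * m%:R * c.
  by rewrite big_const_seq count_predT size_iota iter_addr_0 -[_ *+ _]mulr_natl -muln2 natrM [m%:R * _]mulrC.
apply/eqP; rewrite eq_le; apply/andP; split.
  apply: fine_covers_hausdorff.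
  apply: (@fine_covers_sub _ _ ([set p | exists2 z, z \in s & arc_circle z p] `|`
    [set p | exists2 j, j \in iota 0 m.*2 & ((fun x => pol x (th j)) @` `[0, r]) p])).
    move=> p [?|[j jm [x xI ->]]]; [by left|right; exists j; rewrite ?mem_iota//].
    by exists x => //; rewrite /= in_itv /=; move/andP : xI => [-> /ltW].
  apply: fine_coversU.
    rewrite mulr_sumr (eq_bigr (fun z => z * (2 * pi))) => [|z _]; last by rewrite mulrC.
    by apply: fine_covers_bigcup => z zs; apply: fine_covers_circle; exact/ltW/s0.
  rewrite -cardJ; apply: (@fine_covers_bigcup _ _ (iota 0 m.*2) _ (fun=> r)) => j _.
  have := @fine_covers_curve _ (fun x => pol x (th j)) 1 r ler01 (ltW r0).
  by rewrite mul1r; apply => x y _ _; rewrite edist_pol_ray mul1r.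
(* [F eta] bounds from below the length left after trimming, and [F 0] is the full length. *)
pose F eta : R := (\sum_(z <- s) z) * (cos (eta / 2) * (2 * pi - eta)) +
  2 * m%:R * (r - 2 * eta - 2 * eta * (size s)%:R).
have -> : 2 * pi * (\sum_(z <- s) z) + 2 * m%:R * r = F 0.
  by rewrite /F mul0r cos0 !mulr0 mul0r !subr0 mul1r mulrC.
have e00 : 0 < Num.min pi (r / 2) by rewrite lt_min pi0 divr_gt0.
apply: (lee_limit e00).
  have ch : {for (0 : R), continuous (fun e : R => cos (e / 2))}.
    apply: (@continuous_comp _ _ _ (fun e : R => e / 2) cos); last exact: continuous_cos.
    by apply: cvgM; [exact: cvg_id|exact: cvg_cst].
  apply: cvgD.
    apply: cvgM; first exact: cvg_cst.
    by apply: cvgM; [exact: ch|apply: cvgB; [exact: cvg_cst|exact: cvg_id]].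
  apply: cvgM; first exact: cvg_cst.
  apply: cvgB; last by apply: cvgM; [apply: cvgM; [exact: cvg_cst|exact: cvg_id]|exact: cvg_cst].
  by apply: cvgB; [exact: cvg_cst|apply: cvgM; [exact: cvg_cst|exact: cvg_id]].
move=> eta /andP[e0]; rewrite lt_min => /andP[epi er].
have [|E [mE Eab Es Em]] := @trimmed_interval _ eta (r - eta) eta s _ e0; first by lra.
have E1 x : E x -> eta <= x <= r - eta by move=> /Eab; rewrite /= in_itv.
apply: length_ge_hausdorff.
apply: (@length_ge_sub _ ([set p | exists2 z, z \in s & arc_circle z p] `|`
    [set p | exists2 j, j \in iota 0 m.*2 & ((fun x => pol x (th j)) @` E) p])).
  move=> p [?|[j jm [x /E1 xI <-]]]; [by left|right; exists j].
    by move: jm; rewrite mem_iota.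
  by exists x => //; lra.
apply: length_geU.
- apply: far_apart_bigcup => j _; apply/far_apart_sym/far_apart_bigcup => z zs.
  apply/far_apart_sym/(far_apart_circle_ray _ (s0 _ zs) e0) => x Ex.
  by split; [have := E1 _ Ex; lra|exact: Es].
- rewrite mulr_suml; apply: length_ge_bigcup => // [z zs|z y zs ys zy].
    by rewrite mulrA; apply: length_ge_circle; [exact: s0|rewrite e0].
  by apply: far_apart_circles => //; exact: s0.
- rewrite -cardJ; apply: (@length_ge_bigcup _ _ (iota 0 m.*2) _ (fun=> _)) => [|j _|i j].
  + exact: iota_uniq.
  + near=> d; apply: (@covers_ge_curve _ _ E 1 _ eta (r - eta)) => //.
      by rewrite mul1e; apply: le_trans Em; rewrite lee_fin; lra.
    by move=> x y _ _ _; rewrite mul1r edist_pol_ray.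
  + rewrite !mem_iota /= !add0n => im jm ij.
    apply: (@far_apart_rays _ _ _ eta) => // [|x /E1 /andP[]//].
    have m0 : 0 < m%:R :> R by rewrite ltr0n -double_gt0; apply: leq_ltn_trans im.
    rewrite /th; wlog ij' : i j im jm ij / (j < i)%N => [W|].
      have [h|h] := ltnP j i; first exact: W.
      by rewrite -cosN opprB; apply: W => //; rewrite 1?eq_sym// ltn_neqAle ij.
    have -> : t0 + i%:R * (pi / m%:R) - (t0 + j%:R * (pi / m%:R)) = (i - j)%:R * (pi / m%:R).
      by rewrite natrB ?(ltnW ij')//; ring.
    apply: cos_lt1; apply/andP; split.
      by rewrite mulr_gt0 ?ltr0n ?subn_gt0// divr_gt0.
    rewrite mulrA ltr_pdivrMr// mulrAC ltr_pM2r// -natrM ltr_nat mul2n.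
    exact: leq_ltn_trans (leq_subr _ _) im.
Unshelve. all: by end_near.
Qed.

(** * Nodal sets of eigenfunctions *)

(** De Moivre's formula. *)
Lemma cpow_pol1 (R : realType) (m : nat) (th : R) :
  cpow m (pol 1 th) = pol 1 (m%:R * th).
Proof.
rewrite /pol !mul1r; elim: m => [|m IH]; first by rewrite mul0r cos0 sin0.
by rewrite [LHS]/= IH /= -natr1 mulrDl mul1r cosD sinD; congr pair; ring.
Qed.

(** The numbers [cos (m t)] and [sin (m t)] are polynomials in [cos t] and [sin t], so a harmonic
    depends only on the point of the unit circle. This frees angles from the interval
    [[0, 2 pi]]. *)
Lemma harm_pol (R : realType) (m : nat) (ph s t : R) :
  pol 1 s = pol 1 t -> harm m ph s = harm m ph t.
Proof.
move=> st; have := congr1 (cpow m) st; rewrite !cpow_pol1 /pol !mul1r /harm !cosD.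
by move=> [-> ->].
Qed.

Lemma dirichlet_polar_all (R : realType) (r lam : R) (u : R * R -> R) :
  0 < r -> 0 < lam -> dirichlet_eigenfunction r lam u ->
  exists m C ph, [/\ C != 0, bzero m (Num.sqrt lam * r), (m = 0%N -> ph = 0) &
    forall rho th, 0 <= rho < r ->
      u (pol rho th) = C * bess m (Num.sqrt lam * rho) * harm m ph th].
Proof.
move=> r0 lam0 /(dirichlet_polar r0 lam0)[m [C [ph [C0 bz m0 H]]]].
exists m, C, ph; split => // rho th rhor.
have [a [t [a0 /andP[t0 t2] E]]] := polar_exists (pol 1 th).
have a1 : a = 1.
  apply/eqP; rewrite -(@eqrXn2 _ 2)//; apply/eqP.
  by rewrite -(pol_norm2 a t) -E pol_norm2.
rewrite a1 in E; rewrite (harm_pol _ _ E) -(H _ _ rhor); last by rewrite t0 ltW.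
by congr (u _); move: E; rewrite /pol !mul1r => -[-> ->].
Qed.

Lemma cosD_pi_nat (R : realType) (a : R) (j : nat) : cos (a + j%:R * pi) = (-1) ^+ j * cos a.
Proof.
elim: j => [|j IH]; first by rewrite mul0r addr0 mul1r.
by rewrite -natr1 mulrDl mul1r addrA cosDpi IH exprS mulN1r mulNr.
Qed.

Lemma sinD_pi_nat (R : realType) (a : R) (j : nat) : sin (a + j%:R * pi) = (-1) ^+ j * sin a.
Proof.
elim: j => [|j IH]; first by rewrite mul0r addr0 mul1r.
by rewrite -natr1 mulrDl mul1r addrA sinDpi IH exprS mulN1r mulNr.
Qed.

Lemma sin_eq0_nat (R : realType) (y : R) : 0 <= y -> sin y = 0 ->
  exists i : nat, y = i%:R * pi.
Proof.
move=> y0 sy; have pi0 := @pi_gt0 R.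
have yp : 0 <= y / pi by rewrite divr_ge0// ltW.
have /andP[h1 h2] := truncn_itv yp; set i := Num.truncn _ in h1 h2.
exists i; move: h1 h2; rewrite ler_pdivlMr// ltr_pdivrMr// -natr1 => h1 h2.
apply/eqP; rewrite eq_sym eq_le h1 /= leNgt; apply/negP => h3.
have : 0 < sin (y - i%:R * pi) by apply: sin_gt0_pi; lra.
have E : y = (y - i%:R * pi) + i%:R * pi by ring.
move: sy; rewrite {1}E sinD_pi_nat => /eqP.
by rewrite mulf_eq0 expf_eq0 oppr_eq0 oner_eq0 andbF /= => /eqP ->; rewrite ltxx.
Qed.

(** A zero [t0 <= 0] precedes every angle of [[0, 2 pi[], so that the zeros there are reached from
    it by natural multiples of [pi / m]. *)
Lemma harm_zero_exists (R : realType) (m : nat) (ph : R) : (0 < m)%N ->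
  exists2 t0, t0 <= 0 & harm m ph t0 = 0.
Proof.
move=> m0; have mR : m%:R != 0 :> R by rewrite pnatr_eq0 -lt0n.
pose a := (pi / 2 - ph) / m%:R.
have := archi_boundP (normr_ge0 a); set N := Num.bound _ => aN.
exists (a - N%:R * (2 * pi)).
  have := ler_norm a; have : N%:R * 1 <= N%:R * (2 * pi) :> R.
    by rewrite ler_wpM2l//; have := @pihalf_ge1 R; lra.
  lra.
rewrite /harm -(cos_periodic_nat (m * N)%N) natrM.
have -> : m%:R * N%:R * (2 * pi) + (m%:R * (a - N%:R * (2 * pi)) + ph) = pi / 2.
  by rewrite /a; field.
exact: cos_pihalf.
Qed.

Lemma harm_zeros (R : realType) (m : nat) (ph t0 t : R) : (0 < m)%N -> t0 <= t ->
  harm m ph t0 = 0 -> harm m ph t = 0 ->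
  exists2 j, (j < m.*2)%N & forall rho, pol rho t = pol rho (t0 + j%:R * (pi / m%:R)).
Proof.
move=> m0 tt h0 h1; have mR : 0 < m%:R :> R by rewrite ltr0n.
have [||i E] := @sin_eq0_nat R (m%:R * (t - t0)).
- by rewrite mulr_ge0 ?subr_ge0// ltW.
- have s0 : sin (m%:R * t0 + ph) != 0.
    apply/eqP => s0; have := cos2Dsin2 (m%:R * t0 + ph).
    by move: h0; rewrite /harm s0 => ->; rewrite expr0n addr0 => /eqP; rewrite eq_sym oner_eq0.
  move: h1; rewrite /harm (_ : m%:R * t + ph = (m%:R * t0 + ph) + m%:R * (t - t0)); last by ring.
  rewrite cosD; move: h0; rewrite /harm => ->; rewrite mul0r sub0r => /eqP.
  by rewrite oppr_eq0 mulf_eq0 (negbTE s0) => /eqP.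
(* [2 m] steps of [pi / m] make a full turn. *)
exists (i %% m.*2)%N; first by rewrite ltn_mod double_gt0.
move=> rho; have -> : t = (i %/ m.*2)%:R * (2 * pi) + (t0 + (i %% m.*2)%:R * (pi / m%:R)).
  have -> : t = t0 + i%:R * (pi / m%:R) by rewrite mulrA -E; field; rewrite gt_eqF.
  rewrite {1}(divn_eq i m.*2) natrD natrM -muln2 natrM; field; by rewrite gt_eqF.
by rewrite /pol cos_periodic_nat sin_periodic_nat.
Qed.

Lemma nodal_set_eq (R : realType) (r lam C ph : R) (m : nat) (u : R * R -> R) (l : seq R) :
  0 < r -> 0 < lam -> C != 0 -> (m = 0%N -> ph = 0) ->
  (forall rho th, 0 <= rho < r ->
      u (pol rho th) = C * bess m (Num.sqrt lam * rho) * harm m ph th) ->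
  bzeros_below m (Num.sqrt lam * r) l ->
  exists t0, nodal_set r u =
    circles_and_radii r [seq t / Num.sqrt lam | t <- l] m t0.
Proof.
move=> r0 lam0 C0 ph0 H [ul ml]; set k := Num.sqrt lam in H ml *.
have k0 : 0 < k by rewrite sqrtr_gt0.
have [t0 t00 ht0] : exists2 t0, t0 <= 0 & (0 < m)%N -> harm m ph t0 = 0.
  by case: (m) => [|m']; [exists 0|have [t0 h1 h2] := @harm_zero_exists R m'.+1 ph isT; exists t0].
exists t0; apply/seteqP; split => p.
  move=> [/(disc_polar r0)[rho [th [rhor thI ->]]]].
  rewrite H// => /eqP; rewrite !mulf_eq0 (negbTE C0) /= => /orP[bz|/eqP hz]; last first.
    have m0 : (0 < m)%N.
      case: (posnP m) => // m0; move: hz; rewrite /harm (ph0 m0) m0 mul0r addr0 cos0 => /eqP.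
      by rewrite oner_eq0.
    have [|j jm Ej] := @harm_zeros _ m ph t0 th m0 _ (ht0 m0) hz.
      by case/andP: thI => th0 _; exact: le_trans t00 th0.
    by right; exists j => //; exists rho => //; exact: Ej.
  (* The centre is a zero only if [m > 0], and it is then the end of the radius of index 0. *)
  move: rhor => /andP[]; rewrite le_eqVlt => /orP[/eqP rho0 _|rho0 rhor].
    right; case: (posnP m) => m0.
      have b00 : bess 0 0 = 1 :> R.
        by rewrite /bess expr0 mul1r expr0n mul0r oppr0 phi0 fact0 invr1.
      by move: bz; rewrite -rho0 m0 (mulr0 k) -mulf_eq0 -/(bess 0 0) b00 oner_eq0.
    exists 0%N; first by rewrite double_gt0.
    by exists 0; rewrite ?lexx// -rho0 /pol !mul0r.
  left; exists rho; last by exists th => //; rewrite /= in_itv /=; case/andP: thI => -> /ltW.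
  apply/mapP; exists (k * rho); last by rewrite mulrC mulKf// gt_eqF.
  apply/ml; split; last by rewrite ltr_pM2l.
  split; first exact: mulr_gt0.
  by move: bz; rewrite expf_eq0 gt_eqF ?mulr_gt0// andbF => /eqP.
move=> [[z /mapP[t /ml[[t_gt0 pt] tk] ->] [th _ <-]]|[j jm [x xr ->]]].
  have zr : 0 <= t / k < r by rewrite divr_ge0 ?ltW//= ltr_pdivrMr// mulrC.
  split; first by apply: disc_pol; rewrite ger0_norm; case/andP: zr.
  by rewrite H// [k * _]mulrC divfK ?gt_eqF// /bess pt mulr0 mulr0 mul0r.
have m0 : (0 < m)%N by rewrite -double_gt0; apply: leq_ltn_trans jm.
split; first by apply: disc_pol; case/andP: xr => x0 xr; rewrite ger0_norm.
rewrite H// (_ : harm _ _ _ = 0) ?mulr0//.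
rewrite /harm (_ : _ + ph = (m%:R * t0 + ph) + j%:R * pi).
  by rewrite cosD_pi_nat; have := ht0 m0; rewrite /harm => ->; rewrite mulr0.
by field; rewrite pnatr_eq0 -lt0n.
Qed.

Lemma nodal_ratio (R : realType) (r lam : R) (u : R * R -> R) :
  0 < r -> 0 < lam -> dirichlet_eigenfunction r lam u ->
  let k := Num.sqrt lam * r in
  exists m, bzero m k /\ forall l, bzeros_below m k l ->
    (hausdorff1 (nodal_set r u) * (Num.sqrt lam)^-1%:E)%E =
    ((2 * pi * (\sum_(t <- l) t) + 2 * m%:R * k) / k ^+ 2 * r ^+ 2)%:E.
Proof.
move=> r0 lam0 /(dirichlet_polar_all r0 lam0)[m [C [ph [C0 bz m0 H]]]] k.
exists m; split => // l bl.
have [t0 ->] := nodal_set_eq r0 lam0 C0 m0 H bl.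
have k0 : 0 < Num.sqrt lam by rewrite sqrtr_gt0.
have [ul ml] := bl.
rewrite hausdorff_circles_and_radii//.
- rewrite -EFinM big_map -mulr_suml /k; congr (_%:E).
  by move: (\sum_(t <- l) t) => S; field; rewrite !gt_eqF.
- by rewrite map_inj_uniq// => x y /(mulIf _); apply; rewrite invr_eq0 gt_eqF.
- by move=> z /mapP[t /ml[[t_gt0 _] _] ->]; rewrite divr_gt0.
Qed.

(** * Area of the disc *)

Lemma xsection_disc (R : realType) (r x : R) :
  @lebesgue_measure R (xsection (disc r) x) = (2 * Num.sqrt (r ^+ 2 - x ^+ 2))%:E.
Proof.
have E : xsection (disc r) x = `]- Num.sqrt (r ^+ 2 - x ^+ 2), Num.sqrt (r ^+ 2 - x ^+ 2)[%classic.
  apply/seteqP; split => y; rewrite /xsection /= in_setE /disc /= in_itv /= -ltr_norml.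
    by move=> h; have y0 := sqr_ge0 y; rewrite -sqrtr_sqr ltr_sqrt; lra.
  rewrite -{1}sqrtr_sqr => h.
  have s0 : 0 < r ^+ 2 - x ^+ 2.
    by rewrite -sqrtr_gt0; apply: le_lt_trans h; exact: sqrtr_ge0.
  by move: h; rewrite ltr_sqrt//; lra.
rewrite E lebesgue_measure_itv /= lte_fin; case: ifP => h.
  by rewrite -EFinB; congr (_%:E); ring.
(* Here the interval is empty and the square root is 0, its value at nonpositive numbers. *)
have := sqrtr_ge0 (r ^+ 2 - x ^+ 2); move: h => /negbT; rewrite -leNgt => h1 h2.
by congr (_%:E); lra.
Qed.

(** The lengths of the sections are integrated by the substitution [x = r sin t]. *)
Lemma area_disc (R : realType) (r : R) : 0 < r -> area (disc r) = (pi * r ^+ 2)%:E.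
Proof.
move=> r0; rewrite /area /product_measure1.
transitivity (\int[@lebesgue_measure R]_(x in `[(- r)%R, r])
    (2 * Num.sqrt (r ^+ 2 - x ^+ 2))%:E)%E.
  rewrite [RHS]integral_mkcond; apply: eq_integral => x _ /=.
  rewrite patchE; case: ifPn => [_|]; first exact: xsection_disc.
  rewrite notin_setE /= in_itv /= -ler_norml => /negP; rewrite -ltNge => h.
  rewrite (xsection_disc r x) ler0_sqrtr ?mulr0// subr_le0 -[x ^+ 2]real_normK ?num_real//.
  by rewrite ler_sqr ?nnegrE ?ltW// (lt_trans r0).
pose F (t : R) := r * sin t.
have pi0 := @pi_gt0 R.
have dF (t : R) : is_derive t 1 F (r * cos t) by exact: derZ (is_derive_sin t).
have F' : derive1 F = (fun t => r * cos t).
  by apply/funext => t; rewrite derive1E; have [_ ->] := dF t.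
have cF' : continuous (fun t : R => r * cos t).
  by move=> t; apply: cvgM; [exact: cvg_cst|exact: continuous_cos].
have cF (t : R) : F x @[x --> t] --> F t by exact: der_cvg (dF t).
have Fr : F (pi / 2) = r by rewrite /F sin_pihalf mulr1.
have FNr : F (- (pi / 2)) = - r by rewrite /F sinN sin_pihalf mulrN1.
pose G (x : R) := 2 * Num.sqrt (r ^+ 2 - x ^+ 2).
have cG : continuous G.
  move=> x; apply: cvgM; first exact: cvg_cst.
  apply: (@continuous_comp _ _ _ (fun x : R => r ^+ 2 - x ^+ 2) Num.sqrt).
    by apply: cvgB; [exact: cvg_cst|exact: exprn_continuous].
  exact: sqrt_continuous.
have := @integration_by_substitution_increasing R F G (- (pi / 2)) (pi / 2) _ _ _ _ _ _ _.
rewrite Fr FNr => ->; first last.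
- exact: continuous_subspaceT.
- split; first by move=> t _; have [] := dF t.
    exact: cvg_at_right_filter.
  exact: cvg_at_left_filter.
- by rewrite F'; apply: cvgP; apply: cvg_at_left_filter; exact: cF'.
- by rewrite F'; apply: cvgP; apply: cvg_at_right_filter; exact: cF'.
- by rewrite F' => t _; exact: cF'.
- move=> s t; rewrite !in_itv /= => /andP[s1 s2] /andP[t1 t2] st.
  by rewrite /F ltr_pM2l// ltr_sin// in_itv /= ?s1 ?s2 ?t1 ?t2.
- by lra.
pose K (t : R) := r ^+ 2 * (t + sin t * cos t).
transitivity (\int[@lebesgue_measure R]_(t in `[(- (pi / 2))%R, (pi / 2)%R])
    (2 * r ^+ 2 * cos t ^+ 2)%:E)%E.
  apply: eq_integral => t; rewrite inE /= in_itv /= => tI; congr (_%:E); rewrite F' /G /F /=.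
  transitivity (2 * Num.sqrt (r ^+ 2 - (r * sin t) ^+ 2) * (r * cos t)); first by [].
  have -> : r ^+ 2 - (r * sin t) ^+ 2 = (r * cos t) ^+ 2.
    by rewrite !exprMn -{1}[r ^+ 2]mulr1 -(cos2Dsin2 t); ring.
  rewrite sqrtr_sqr ger0_norm; first by ring.
  by rewrite mulr_ge0 ?(ltW r0)// cos_ge0_pihalf.
have dK (t : R) : is_derive t 1 K (2 * r ^+ 2 * cos t ^+ 2).
  have D := derZ (r ^+ 2) (derD (derI t) (derM (is_derive_sin t) (is_derive_cos t))).
  by apply: is_derive_eq D _; rewrite -{1}(cos2Dsin2 t); ring.
rewrite (@continuous_FTC2 _ _ K); first last.
- by move=> t _; rewrite derive1E; have [_ ->] := dK t.
- have cK (t : R) : K x @[x --> t] --> K t by exact: der_cvg (dK t).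
  split; first by move=> t _; have [] := dK t.
    exact: cvg_at_right_filter.
  exact: cvg_at_left_filter.
- apply: continuous_subspaceT => t; apply: cvgM; first exact: cvg_cst.
  by rewrite /GRing.exp /=; apply: cvgM; exact: continuous_cos.
- by lra.
rewrite -EFinB /K cosN cos_pihalf; congr (_%:E); by field.
Qed.

(** * The extreme nodal ratios *)

Lemma ratio_upper (R : realType) (r Lam : R) (e : \bar R) : 0 < r -> 0 < Lam ->
  nodal_ratios r Lam e -> (e <= (2 * r ^+ 2)%:E)%E.
Proof.
move=> r0 L0 [lam [u [Ll E ->]]]; have lam0 := lt_le_trans L0 Ll.
have [m [bz H]] := nodal_ratio r0 lam0 E.
have k0 : 0 < Num.sqrt lam * r by rewrite mulr_gt0// sqrtr_gt0.
have [l bl] := bzeros_below_exists bz.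
rewrite (H _ bl) lee_fin ler_wpM2r ?sqr_ge0// ler_pdivrMr ?exprn_gt0//.
exact: bzeros_upper.
Qed.

Lemma sqrt_scale_ge (R : realType) (r X Lam lam : R) : 0 < r -> 0 <= X ->
  (X / r) ^+ 2 <= Lam -> Lam <= lam -> X <= Num.sqrt lam * r.
Proof.
move=> r0 X0 XL Ll; rewrite -ler_pdivrMr//.
have xr0 : 0 <= X / r by rewrite divr_ge0// ltW.
rewrite -[leLHS](ger0_norm xr0) -sqrtr_sqr; apply: ler_wsqrtr.
exact: le_trans XL Ll.
Qed.

Lemma ratio_lower (R : realType) (r e : R) : 0 < r -> 0 < e ->
  exists2 L : R, 0 < L & forall Lam x, L <= Lam -> nodal_ratios r Lam x ->
    (((1 - e) * r ^+ 2)%:E <= x)%E.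
Proof.
move=> r0 /bzeros_lower[X X0 HX]; exists ((X / r) ^+ 2); first by rewrite exprn_gt0// divr_gt0.
move=> Lam x XL [lam [u [Ll E ->]]].
have lam0 : 0 < lam by apply: lt_le_trans (le_trans XL Ll); rewrite exprn_gt0// divr_gt0.
have [m [bz H]] := nodal_ratio r0 lam0 E.
have k0 : 0 < Num.sqrt lam * r by rewrite mulr_gt0// sqrtr_gt0.
have [l bl] := bzeros_below_exists bz.
rewrite (H _ bl) lee_fin ler_wpM2r ?sqr_ge0// ler_pdivlMr ?exprn_gt0//.
by apply: HX => //; exact: sqrt_scale_ge (ltW X0) XL Ll.
Qed.

(** The eigenvalue is [(k / r) ^ 2]. The ratio is known for the mode of the eigenfunction found,
    which is [m] by [bzero_inj]. *)
Lemma ratio_of_bzero (R : realType) (r Lam k : R) (m : nat) (l : seq R) : 0 < r ->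
  Num.sqrt Lam * r <= k -> 0 <= Lam -> bzero m k -> bzeros_below m k l ->
  nodal_ratios r Lam (((2 * pi * (\sum_(t <- l) t) + 2 * m%:R * k) / k ^+ 2 * r ^+ 2)%:E).
Proof.
move=> r0 Lk L0 bz bl; have k0 : 0 < k by case: bz.
have kr0 : 0 < k / r by exact: divr_gt0.
have sk : Num.sqrt ((k / r) ^+ 2) = k / r by rewrite sqrtr_sqr gtr0_norm.
have kE : Num.sqrt ((k / r) ^+ 2) * r = k by rewrite sk divfK// gt_eqF.
have lam0 : 0 < (k / r) ^+ 2 by rewrite exprn_gt0.
have [u E] : exists u, dirichlet_eigenfunction r ((k / r) ^+ 2) u.
  by apply: (@eigenfunction_exists _ _ _ m) => //; rewrite kE.
exists ((k / r) ^+ 2), u; split => //.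
  by rewrite -(sqr_sqrtr L0) ler_sqr ?nnegrE ?sqrtr_ge0 ?(ltW kr0)// ler_pdivlMr.
have [n [bn H]] := nodal_ratio r0 lam0 E; rewrite kE in bn H.
by rewrite (bzero_inj bz bn) in bl *; rewrite (H _ bl).
Qed.

(** In mode 1 the radii contribute [2 k], which is at most [e k ^ 2] as soon as [k >= 2 / e]. *)
Lemma ratio_small (R : realType) (r Lam e : R) : 0 < r -> 0 <= Lam -> 0 < e ->
  exists2 x, nodal_ratios r Lam x & (x <= ((1 + e) * r ^+ 2)%:E)%E.
Proof.
move=> r0 L0 e0; have [k kB bz] := @bzero_unbounded R 1 (Num.max (Num.sqrt Lam * r) (2 / e)).
move: kB; rewrite ge_max => /andP[k1 k2].
have [l bl] := bzeros_below_exists bz; have k0 : 0 < k by case: bz.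
exists (((2 * pi * (\sum_(t <- l) t) + 2 * 1%:R * k) / k ^+ 2 * r ^+ 2)%:E).
  exact: ratio_of_bzero.
rewrite lee_fin ler_wpM2r ?sqr_ge0// ler_pdivrMr ?exprn_gt0//.
have -> : (1 + e) * k ^+ 2 = k ^+ 2 + e * k ^+ 2 by ring.
apply: lerD; first exact: bzeros_upper1.
by rewrite mulr1 expr2 mulrA; apply: ler_wpM2r; [exact: ltW|rewrite [e * k]mulrC -ler_pdivrMr].
Qed.

Lemma ratio_large (R : realType) (r Lam e : R) : 0 < r -> 0 <= Lam -> 0 < e ->
  exists2 x, nodal_ratios r Lam x & (((2 - e) * r ^+ 2)%:E <= x)%E.
Proof.
move=> r0 L0 /(bzero_first_ratio (Num.sqrt Lam * r))[m [k [m0 k1 bz bl H]]].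
have k0 : 0 < k by case: bz.
exists (((2 * pi * (\sum_(t <- [::]) t) + 2 * m%:R * k) / k ^+ 2 * r ^+ 2)%:E).
  exact: ratio_of_bzero.
rewrite lee_fin ler_wpM2r ?sqr_ge0// ler_pdivlMr ?exprn_gt0//.
by rewrite big_nil mulr0 add0r.
Qed.

(** Convergence to a real number in the extended reals includes finiteness of the values near
    infinity, which the case [e = 1] gives. *)
Lemma cvge_squeeze (R : realType) (f : R -> \bar R) (a c : R) : 0 < c ->
  (forall e, 0 < e -> \forall L \near +oo, ((a - e * c)%:E <= f L <= (a + e * c)%:E)%E) ->
  f L @[L --> +oo] --> a%:E.
Proof.
move=> c0 H; apply/fine_cvgP; split.
  apply: filterS (H 1 ltr01) => L /andP[h1 h2].
  by rewrite fin_numE; apply/andP; split; apply/eqP => E; move: h1 h2; rewrite E.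
apply/cvgrPdist_le => e e0; have ec : 0 < e / c by exact: divr_gt0.
apply: filterS (H _ ec) => L; rewrite divfK ?gt_eqF// => /andP[].
rewrite /comp; case: (f L) => [x| |] //=; rewrite !lee_fin => h1 h2.
by rewrite ler_norml; lra.
Qed.

Theorem corollary2 (R : realType) (r : R) (hr : 0 < r) :
  [/\ ereal_inf (nodal_ratios r Lambda) @[Lambda --> +oo] --> H1_disc r,
      H1_disc r = (r ^+ 2)%:E
    & H1_disc r = ((pi^-1)%:E * area (disc r))%E] /\
  [/\ ereal_sup (nodal_ratios r Lambda) @[Lambda --> +oo] --> H2_disc r,
      H2_disc r = (2 * r ^+ 2)%:E
    & H2_disc r = ((2 / pi)%:E * area (disc r))%E].
Proof.
have r2 : 0 < r ^+ 2 by rewrite exprn_gt0.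
have pin0 : pi != 0 :> R by rewrite gt_eqF// pi_gt0.
(* The lower estimate holds for every eigenfunction of large eigenvalue; for the upper one, a single
   eigenfunction beyond each [Lambda] is exhibited. *)
have c1 : ereal_inf (nodal_ratios r Lambda) @[Lambda --> +oo] --> (r ^+ 2)%:E.
  apply: (cvge_squeeze r2) => e e0; have [L L0 HL] := ratio_lower hr e0.
  near=> Lam.
  have LL : L <= Lam by near: Lam; apply: nbhs_pinfty_ge; exact: num_real.
  apply/andP; split.
    apply: le_ereal_inf_tmp => x /(HL _ _ LL); apply: le_trans.
    by rewrite lee_fin; lra.
  have [x Sx xe] := ratio_small hr (le_trans (ltW L0) LL) e0.
  apply: (@le_trans _ _ x); first exact: ereal_inf_lbound.
  by apply: le_trans xe _; rewrite lee_fin; lra.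
have c2 : ereal_sup (nodal_ratios r Lambda) @[Lambda --> +oo] --> (2 * r ^+ 2)%:E.
  apply: (cvge_squeeze r2) => e e0; near=> Lam.
  have L0 : 0 < Lam by near: Lam; apply: nbhs_pinfty_gt; exact: num_real.
  apply/andP; split.
    have [x Sx xe] := ratio_large hr (ltW L0) e0.
    apply: (@le_trans _ _ x); last exact: ereal_sup_ubound.
    by apply: le_trans xe; rewrite lee_fin; lra.
  apply: ge_ereal_sup => x /(ratio_upper hr L0) h; apply: le_trans h _.
  by rewrite lee_fin lerDl mulr_ge0// ltW.
have E1 : H1_disc r = (r ^+ 2)%:E by exact: cvg_lim c1.
have E2 : H2_disc r = (2 * r ^+ 2)%:E by exact: cvg_lim c2.
rewrite area_disc// E1 E2 -!EFinM; split; split => //.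
  by rewrite mulrA mulVf// mul1r.
by congr (_%:E); rewrite [RHS]mulrA divfK.
Unshelve. all: by end_near.
Qed.
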